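(* For every integer $r\ge1$, every $\varepsilon\in(0,1)$ and every $K\ge 1$ there exist constants $c,C>0$ depending only on $\varepsilon,K,r$ such that the following holds. Let $n_1,\dots,n_r\ge 1$ be integers and let $T\in\mathbb R^{n_1\times\cdots\times n_r}$ be a random tensor whose entries are i.i.d. copies of a mean-zero random variable $Z$ with $\sigma^2:=\mathbb E Z^2<\infty$ and $\mathbb E|Z|^{2+\varepsilon}\le K\sigma^{2+\varepsilon}$. Then $$c\,Q\le\mathbb E\,\|T\|_{\mathrm{inj}}\le C\,Q,\qquad Q:=\sigma\cdot\max_{i\in[r]}\sqrt{n_i}+\mathbb E\max_{i_1\in[n_1],\dots,i_r\in[n_r]}|T_{i_1,\dots,i_r}| .$$
   Context: $[n]=\{1,\dots,n\}$. The injective norm of $T\in\mathbb R^{n_1\times\cdots\times n_r}$ is $\|T\|_{\mathrm{inj}}=\max\{|\langle T,x_1\otimes\cdots\otimes x_r\rangle| : x_k\in\mathbb R^{n_k},\ \|x_k\|_2=1 \text{ for all } k\in[r]\}$, where $\langle\cdot,\cdot\rangle$ is the entrywise (Euclidean) inner product. *)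

(* Defs.v *)
From HB Require Import structures.
From mathcomp Require Export all_boot all_order all_algebra.
From mathcomp Require Export all_classical all_reals all_analysis.
Set Implicit Arguments.
Unset Strict Implicit.
Unset Printing Implicit Defensive.
Export Order.TTheory GRing.Theory Num.Theory.
Export numFieldNormedType.Exports.
Local Open Scope classical_set_scope.
Local Open Scope ring_scope.

Definition tensor_index (r : nat) (n : 'I_r -> nat) : finType :=
  {dffun forall k : 'I_r, 'I_(n k)}.

Definition tensor (R : realType) (r : nat) (n : 'I_r -> nat) : Type :=
  tensor_index n -> R.

Definition tensor_dot (R : realType) (r : nat) (n : 'I_r -> nat)
    (S T : tensor R n) : R :=
  \sum_(i : tensor_index n) S i * T i.

Definition rank_one (R : realType) (r : nat) (n : 'I_r -> nat)
    (x : forall k : 'I_r, 'rV[R]_(n k)) : tensor R n :=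
  fun i => \prod_(k < r) x k ord0 (i k).

(* The library norm on 'rV[R]_m is the sup norm, hence this definition. *)
Definition l2norm (R : realType) (m : nat) (x : 'rV[R]_m) : R :=
  Num.sqrt (\sum_(j < m) x ord0 j ^+ 2).

(* The supremum is a maximum when all n k are positive: see inj_norm_max. *)
Definition inj_norm (R : realType) (r : nat) (n : 'I_r -> nat)
    (T : tensor R n) : R :=
  sup [set y | exists2 x : forall k : 'I_r, 'rV[R]_(n k),
         forall k, l2norm (x k) = 1 & y = `|tensor_dot T (rank_one x)|].

Definition max_abs_entry (R : realType) (r : nat) (n : 'I_r -> nat)
    (T : tensor R n) : R :=
  \big[Num.max/0]_(i : tensor_index n) `|T i|.

Definition max_sqrt_dim (R : realType) (r : nat) (n : 'I_r -> nat) : R :=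
  \big[Num.max/0]_(k < r) Num.sqrt (n k)%:R.

Definition mutually_independent (R : realType) (d : measure_display)
    (Omega : measurableType d) (P : probability Omega R) (I : finType)
    (X : I -> {RV P >-> R}) : Prop :=
  forall (J : {set I}) (B : I -> set R),
    (forall i, measurable (B i)) ->
    P (\bigcap_(i in [set i | i \in J]) (X i @^-1` B i)) =
    (\prod_(i in J) P (X i @^-1` B i))%E.

Definition same_law (R : realType) (d d' : measure_display)
    (Omega : measurableType d) (P : probability Omega R)
    (Omega' : measurableType d') (P' : probability Omega' R)
    (X : {RV P >-> R}) (Z : {RV P' >-> R}) : Prop :=
  forall A : set R, measurable A -> distribution P X A = distribution P' Z A.

Definition iid_copies (R : realType) (d d' : measure_display)
    (Omega : measurableType d) (P : probability Omega R)
    (Omega' : measurableType d') (P' : probability Omega' R)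
    (I : finType) (X : I -> {RV P >-> R}) (Z : {RV P' >-> R}) : Prop :=
  mutually_independent X /\ forall i, same_law (X i) Z.

Lemma l2norm_delta (R : realType) (m : nat) (j : 'I_m) :
  l2norm (delta_mx ord0 j : 'rV[R]_m) = 1.
Proof.
rewrite /l2norm (bigD1 j) //= mxE !eqxx /= expr1n big1 ?addr0 ?sqrtr1 //.
by move=> i ij; rewrite mxE (negbTE ij) andbF expr0n.
Qed.

Lemma l2norm_continuous (R : realType) (m : nat) : continuous (@l2norm R m).
Proof.
move=> x; rewrite /l2norm.
apply: (@continuous_comp _ _ _ (fun x : 'rV[R]_m => \sum_(j < m) x ord0 j ^+ 2)
  Num.sqrt); last exact: sqrt_continuous.
apply: (@continuous_big R^o) => [|j _]; first exact: add_continuous.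
move=> y.
apply: (@continuous_comp _ _ _ (fun x : 'rV[R]_m => x ord0 j) (fun y => y ^+ 2)).
  exact: coord_continuous.
exact: exprn_continuous.
Qed.

Lemma compact_l2sphere (R : realType) (m : nat) :
  compact [set x : 'rV[R]_m | l2norm x = 1].
Proof.
apply: bounded_closed_compact; last first.
  apply: (@preimage_closed _ _ (@l2norm R m) [set 1 : R]); last exact: closed_eq.
  move=> x _; exact: l2norm_continuous.
exists 1; split => // M M1 x /= x1.
rewrite [leLHS]mx_normrE; apply/bigmax_leP.
split => [|[i j] _ /=]; first by rewrite ltW // (lt_trans ltr01).
rewrite (le_trans _ (ltW M1)) // -x1 /l2norm -sqrtr_sqr ler_wsqrtr //.
rewrite (ord1 i) (bigD1 j) //= lerDl sumr_ge0 // => k _; exact: sqr_ge0.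
Qed.

Lemma inj_norm_max (R : realType) (r : nat) (n : 'I_r -> nat)
    (n_gt0 : forall k, (0 < n k)%N) (T : tensor R n) :
  exists2 x : forall k : 'I_r, 'rV[R]_(n k),
    (forall k, l2norm (x k) = 1) /\ inj_norm T = `|tensor_dot T (rank_one x)| &
    forall y : forall k : 'I_r, 'rV[R]_(n k),
      (forall k, l2norm (y k) = 1) ->
      `|tensor_dot T (rank_one y)| <= `|tensor_dot T (rank_one x)|.
Proof.
pose X := prod_topology (fun k : 'I_r => 'rV[R]_(n k) : topologicalType).
pose f (x : X) : R := `|tensor_dot T (rank_one x)|.
pose A : set X := [set x | forall k, l2norm (x k) = 1].
have A0 : A !=set0.
  exists (fun k => delta_mx ord0 (Ordinal (n_gt0 k))) => k.
  exact: l2norm_delta.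
have cA : compact A.
  apply: (@tychonoff _ (fun k : 'I_r => 'rV[R]_(n k) : topologicalType)
    (fun k => [set x | l2norm x = 1])) => k.
  exact: compact_l2sphere.
have cf : continuous f.
  move=> x; apply: (@continuous_comp _ _ _
    (fun x : X => tensor_dot T (rank_one x) : R^o) (fun y => `|y|));
    last exact: norm_continuous.
  apply: (@continuous_big R^o) => [|i _]; first exact: add_continuous.
  move=> y; apply: (@continuousM R X (cst (T i)) (fun x : X => rank_one x i)).
    exact: cst_continuous.
  move: y; apply: (@continuous_big R^o) => [|k _].
    by move=> z; apply: continuousM; [exact: cvg_fst|exact: cvg_snd].
  move=> y; apply: (@continuous_comp _ _ _
    (fun x : X => (x k : 'rV[R]_(n k))) (fun z : 'rV[R]_(n k) => z ord0 (i k))).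
    exact: (@proj_continuous _ (fun k : 'I_r => 'rV[R]_(n k) : topologicalType)).
  exact: coord_continuous.
have [x /set_mem Ax xmax] :=
  compact_EVT_max A0 cA (continuous_subspaceT cf).
have xmax' y : A y -> f y <= f x by move=> Ay; apply: xmax; exact: mem_set.
exists x => //; split => //.
apply/eqP; rewrite eq_le; apply/andP; split.
  apply: ge_sup; first by exists (f x), x.
  by move=> _ [y Ay ->]; exact: xmax'.
apply: ub_le_sup; last by exists x.
by exists (f x) => _ [y Ay ->]; exact: xmax'.
Qed.

(* Main.v *)
Require Import Defs.
From mathcomp Require Import measurable_realfun zify ring lra.
Set Implicit Arguments.
Unset Strict Implicit.
Unset Printing Implicit Defensive.
Local Open Scope classical_set_scope.
Local Open Scope ring_scope.

(** * Proof idea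

Lower bound: the injective norm dominates every entry, and it dominates
[n_k^(-1/2) sum_v |T_v|] along a line in direction [k], while the [2 + eps]
moment forces [E|Z| >= c sigma].

Upper bound: let [N] be the largest dimension, [s = sqrt N] and pad the tensor
by zeros to a cube of side [N].  Rounding each unit vector coordinatewise, in
the direction that increases the multilinear form, replaces unit vectors by
vectors [y_k] of the lattice [Z^N / s] in the ball of radius 2; there are only
[exp (C N)] of them.  Write [w_i = prod_k y_k(i_k)] and let [q] be a small fixed
power of [N].  The sum [sum_i T_i w_i] is split as follows.
- Light terms, [|T_i w_i| <= 1/s]: the exponential moment at [lambda ~ s] is at
  most [exp (C N)], so a union bound over the lattice gives [C s].
- Entries of size at most [q^a] with too large [w_i]: either every [y_k(i_k)] is
  far above [1/s], so that the vectors are sparse and have small entropy, or all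
  but one of the [y_k(i_k)] are at least a small negative power of [q], and then
  the off-diagonal entries of a Gram matrix are negligible.
- Heavy terms, [|T_i| > q^a] and [|T_i w_i| > 1/s]: in every box the number of
  large entries is, outside an event of probability [O(N^-r)], at most
  [D max_k |B_k|] or [q p prod_k |B_k|].  In the first case some slice has at
  most [D] entries; peeling it off and iterating, each peeled slice is bounded
  by Cauchy-Schwarz through the l2 norms of one-dimensional fibers, which are at
  most [C (s + max |T_i|)].  What cannot be peeled is negligible, because the
  [2 + eps] moment leaves a power of [q] to spare. *)

(** * Bounded measurable functions and independence *)

(** The obstacle: a union bound over [exp (C N)] lattice points needs exponential moments at scale
    [s], which only terms of size [O(1/s)] have. Larger terms are controlled by counting, and the
    power of [q] gained from the [2 + eps] moment has to pay for every loss. The exponents are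
    chosen backwards: [eps a >= 2r + 3], so that the tail at [q^(a+l)] beats the variance bound by
    [q^(2r+3)], and [h = 4(a+1)r + 1] with [q^(2h) = N], so that [(q^(a+1))^(4r) q = s] absorbs the
    off-diagonal Gram entries. Both depend on [r] and [eps] alone, so the numbers of levels and
    blocks are constants, and [q <= exp q] replaces every logarithm. Expectations are never obtained
    by integrating tails. Each supremum is dominated by a function
    [(c + sum exp (lam g - c)) / lam], and each exceptional event by a nonnegative function that is
    at least 1 on it. These majorants see the entries only through truncations and indicators, hence
    are bounded and measurable. On the exceptional event Cauchy-Schwarz with the Frobenius norm
    takes over, weighted by [N^r]. *)

Definition bounded_measurable (R : realType) (d : measure_display)
    (T : measurableType d) (f : T -> R) : Prop :=
  measurable_fun [set: T] f /\ exists M : R, forall x, `|f x| <= M.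

Section bounded_measurable_closure.
Context {R : realType} {d : measure_display} {T : measurableType d}.
Implicit Types f g : T -> R.

Lemma eq_bm f g : f =1 g -> bounded_measurable f -> bounded_measurable g.
Proof. by move=> /funext ->. Qed.

Lemma bm_cst (c : R) : bounded_measurable (fun _ : T => c).
Proof. by split; [exact: measurable_cst|exists `|c|]. Qed.

Lemma bmD f g : bounded_measurable f -> bounded_measurable g ->
  bounded_measurable (fun x => f x + g x).
Proof.
move=> [mf [M fM]] [mg [N gN]]; split; first exact: measurable_funD.
by exists (M + N) => x; rewrite (le_trans (ler_normD _ _))// lerD.
Qed.

Lemma bmM f g : bounded_measurable f -> bounded_measurable g ->
  bounded_measurable (fun x => f x * g x).
Proof.
move=> [mf [M fM]] [mg [N gN]]; split; first exact: measurable_funM.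
by exists (M * N) => x; rewrite normrM ler_pM.
Qed.

Lemma bmZ (c : R) f : bounded_measurable f ->
  bounded_measurable (fun x => c * f x).
Proof. by move=> bf; apply: bmM => //; exact: bm_cst. Qed.

Lemma bmN f : bounded_measurable f -> bounded_measurable (fun x => - f x).
Proof.
move=> /(bmZ (-1)); congr bounded_measurable.
by apply/funext => x; rewrite mulN1r.
Qed.

Lemma bmB f g : bounded_measurable f -> bounded_measurable g ->
  bounded_measurable (fun x => f x - g x).
Proof. by move=> bf bg; apply: bmD => //; exact: bmN. Qed.

Lemma bm_sum (I : Type) (s : seq I) (Q : pred I) (f : I -> T -> R) :
  (forall i, Q i -> bounded_measurable (f i)) ->
  bounded_measurable (fun x => \sum_(i <- s | Q i) f i x).
Proof.
move=> bf; elim: s => [|i s IHs].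
  by apply: eq_bm (bm_cst 0) => x; rewrite big_nil.
have [Qi|nQi] := boolP (Q i); last first.
  by apply: eq_bm IHs => x; rewrite big_cons (negbTE nQi).
apply: (eq_bm (f := fun x => f i x + \sum_(j <- s | Q j) f j x)).
  by move=> x; rewrite big_cons Qi.
by apply: bmD => //; exact: bf.
Qed.

Lemma bm_prod (I : Type) (s : seq I) (Q : pred I) (f : I -> T -> R) :
  (forall i, Q i -> bounded_measurable (f i)) ->
  bounded_measurable (fun x => \prod_(i <- s | Q i) f i x).
Proof.
move=> bf; elim: s => [|i s IHs].
  by apply: eq_bm (bm_cst 1) => x; rewrite big_nil.
have [Qi|nQi] := boolP (Q i); last first.
  by apply: eq_bm IHs => x; rewrite big_cons (negbTE nQi).
apply: (eq_bm (f := fun x => f i x * \prod_(j <- s | Q j) f j x)).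
  by move=> x; rewrite big_cons Qi.
by apply: bmM => //; exact: bf.
Qed.

Lemma bmX f n : bounded_measurable f -> bounded_measurable (fun x => f x ^+ n).
Proof.
move=> bf; elim: n => [|n IHn]; first exact: bm_cst.
by apply: eq_bm (bmM bf IHn) => x; rewrite exprS.
Qed.

Lemma bm_expR f : bounded_measurable f ->
  bounded_measurable (fun x => expR (f x)).
Proof.
move=> [mf [M fM]]; split; first by apply: measurableT_comp => //; exact: measurable_expR.
exists (expR M) => x; rewrite ger0_norm ?expR_ge0// ler_expR.
by rewrite (le_trans (ler_norm _)).
Qed.

Lemma bm_if (b : T -> bool) f g : measurable_fun [set: T] b ->
  bounded_measurable f -> bounded_measurable g ->
  bounded_measurable (fun x => if b x then f x else g x).
Proof.
move=> mb [mf [M fM]] [mg [N gN]]; split; first exact: measurable_fun_ifT.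
exists (Num.max M N) => x.
by case: ifP => _; rewrite le_max ?fM ?gN ?orbT.
Qed.

Lemma bm_indic (B : set T) : measurable B ->
  bounded_measurable (\1_B : T -> R).
Proof.
move=> mB; split; first exact: measurable_indic.
by exists 1 => x; rewrite indicE; case: (_ \in _); rewrite ?normr1 ?normr0.
Qed.

End bounded_measurable_closure.

Lemma bm_comp (R : realType) (d : measure_display) (T : measurableType d)
    (f : R -> R) (Y : T -> R) :
  bounded_measurable f -> measurable_fun [set: T] Y ->
  bounded_measurable (fun x => f (Y x)).
Proof.
move=> [mf [M fM]] mY; split; first exact: measurableT_comp.
by exists M => x.
Qed.

Definition mean (R : realType) (d : measure_display) (T : measurableType d)
    (P : probability T R) (f : T -> R) : R := Rintegral P setT f.

Section mean_bounded.
Context {R : realType} {d : measure_display} {T : measurableType d}.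
Variable P : probability T R.
Implicit Types f g : T -> R.

Lemma bm_integrable f : bounded_measurable f ->
  P.-integrable [set: T] (EFin \o f).
Proof.
move=> [mf [M fM]]; apply: measurable_bounded_integrable => //.
  by rewrite (@le_lt_trans _ _ 1%E) ?ltry// probability_le1.
exists M; split; first exact: num_real.
by move=> N MN x _; apply: le_trans (fM x) (ltW MN).
Qed.

Lemma eq_mean f g : f =1 g -> mean P f = mean P g.
Proof. by move=> /funext ->. Qed.

Lemma mean_cst (c : R) : mean P (fun _ => c) = c.
Proof.
rewrite /mean Rintegral_cst//.
by have /= -> := @probability_setT _ _ _ P; rewrite mulr1.
Qed.

Lemma meanD f g : bounded_measurable f -> bounded_measurable g ->
  mean P (fun x => f x + g x) = mean P f + mean P g.
Proof. by move=> bf bg; rewrite /mean RintegralD//; exact: bm_integrable. Qed.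

Lemma meanZ (c : R) f : bounded_measurable f ->
  mean P (fun x => c * f x) = c * mean P f.
Proof. by move=> bf; rewrite /mean RintegralZl//; exact: bm_integrable. Qed.

Lemma meanB f g : bounded_measurable f -> bounded_measurable g ->
  mean P (fun x => f x - g x) = mean P f - mean P g.
Proof. by move=> bf bg; rewrite /mean RintegralB//; exact: bm_integrable. Qed.

Lemma mean_sum (I : Type) (s : seq I) (Q : pred I) (f : I -> T -> R) :
  (forall i, Q i -> bounded_measurable (f i)) ->
  mean P (fun x => \sum_(i <- s | Q i) f i x) = \sum_(i <- s | Q i) mean P (f i).
Proof.
move=> bf; elim: s => [|i s IHs].
  by rewrite big_nil -[RHS]mean_cst; apply: eq_mean => x; rewrite big_nil.
rewrite big_cons -IHs; case: ifPn => [Qi|nQi].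
  rewrite -meanD; [|exact: bf|exact: bm_sum].
  by apply: eq_mean => x; rewrite big_cons Qi.
by apply: eq_mean => x; rewrite big_cons (negbTE nQi).
Qed.

Lemma le_mean f g : bounded_measurable f -> bounded_measurable g ->
  (forall x, f x <= g x) -> mean P f <= mean P g.
Proof.
by move=> bf bg fg; rewrite /mean le_Rintegral//; exact: bm_integrable.
Qed.

Lemma mean_ge0 f : (forall x, 0 <= f x) -> 0 <= mean P f.
Proof. by move=> f0; apply: Rintegral_ge0. Qed.

Lemma norm_mean_le f (M : R) : bounded_measurable f ->
  (forall x, `|f x| <= M) -> `|mean P f| <= M.
Proof.
move=> bf fM; rewrite ler_norml; apply/andP; split.
  rewrite -[leLHS]mean_cst; apply: le_mean => //; first exact: bm_cst.
  by move=> x; have := fM x; rewrite ler_norml => /andP[].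
rewrite -[leRHS]mean_cst; apply: le_mean => //; first exact: bm_cst.
by move=> x; have := fM x; rewrite ler_norml => /andP[].
Qed.

Lemma integral_mean f : bounded_measurable f ->
  (\int[P]_x (f x)%:E)%E = (mean P f)%:E.
Proof.
move=> bf; rewrite /mean /Rintegral fineK//.
exact: integrable_fin_num (bm_integrable bf).
Qed.

Lemma mean_indic (B : set T) : measurable B -> (mean P (\1_B))%:E = P B.
Proof.
move=> mB; rewrite -integral_mean; last exact: bm_indic.
by rewrite integral_indic// setIT.
Qed.

End mean_bounded.

Section finite_approximation.
Context {R : realType} {d : measure_display} {T : measurableType d}.

(** The range [[-M, M]] is cut into slices of height [1/(m+1)]: [u] rescales [f] so that the slices
    become the unit intervals [[k, k+1)], and [f] is replaced by the lower end of its slice. *)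
Lemma bm_finite_approx (f : T -> R) (m : nat) : bounded_measurable f ->
  exists K (c : 'I_K -> R) (B : 'I_K -> set T), (forall k, measurable (B k)) /\
  forall x, `|f x - \sum_(k < K) c k * \1_(B k) x| <= m.+1%:R^-1.
Proof.
move=> [mf [M fM]].
pose u x := (f x + M) * m.+1%:R.
have u0 x : 0 <= u x.
  have := fM x; rewrite ler_norml => /andP[fx _].
  by rewrite mulr_ge0// -lerBlDr sub0r.
pose K := (Num.trunc (2 * M * m.+1%:R)).+1.
have uK x : (Num.trunc (u x) < K)%N.
  rewrite /K ltnS le_truncn// ler_wpM2r//.
  have := fM x; rewrite ler_norml => /andP[_ fx].
  by rewrite mulr_natl mulr2n lerD2r.
exists K, (fun k : 'I_K => k%:R / m.+1%:R - M),
  (fun k : 'I_K => [set x | (k%:R <= u x) && (u x < k.+1%:R)]).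
have mu : measurable_fun [set: T] u.
  by apply: measurable_funM => //; exact: measurable_funD.
split=> [k|x].
  rewrite (_ : mkset _ = u @^-1` `[k%:R, k.+1%:R[%classic).
    by rewrite -[X in measurable X]setTI; exact: mu.
  by apply/seteqP; split => x /=; rewrite in_itv.
have ux := truncn_itv (u0 x).
rewrite (bigD1 (Ordinal (uK x)))//= big1 => [|k /negP kK].
  rewrite indicE mem_set//= mulr1 addr0.
  have -> : f x - ((Num.trunc (u x))%:R / m.+1%:R - M) =
    (u x - (Num.trunc (u x))%:R) / m.+1%:R.
    by rewrite /u mulrBl mulfK ?pnatr_eq0//; ring.
  rewrite normrM ger0_norm ?subr_ge0; last by case/andP: ux.
  rewrite ger0_norm ?invr_ge0// ler_piMl ?invr_ge0//.
  by case/andP: ux => _; rewrite -natr1 -lterBDl => /ltW.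
rewrite indicE memNset ?mulr0// => /= /andP[ku uk]; apply: kK.
apply/eqP/val_inj => /=; apply/esym; apply/eqP.
by rewrite truncn_eq ?ku ?uk.
Qed.

End finite_approximation.

Lemma invS_squeeze (R : realType) (x C : R) : 0 <= C ->
  (forall m : nat, `|x| <= C * m.+1%:R^-1) -> x = 0.
Proof.
move=> C0 xC; apply/eqP/negPn/negP => x0.
have x_gt0 : 0 < `|x| by rewrite normr_gt0.
have := xC (Num.trunc (C / `|x|)).
rewrite ler_pdivlMr ?ltr0n// leNgt => /negP; apply.
rewrite mulrC -ltr_pdivrMr// truncnS_gt//.
Qed.

Section factorization.
Context {R : realType} {d : measure_display} {T : measurableType d}.
Variable P : probability T R.

(** Frees one variable, with [g] carrying the remaining factors. A bounded [f] is uniformly within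
    [1/(m+1)] of a combination of indicators, for which the identity follows by linearity, and the
    error tends to 0. *)
Lemma mean_factor_ext (Y g : T -> R) (c : R) :
  measurable_fun [set: T] Y -> bounded_measurable g ->
  (forall B : set R, measurable B ->
    mean P (fun x => \1_B (Y x) * g x) = mean P (fun x => \1_B (Y x)) * c) ->
  forall f : R -> R, bounded_measurable f ->
    mean P (fun x => f (Y x) * g x) = mean P (fun x => f (Y x)) * c.
Proof.
move=> mY bg HB f bf; apply/eqP; rewrite -subr_eq0; apply/eqP.
have [mg [G gG]] := bg.
apply: (@invS_squeeze _ _ (`|G| + `|c|)); first by rewrite addr_ge0.
move=> m; have [K [a [B [mB fB]]]] := bm_finite_approx m bf.
have bB k : bounded_measurable (fun x => \1_(B k) (Y x) : R).
  by apply: bm_comp mY; exact: bm_indic.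
pose h x := \sum_(k < K) a k * \1_(B k) (Y x).
have bh : bounded_measurable h by apply: bm_sum => k _; exact: bmZ.
have bfY : bounded_measurable (fun x => f (Y x)) by exact: bm_comp.
have hg : mean P (fun x => h x * g x) = mean P h * c.
  rewrite /h mean_sum => [|k _]; last exact: bmZ.
  under eq_fun do rewrite mulr_suml.
  rewrite mean_sum => [|k _]; last by apply: bmM => //; exact: bmZ.
  rewrite mulr_suml; apply: eq_bigr => k _.
  rewrite meanZ// -mulrA -HB//.
  under eq_fun do rewrite -mulrA.
  by rewrite meanZ//; exact: bmM.
have -> : mean P (fun x => f (Y x) * g x) - mean P (fun x => f (Y x)) * c =
    mean P (fun x => (f (Y x) - h x) * g x) -
    mean P (fun x => f (Y x) - h x) * c.
  under [in RHS]eq_fun do rewrite mulrBl.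
  rewrite [mean P (fun x => f (Y x) - h x)]meanB// meanB; [|exact: bmM..].
  by rewrite hg; ring.
rewrite (le_trans (ler_normB _ _))// mulrDl lerD//.
  apply: norm_mean_le; first by apply: bmM => //; exact: bmB.
  move=> x; rewrite normrM mulrC ler_pM//.
  by rewrite (le_trans (gG x))// ler_norm.
rewrite normrM mulrC ler_wpM2l//; apply: norm_mean_le; first exact: bmB.
by move=> x; exact: fB.
Qed.

(** The form in which independence is used from here on. It speaks of plain functions and survives
    injective reindexing, scaling and padding by constants. *)
Definition factorizes (I : finType) (X : I -> T -> R) : Prop :=
  forall f : I -> R -> R, (forall i, bounded_measurable (f i)) ->
  mean P (fun x => \prod_i f i (X i x)) = \prod_i mean P (fun x => f i (X i x)).

Lemma independent_factorizes (I : finType) (X : I -> {RV P >-> R}) :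
  mutually_independent X -> factorizes (fun i => X i : T -> R).
Proof.
move=> indX.
(* Outside [s] the functions are indicators. Each induction step replaces the indicator at one more
   coordinate by a general function; for [s = enum I] nothing is restricted. *)
suff H (s : seq I) (f : I -> R -> R) : (forall i, bounded_measurable (f i)) ->
    (forall i, i \notin s -> exists2 B, measurable B & f i = \1_B) ->
    mean P (fun x => \prod_i f i (X i x)) =
    \prod_i mean P (fun x => f i (X i x)).
  by move=> f bf; apply: (H (enum I)) => // i; rewrite mem_enum.
elim: s f => [|i s IHs] f bf fs.
  have /(_ _)/cid2-/all_sig2[B mB fB] : forall i,
    exists2 B, measurable B & f i = \1_B by move=> i; exact: fs.
  have mXB i : measurable (X i @^-1` B i).
    by rewrite -[X in measurable X]setTI; exact: measurable_funPT.
  have EB i : mean P (fun x => f i (X i x)) = fine (P (X i @^-1` B i)).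
    by rewrite fB -[in RHS]mean_indic.
  under [RHS]eq_bigr do rewrite EB.
  have [] := (indX [set: I]%SET B mB, tt).
  rewrite (_ : \bigcap_(i in _) _ = \bigcap_(i in [set: I]) (X i @^-1` B i)).
    move=> H _; have -> : (fun x => \prod_i f i (X i x)) =
        \1_(\bigcap_(i in [set: I]) (X i @^-1` B i)).
      apply/funext => x; rewrite indicE.
      have [xB|xB] := pselect (forall i, B i (X i x)).
        have -> : x \in \bigcap_(i in [set: I]) (X i @^-1` B i).
          by apply/mem_set => i _; exact: xB.
        by apply: big1 => i _; rewrite fB indicE mem_set.
      have -> : (x \in \bigcap_(i in [set: I]) (X i @^-1` B i)) = false.
        by apply/memNset => h; apply: xB => i; exact: h.
      move/existsNP: xB => [i xB].
      by rewrite (bigD1 i)//= fB indicE memNset ?mul0r.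
    apply: EFin_inj; rewrite mean_indic; last exact: fin_bigcap_measurable.
    rewrite H -prodEFin; apply: eq_big => [j|j _]; first by rewrite inE.
    by rewrite fineK// fin_num_measure.
  by apply/seteqP; split => x /= h i _; apply: h; rewrite /= ?inE.
pose g x := \prod_(j | j != i) f j (X j x).
have bg : bounded_measurable g by apply: bm_prod => j _; exact: bm_comp.
have -> : (fun x => \prod_j f j (X j x)) = (fun x => f i (X i x) * g x).
  by apply/funext => x; rewrite (bigD1 i).
rewrite [RHS](bigD1 i)//=.
apply: mean_factor_ext => // B mB.
pose f' j := if j == i then \1_B : R -> R else f j.
have -> : (fun x => \1_B (X i x) * g x) = (fun x => \prod_j f' j (X j x)).
  apply/funext => x; rewrite [RHS](bigD1 i)//= /f' eqxx; congr (_ * _).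
  by apply: eq_bigr => j /negbTE ->.
rewrite IHs.
- rewrite (bigD1 i)//= /f' eqxx; congr (_ * _).
  by apply: eq_bigr => j /negbTE ->.
- by move=> j; rewrite /f'; case: ifP => // _; exact: bm_indic.
- move=> j js; rewrite /f'; case: ifPn => [_|ji]; first by exists B.
  by apply: fs; rewrite inE negb_or ji.
Qed.

End factorization.

(** * Moment generating functions and union bounds *)

Section exponential_bounds.
Context {R : realType}.
Implicit Types u : R.

(** From [expR u * (1 - u) <= expR u * expR (- u) = 1] and [(1 - u) (1 + u + 2u^2) = 1 + u^2 (1 -
    2u) >= 1]. Here [u] may be arbitrarily negative. *)
Lemma expR_le_quadratic u : u <= 2^-1 -> expR u <= 1 + u + 2 * u ^+ 2.
Proof.
move=> u2; have u1 : 0 < 1 - u by lra.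
have : expR u * (1 - u) <= 1.
  apply: (@le_trans _ _ (expR u * expR (- u))).
    by rewrite ler_wpM2l ?expR_ge0//; exact: expR_ge1Dx.
  by rewrite expRN mulfV// gt_eqF ?expR_gt0.
rewrite -ler_pdivlMr// => /le_trans; apply.
rewrite ler_pdivrMr//; have := mulr_ge0 (sqr_ge0 u) (ltW u1); nra.
Qed.

(** For centered [u] the linear term integrates to 0, which leaves a subgaussian bound for bounded
    variables without a smallness condition. Beyond [1/2] the inequality [u <= 2 u^2] already
    suffices. *)
Lemma expR_le_linear_square u : expR u <= u + expR (2 * u ^+ 2).
Proof.
have e1 := expR_ge1Dx (2 * u ^+ 2).
have [u2|u2] := leP u 2^-1.
  by have := expR_le_quadratic u2; lra.
have : expR u <= expR (2 * u ^+ 2) by rewrite ler_expR; nra.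
lra.
Qed.

Lemma expR_le_double u : 0 <= u <= 2^-1 -> expR u <= 1 + 2 * u.
Proof. by move=> /andP[u0 u2]; have := expR_le_quadratic u2; nra. Qed.

(** A union bound without probabilities: [1 + t <= expR t] at [t = lam * g y - c], the other
    exponentials being nonnegative. The right side no longer depends on [y]. *)
Lemma expR_union (Y : finType) (Q : pred Y) (g : Y -> R) (lam c : R) (y : Y) :
  0 < lam -> Q y ->
  g y <= lam^-1 * (c + \sum_(z | Q z) expR (lam * g z - c)).
Proof.
move=> lam0 Qy; rewrite mulrC ler_pdivlMr// (bigD1 y)//= mulrC.
have e1 := expR_ge1Dx (lam * g y - c).
have s0 : 0 <= \sum_(z | Q z && (z != y)) expR (lam * g z - c).
  by apply: sumr_ge0 => z _; exact: expR_ge0.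
lra.
Qed.

Lemma le_expR_id u : u <= expR u.
Proof. by have := expR_ge1Dx u; lra. Qed.

Lemma exprn_le_expR u (n : nat) : 0 <= u -> u ^+ n <= expR (n%:R * u).
Proof.
move=> u0; rewrite mulrC expRM_natr lerXn2r ?nnegrE ?expR_ge0//.
exact: le_expR_id.
Qed.

End exponential_bounds.

Section moment_generating.
Context {R : realType} {d : measure_display} {T : measurableType d}.
Variable P : probability T R.
Context {I : finType}.
Variable X : I -> T -> R.
Hypothesis facX : factorizes P X.

Lemma mgf_sum (f : I -> R -> R) (v : I -> R) :
  (forall i, bounded_measurable (f i)) ->
  (forall i, mean P (fun x => expR (f i (X i x))) <= expR (v i)) ->
  mean P (fun x => expR (\sum_i f i (X i x))) <= expR (\sum_i v i).
Proof.
move=> bf fv; rewrite (eq_mean _ (fun x => expR_sum _ _ _)).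
rewrite (facX (f := fun i t => expR (f i t))); last first.
  by move=> i; exact: bm_expR.
rewrite expR_sum; apply: ler_prod => i _; rewrite fv andbT.
by apply: mean_ge0 => x; exact: expR_ge0.
Qed.

Definition exp_union (Y : finType) (Q : pred Y) (g : Y -> T -> R) (lam c : R)
    (x : T) : R :=
  lam^-1 * (c + \sum_(y | Q y) expR (lam * g y x - c)).

Lemma exp_union_ge (Y : finType) (Q : pred Y) (g : Y -> T -> R) (lam c : R)
    (y : Y) (x : T) : 0 < lam -> Q y -> g y x <= exp_union Q g lam c x.
Proof. by move=> lam0 Qy; exact: (expR_union (fun y => g y x)). Qed.

Lemma exp_union_ge0 (Y : finType) (Q : pred Y) (g : Y -> T -> R) (lam c : R)
    (x : T) : 0 < lam -> 0 <= c -> 0 <= exp_union Q g lam c x.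
Proof.
move=> lam0 c0; rewrite mulr_ge0 ?invr_ge0 ?(ltW lam0)// addr_ge0//.
by apply: sumr_ge0 => y _; exact: expR_ge0.
Qed.

Lemma bm_exp_union (Y : finType) (Q : pred Y) (g : Y -> T -> R) (lam c : R) :
  (forall y, Q y -> bounded_measurable (g y)) ->
  bounded_measurable (exp_union Q g lam c).
Proof.
move=> bg; apply: bmZ; apply: bmD; first exact: bm_cst.
apply: bm_sum => y Qy; apply: bm_expR; apply: bmB; last exact: bm_cst.
by apply: bmZ; exact: bg.
Qed.

(** With [c = a + b] each exponential has mean at most [expR (- b)], and there are at most [expR b]
    of them: the whole sum costs the final [+ 1]. *)
Lemma mean_exp_union (Y : finType) (Q : pred Y) (g : Y -> T -> R)
    (lam a b : R) : 0 < lam ->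
  (forall y, Q y -> bounded_measurable (g y)) ->
  (forall y, Q y -> mean P (fun x => expR (lam * g y x)) <= expR a) ->
  #|Q|%:R <= expR b ->
  mean P (exp_union Q g lam (a + b)) <= lam^-1 * (a + b + 1).
Proof.
move=> lam0 bg ga Qb.
have be y : Q y -> bounded_measurable (fun x => expR (lam * g y x - (a + b))).
  move=> Qy; apply: bm_expR; apply: bmB; last exact: bm_cst.
  by apply: bmZ; exact: bg.
rewrite meanZ; last by apply: bmD; [exact: bm_cst|exact: bm_sum].
rewrite ler_wpM2l ?invr_ge0 ?(ltW lam0)//.
rewrite meanD ?mean_cst ?lerD2l; [|exact: bm_cst|exact: bm_sum].
rewrite mean_sum//; apply: (@le_trans _ _ (\sum_(y | Q y) expR (- b))).
  apply: ler_sum => y Qy.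
  rewrite (eq_mean _ (g := fun x => expR (- (a + b)) * expR (lam * g y x))).
    rewrite meanZ; last by apply: bm_expR; apply: bmZ; exact: bg.
    have -> : - b = - (a + b) + a by ring.
    by rewrite expRD ler_wpM2l ?expR_ge0// ga.
  by move=> x; rewrite -expRD addrC.
rewrite sumr_const -mulr_natl expRN ler_pdivrMr ?expR_gt0// mul1r.
exact: Qb.
Qed.

End moment_generating.

(** * Lattice vectors *)

Definition cube (r N : nat) : finType := {ffun 'I_r -> 'I_N}.

Definition wt (R : realType) (r N : nat) (u : 'I_r -> 'I_N -> R)
    (i : cube r N) : R := \prod_k u k (i k).

Definition form (R : realType) (r N : nat) (x : cube r N -> R)
    (u : 'I_r -> 'I_N -> R) : R := \sum_i x i * wt u i.

(** Sign and magnitude, so 0 has two codes. Magnitudes up to [2 * N] leave room for rounding a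
    number of [[-1, 1]] away from 0, because [s <= N]. *)
Definition digit (N : nat) : finType := (bool * 'I_(2 * N).+1)%type.

Definition lattice (r N : nat) : finType := {ffun 'I_r * 'I_N -> digit N}.

Definition digit_val (R : realType) (N : nat) (s : R) (v : digit N) : R :=
  (-1) ^+ v.1 * (v.2%:R / s).

Definition coord (R : realType) (r N : nat) (s : R) (y : lattice r N)
    (k : 'I_r) (j : 'I_N) : R := digit_val s (y (k, j)).

Definition in_ball (R : realType) (r N : nat) (u : 'I_r -> 'I_N -> R) : bool :=
  [forall k, \sum_j u k j ^+ 2 <= 4].

Section weights.
Context {R : realType} {r N : nat}.
Implicit Types (u : 'I_r -> 'I_N -> R).

Lemma sum_wt u : \sum_i wt u i = \prod_k \sum_j u k j.
Proof. by rewrite bigA_distr_bigA. Qed.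

Lemma sum_wt_sqr u : \sum_i wt u i ^+ 2 = \prod_k \sum_j u k j ^+ 2.
Proof.
rewrite -(sum_wt (fun k j => u k j ^+ 2)); apply: eq_bigr => i _.
by rewrite /wt prodrXl.
Qed.

Lemma in_ballP u : reflect (forall k, \sum_j u k j ^+ 2 <= 4) (in_ball u).
Proof. exact: forallP. Qed.

Lemma sum_wt_sqr_le u : in_ball u -> \sum_i wt u i ^+ 2 <= 4 ^+ r.
Proof.
move=> /in_ballP bu; rewrite sum_wt_sqr -[r in 4 ^+ r]card_ord -prodr_const.
apply: ler_prod => k _; rewrite bu andbT.
by apply: sumr_ge0 => j _; exact: sqr_ge0.
Qed.

Lemma in_ball_coord_le u k j : in_ball u -> `|u k j| <= 2.
Proof.
move=> /in_ballP/(_ k) bu; rewrite -(ler_pXn2r (n := 2)) ?nnegrE// real_normK ?num_real//.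
have -> : (2 : R) ^+ 2 = 4 by ring.
apply: le_trans bu; rewrite (bigD1 j)//= lerDl.
by apply: sumr_ge0 => l _; exact: sqr_ge0.
Qed.

Lemma norm_wt u i : `|wt u i| = \prod_k `|u k (i k)|.
Proof. exact: normr_prod. Qed.

End weights.

Section rounding.
Context {R : realType} {r N : nat}.
Variable s : R.
Hypotheses (s_gt0 : 0 < s) (sN : s ^+ 2 = N%:R).

Let s_ge1 : 1 <= s.
Proof.
rewrite -(ler_pXn2r (n := 2)) ?nnegrE ?ler01 ?(ltW s_gt0)// expr1n sN.
rewrite ler1n lt0n; apply/negP => /eqP N0.
by move: sN; rewrite N0 => /eqP; rewrite sqrf_eq0 gt_eqF.
Qed.

Let s_leN : s <= N%:R.
Proof. by rewrite -sN expr2 ler_peMr// ltW. Qed.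

Lemma digit_valN (v : digit N) : digit_val s (~~ v.1, v.2) = - digit_val s v.
Proof. by rewrite /digit_val /=; case: v.1; rewrite /= ?expr0 ?expr1; ring. Qed.

Lemma digit_round (t : R) (up : bool) : `|t| <= 1 ->
  exists v : digit N, `|digit_val s v - t| <= s^-1 /\
    (if up then t <= digit_val s v else digit_val s v <= t).
Proof.
wlog t0 : t up / 0 <= t => [wl t1|].
  have [t0|t0] := leP 0 t; first exact: wl.
  have [||v [v1 v2]] := wl (- t) (~~ up); rewrite ?normrN// ?oppr_ge0 ?(ltW t0)//.
  exists (~~ v.1, v.2); rewrite digit_valN; split.
    by rewrite -opprD normrN -[t]opprK.
  by case: up v2 => /=; lra.
rewrite ger0_norm// => t1.
have ts0 : 0 <= t * s by rewrite mulr_ge0// ltW.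
have /andP[k1 k2] := truncn_itv ts0; set k := Num.trunc (t * s) in k1 k2 *.
have kN : (k <= N)%N.
  rewrite -(ler_nat R) (le_trans k1)// (le_trans _ s_leN)//.
  by apply: ler_piMl => //; exact: ltW.
have k1N : (k.+1 < (2 * N).+1)%N.
  rewrite ltnS mul2n -addnn -addn1 leq_add// -(ler_nat R).
  exact: le_trans s_ge1 s_leN.
case: up.
  exists (false, Ordinal k1N); rewrite /digit_val/= expr0 mul1r.
  have tk : t <= k.+1%:R / s by rewrite ler_pdivlMr// ltW.
  split=> //; rewrite ger0_norm ?subr_ge0//.
  by rewrite lerBlDr -natr1 mulrDl mul1r addrC lerD2l ler_pdivrMr.
exists (false, Ordinal (ltnW k1N)); rewrite /digit_val/= expr0 mul1r.
have tk : k%:R / s <= t by rewrite ler_pdivrMr.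
split=> //; rewrite distrC ger0_norm ?subr_ge0//.
rewrite lerBlDr -[X in X + _]mul1r -mulrDl ler_pdivlMr// addrC natr1.
exact: ltW.
Qed.

(** Each coordinate moves in the direction of the sign of [c j], so no term of the linear form
    decreases. The displacements are at most [1/s] in [N = s^2] coordinates, and
    [(a + b)^2 <= 2a^2 + 2b^2] yields the squared radius 4. *)
Lemma row_round (c u : 'I_N -> R) : \sum_j u j ^+ 2 <= 1 ->
  exists z : {ffun 'I_N -> digit N},
    \sum_j digit_val s (z j) ^+ 2 <= 4 /\
    \sum_j c j * u j <= \sum_j c j * digit_val s (z j).
Proof.
move=> u1.
have uj j : `|u j| <= 1.
  rewrite -(ler_pXn2r (n := 2)) ?nnegrE// real_normK ?num_real// expr1n.
  apply: le_trans u1; rewrite (bigD1 j)//= lerDl.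
  by apply: sumr_ge0 => l _; exact: sqr_ge0.
have /(_ _)/cid-/all_sig[z zP] j := digit_round (0 <= c j) (uj j).
exists [ffun j => z j]; split.
  apply: (@le_trans _ _ (\sum_j (2 * u j ^+ 2 + 2 * s^-1 ^+ 2))).
    apply: ler_sum => j _; rewrite ffunE.
    have [+ _] := zP j; rewrite ler_norml => /andP[z1 z2].
    have d2 : (digit_val s (z j) - u j) ^+ 2 <= s^-1 ^+ 2.
      have s0 : 0 <= s^-1 by rewrite invr_ge0 ltW.
      nra.
    have := sqr_ge0 (2 * u j - digit_val s (z j)); nra.
  rewrite big_split/= -mulr_sumr sumr_const card_ord -[_ *+ N]mulr_natr -sN.
  rewrite -mulrA -exprMn mulVf ?gt_eqF// expr1n; lra.
apply: ler_sum => j _; rewrite ffunE; have [_] := zP j.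
case: leP => c0 h; first exact: ler_wpM2l.
by rewrite ler_wnM2l// ltW.
Qed.

Lemma form_linear (x : cube r N -> R) (u : 'I_r -> 'I_N -> R) (k : 'I_r)
    (a : 'I_N -> R) :
  form x (fun l => if l == k then a else u l) =
  \sum_j (\sum_(i : cube r N | i k == j) x i * \prod_(l | l != k) u l (i l)) * a j.
Proof.
rewrite /form (partition_big (fun i : cube r N => i k) predT)//=.
apply: eq_bigr => j _; rewrite mulr_suml; apply: eq_bigr => i /eqP ij.
rewrite /wt (bigD1 k)//= eqxx ij mulrCA mulrC; congr (_ * _ * _).
by apply: eq_bigr => l /negbTE ->.
Qed.

Lemma lattice_round (x : cube r N -> R) (u : 'I_r -> 'I_N -> R) :
  (forall k, \sum_j u k j ^+ 2 <= 1) ->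
  exists y : lattice r N,
    in_ball (coord s y) /\ form x u <= form x (coord s y).
Proof.
move=> u1.
(* Rows in [ks] already lie on the lattice, the others are still those of [u]. The form is linear in
   the row being rounded, with coefficients depending on the current state of the other rows. *)
have step (ks : seq 'I_r) : exists u' : 'I_r -> 'I_N -> R,
    [/\ forall k, k \in ks -> exists2 z : {ffun 'I_N -> digit N},
          \sum_j digit_val s (z j) ^+ 2 <= 4 & u' k = fun j => digit_val s (z j),
        forall k, k \notin ks -> u' k = u k & form x u <= form x u'].
  elim: ks => [|k ks [u' [h1 h2 h3]]]; first by exists u.
  have [kks|kks] := boolP (k \in ks).
    exists u'; split=> // l; rewrite inE; first by case/predU1P => [->|]; exact: h1.
    by rewrite negb_or => /andP[_]; exact: h2.
  have u'k : \sum_j u' k j ^+ 2 <= 1 by rewrite h2.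
  have [z [z4 zle]] := row_round
    (fun j => \sum_(i : cube r N | i k == j) x i * \prod_(l | l != k) u' l (i l)) u'k.
  exists (fun l => if l == k then (fun j => digit_val s (z j)) else u' l); split.
  - move=> l; have [->|lk] := eqVneq l k; first by exists z.
    by rewrite inE (negbTE lk) /=; exact: h1.
  - by move=> l; rewrite inE negb_or => /andP[/negbTE -> /h2].
  - rewrite (le_trans h3)// form_linear; apply: le_trans zle.
    rewrite -form_linear /form le_eqVlt; apply/orP; left; apply/eqP.
    apply: eq_bigr => i _; congr (_ * _); apply: eq_bigr => l _.
    by case: eqP => // ->.
have [u' [h1 _ h3]] := step (enum 'I_r).
have /(_ _)/cid2-/all_sig2[z z4 zu] : forall k,
    exists2 z : {ffun 'I_N -> digit N},
      \sum_j digit_val s (z j) ^+ 2 <= 4 & u' k = fun j => digit_val s (z j).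
  by move=> k; apply: h1; rewrite mem_enum.
have E k j : coord s [ffun p => z p.1 p.2] k j = u' k j.
  by rewrite /coord ffunE/= zu.
exists [ffun p => z p.1 p.2]; split.
  apply/in_ballP => k; under eq_bigr do rewrite E zu.
  exact: z4.
apply: le_trans h3 _; rewrite /form le_eqVlt; apply/orP; left; apply/eqP.
by apply: eq_bigr => i _; congr (_ * _); apply: eq_bigr => k _; rewrite E.
Qed.

End rounding.

Section counting.
Context {R : realType} {r N : nat}.

(** Exponential tilting of the counting measure: the weight dominates the indicator of [Q], and a
    product weight summed over the whole lattice factorizes. *)
Lemma lattice_count (Q : pred (lattice r N)) (om : digit N -> R) (E : R) :
  0 <= E -> (forall v, 0 <= om v) ->
  (forall y, Q y -> 1 <= E * \prod_p om (y p)) ->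
  #|Q|%:R <= E * (\sum_v om v) ^+ (r * N).
Proof.
move=> E0 om0 QE.
rewrite -sum1_card natr_sum.
apply: (@le_trans _ _ (\sum_(y | Q y) E * \prod_p om (y p))).
  by apply: ler_sum => y; exact: QE.
apply: (@le_trans _ _ (\sum_(y : lattice r N) E * \prod_p om (y p))).
  rewrite [leRHS](bigID Q)/= lerDl; apply: sumr_ge0 => y _.
  by rewrite mulr_ge0// prodr_ge0.
rewrite -mulr_sumr ler_wpM2l//.
have -> : (r * N)%N = #|{: 'I_r * 'I_N}| by rewrite card_prod !card_ord.
by rewrite -prodr_const bigA_distr_bigA.
Qed.

Lemma sum_digit (f : bool -> nat -> R) :
  \sum_(v : digit N) f v.1 v.2 =
  \sum_(k < (2 * N).+1) f false k + \sum_(k < (2 * N).+1) f true k.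
Proof.
rewrite -(pair_big xpredT xpredT (fun b (k : 'I_(2 * N).+1) => f b k))/=.
by rewrite big_bool /= addrC.
Qed.

Lemma geometric_half (m : nat) : \sum_(k < m) (2^-1 : R) ^+ k <= 2.
Proof.
suff : \sum_(k < m) (2^-1 : R) ^+ k = 2 - 2 * 2^-1 ^+ m.
  by move=> ->; rewrite gerBl mulr_ge0// exprn_ge0// invr_ge0.
elim: m => [|m IHm]; first by rewrite big_ord0 expr0; ring.
by rewrite big_ord_recr/= IHm exprS; field.
Qed.

Variable s : R.
Hypotheses (s_gt0 : 0 < s) (sN : s ^+ 2 = N%:R).

Lemma digit_val_sqr (v : digit N) : digit_val s v ^+ 2 = v.2%:R ^+ 2 / N%:R.
Proof. by rewrite /digit_val exprMn sqrr_sign mul1r expr_div_n sN. Qed.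

(** The weight is [2^-k] at magnitude [k]. In the ball the magnitudes satisfy
    [sum k <= sum k^2 <= 4 r N], and one digit has total weight at most 4, whence
    [2^(4 r N) 4^(r N) = 2^(6 r N)]. *)
Lemma ball_count :
  #|[pred y : lattice r N | in_ball (coord s y)]|%:R <= expR ((6 * r * N)%:R : R).
Proof.
have N_gt0 : 0 < N%:R :> R by rewrite -sN exprn_gt0.
apply: (@le_trans _ _ (2 ^+ (4 * r * N) * (4 ^+ (r * N)))); last first.
  rewrite (_ : 4 = 2 ^+ 2 :> R); last by ring.
  rewrite -exprM -exprD.
  rewrite (_ : (4 * r * N + 2 * (r * N))%N = (6 * r * N)%N); last by lia.
  rewrite -[X in expR X]mulr1 expRM_natl lerXn2r ?nnegrE ?expR_ge0//.
  by have := expR_ge1Dx (1 : R); lra.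
apply: (@le_trans _ _ (2 ^+ (4 * r * N) *
    (\sum_(v : digit N) 2^-1 ^+ v.2) ^+ (r * N))).
  apply: lattice_count => [|v|y /in_ballP By]; rewrite ?exprn_ge0 ?invr_ge0//.
  rewrite prodrXr exprVn ler_pdivlMr ?exprn_gt0// mul1r ler_eXn2l//; last lra.
  rewrite -(ler_nat R) natr_sum.
  apply: (@le_trans _ _ (\sum_(p : 'I_r * 'I_N) (y p).2%:R ^+ 2)).
    apply: ler_sum => p _; rewrite -natrX ler_nat.
    by case: (nat_of_ord (y p).2) => // m; rewrite -{1}[m.+1]muln1 expnS leq_mul.
  have -> : \sum_(p : 'I_r * 'I_N) (y p).2%:R ^+ 2 =
      \sum_k \sum_j (y (k, j)).2%:R ^+ 2 :> R.
    by rewrite pair_bigA; apply: eq_bigr => -[].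
  rewrite (_ : (4 * r * N)%:R = \sum_(k < r) (4 * N)%:R :> R); last first.
    by rewrite sumr_const card_ord -[RHS]mulr_natr -natrM mulnAC.
  apply: ler_sum => k _.
  have := By k; rewrite /coord; under eq_bigr do rewrite digit_val_sqr.
  rewrite -mulr_suml ler_pdivrMr// => /le_trans; apply.
  by rewrite natrM.
rewrite ler_wpM2l ?exprn_ge0// lerXn2r ?nnegrE//.
  by apply: sumr_ge0 => v _; rewrite exprn_ge0// invr_ge0.
rewrite (sum_digit (fun _ k => 2^-1 ^+ k)).
by have := geometric_half (2 * N).+1; lra.
Qed.

Definition zero_digit : digit N := (false, ord0).

(** Vanishing coordinates must be [zero_digit], not the negative zero: counting sparse vectors needs
    a unique code for 0. *)
Definition sparse (thr : R) (y : lattice r N) : bool :=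
  [forall p, (y p == zero_digit) || (thr < `|digit_val s (y p)|)].

Definition sparsify (thr : R) (y : lattice r N) : lattice r N :=
  [ffun p => if thr < `|digit_val s (y p)| then y p else zero_digit].

Lemma digit_val0 : digit_val s zero_digit = 0.
Proof. by rewrite /digit_val/= mul0r mulr0. Qed.

Lemma coord_sparsify (thr : R) (y : lattice r N) k j :
  coord s (sparsify thr y) k j =
  if thr < `|coord s y k j| then coord s y k j else 0.
Proof. by rewrite /coord ffunE; case: ifP => // _; rewrite digit_val0. Qed.

Lemma sparse_sparsify (thr : R) (y : lattice r N) : sparse thr (sparsify thr y).
Proof.
by apply/forallP => p; rewrite ffunE; case: ifP => [->|_]; rewrite ?orbT ?eqxx.
Qed.

Lemma in_ball_sparsify (thr : R) (y : lattice r N) :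
  in_ball (coord s y) -> in_ball (coord s (sparsify thr y)).
Proof.
move=> /in_ballP yB; apply/in_ballP => k; apply: le_trans (yB k).
apply: ler_sum => j _; rewrite coord_sparsify; case: ifP => // _.
by rewrite expr0n sqr_ge0.
Qed.

Lemma sparse_count (thr L : R) : 0 < thr -> 0 <= L ->
  (4 * N * N)%:R * expR (- L) <= 1 ->
  #|[pred y | in_ball (coord s y) && sparse thr y]|%:R <=
  expR (L * (4 * r%:R / thr ^+ 2) + r%:R).
Proof.
move=> thr0 L0 LN.
have N_gt0 : 0 < N%:R :> R by rewrite -sN exprn_gt0.
(* Weight 1 for [zero_digit], 0 for the other code of 0, [expR (- L)] for nonzero digits. At most
   [4 r / thr^2] coordinates exceed [thr], and [(1 + 4 N expR (- L))^(r N) <= expR r] because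
   [4 N^2 expR (- L) <= 1]. *)
pose om (v : digit N) : R :=
  if v.2 == 0 :> nat then (~~ v.1)%:R else expR (- L).
rewrite expRD; apply: (@le_trans _ _ (expR (L * (4 * r%:R / thr ^+ 2)) *
    (\sum_v om v) ^+ (r * N))).
  apply: lattice_count => [|v|y]; first exact: expR_ge0.
    by rewrite /om; case: ifP => _; rewrite ?ler0n ?expR_ge0.
  move=> /andP[/in_ballP yB /forallP ysp].
  have omE p : om (y p) = expR (- L * (y p != zero_digit)%:R).
    rewrite /om; have /orP[/eqP ->|yp] := ysp p.
      by rewrite eqxx mulr0 expR0.
    case: ifPn => [/eqP y0|y0].
      by move: yp; rewrite /digit_val y0 mul0r mulr0 normr0 ltNge (ltW thr0).
    suff -> : y p != zero_digit by rewrite mulr1.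
    by apply: contraNneq y0 => ->.
  rewrite (eq_bigr _ (fun p _ => omE p)) -expR_sum -mulr_sumr -expRD.
  rewrite -[leLHS]expR0 ler_expR mulNr -mulrBr mulr_ge0// subr_ge0.
  rewrite ler_pdivlMr ?exprn_gt0// mulr_suml.
  apply: (@le_trans _ _ (\sum_(p : 'I_r * 'I_N) digit_val s (y p) ^+ 2)).
    apply: ler_sum => p _; have /orP[/eqP ->|yp] := ysp p.
      by rewrite eqxx mul0r sqr_ge0.
    rewrite -[leRHS]real_normK ?num_real//.
    apply: (@le_trans _ _ (thr ^+ 2)).
      by rewrite ler_piMl ?sqr_ge0// lern1; case: (_ != _).
    by rewrite lerXn2r ?nnegrE ?(ltW thr0) ?(ltW yp).
  have -> : \sum_(p : 'I_r * 'I_N) digit_val s (y p) ^+ 2 =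
      \sum_k \sum_j digit_val s (y (k, j)) ^+ 2.
    by rewrite pair_bigA; apply: eq_bigr => -[].
  rewrite (_ : 4 * r%:R = \sum_(k < r) 4 :> R); last first.
    by rewrite sumr_const card_ord mulr_natr.
  by apply: ler_sum => k _; exact: yB.
rewrite ler_wpM2l ?expR_ge0//.
have -> : \sum_v om v = 1 + (4 * N)%:R * expR (- L).
  rewrite (sum_digit (fun b k => if k == 0%N then (~~ b)%:R else expR (- L))).
  have E c : \sum_(k < (2 * N).+1) (if k == 0 :> nat then c else expR (- L)) =
      c + (2 * N)%:R * expR (- L).
    by rewrite big_ord_recl /= sumr_const card_ord mulr_natl.
  by rewrite !E /= !natrM; ring.
apply: (@le_trans _ _ (expR (N%:R^-1) ^+ (r * N))).
  have e0 : 0 <= (4 * N)%:R * expR (- L) by rewrite mulr_ge0 ?expR_ge0.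
  rewrite lerXn2r ?nnegrE ?expR_ge0 ?addr_ge0//.
  apply: le_trans (expR_ge1Dx _); rewrite lerD2l -[leRHS]mul1r ler_pdivlMr//.
  by rewrite mulrAC -natrM.
by rewrite -expRM_natl natrM -mulrA mulfV ?gt_eqF// mulr1.
Qed.

End counting.

(** * Fibers, Gram matrices and coordinate classes *)

Definition upd (r N : nat) (i : cube r N) (k : 'I_r) (v : 'I_N) : cube r N :=
  [ffun l => if l == k then v else i l].

Section fibers.
Context {R : realType} {r N : nat}.
Implicit Types (i : cube r N) (k : 'I_r).

Lemma upd_k i k v : upd i k v k = v.
Proof. by rewrite ffunE eqxx. Qed.

Lemma upd_other i k v l : l != k -> upd i k v l = i l.
Proof. by move=> /negbTE lk; rewrite ffunE lk. Qed.

Lemma upd_upd i k v v' : upd (upd i k v) k v' = upd i k v'.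
Proof. by apply/ffunP => l; rewrite !ffunE; case: eqP. Qed.

Lemma upd_id i k : upd i k (i k) = i.
Proof. by apply/ffunP => l; rewrite ffunE; case: eqP => // ->. Qed.

(** The lines in direction [k] are indexed by their points with [k]-th coordinate [j0], an arbitrary
    section. *)
Lemma sum_fiber k (j0 : 'I_N) (F : cube r N -> R) :
  \sum_i F i = \sum_(i : cube r N | i k == j0) \sum_v F (upd i k v).
Proof.
rewrite (partition_big (fun i => upd i k j0) (fun i : cube r N => i k == j0)).
  apply: eq_bigr => b /eqP bk.
  rewrite (reindex_onto (fun v => upd b k v) (fun i : cube r N => i k)).
    apply: eq_bigl => v.
    by rewrite upd_upd -bk upd_id upd_k !eqxx.
  move=> i /eqP <-; apply/ffunP => l; rewrite !ffunE.
  by case: eqP => // ->.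
by move=> i _; rewrite upd_k.
Qed.

Lemma sum_base k (j0 : 'I_N) (g : 'I_r -> 'I_N -> R) :
  \sum_(i : cube r N | i k == j0) \prod_(l | l != k) g l (i l) =
  \prod_(l | l != k) \sum_j g l j.
Proof.
pose g' l j : R := if l == k then (j == j0)%:R else g l j.
have := sum_wt g'; rewrite [RHS](bigD1 k)//= [X in X * _](_ : _ = 1); last first.
  rewrite /g' eqxx (bigD1 j0)//= eqxx big1 ?addr0// => j /negbTE ->//.
rewrite mul1r => E; transitivity (\sum_i wt g' i).
  rewrite big_mkcond/=; apply: eq_bigr => i _.
  rewrite /wt [RHS](bigD1 k)//= {1}/g' eqxx; case: eqP => _; last by rewrite mul0r.
  by rewrite mul1r; apply: eq_bigr => l lk; rewrite /g' (negbTE lk).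
rewrite E; apply: eq_bigr => l lk.
by apply: eq_bigr => j _; rewrite /g' (negbTE lk).
Qed.

Lemma sum_fiber_sqr k (j0 : 'I_N) (x : cube r N -> R) (u : 'I_r -> 'I_N -> R)
    (F : R) :
  (forall i, \sum_v x (upd i k v) ^+ 2 <= F) ->
  \sum_i x i ^+ 2 * \prod_(l | l != k) u l (i l) ^+ 2 <=
  F * \prod_(l | l != k) \sum_j u l j ^+ 2.
Proof.
move=> xF; rewrite (sum_fiber k j0) -(sum_base k j0 (fun l j => u l j ^+ 2)).
rewrite mulr_sumr; apply: ler_sum => i _.
rewrite (eq_bigr (fun v => x (upd i k v) ^+ 2 *
    \prod_(l | l != k) u l (i l) ^+ 2)); last first.
  by move=> v _; congr (_ * _); apply: eq_bigr => l lk; rewrite upd_other.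
rewrite -mulr_suml ler_wpM2r//; apply: prodr_ge0 => l _; exact: sqr_ge0.
Qed.

(** Cauchy-Schwarz in direction [k], written as [2 a G <= al a^2 + G^2 / al]. Expanding
    [sum_v G v ^+ 2] produces the Gram matrix of the lines: its diagonal is weighted by the squares
    of the [b l], the rest by their absolute values, so small off-diagonal entries help when the l1
    norms of the [b l] are moderate. *)
Lemma gram_bound k (j0 : 'I_N) (z : cube r N -> R) (a : 'I_N -> R)
    (b : 'I_r -> 'I_N -> R) (Dg Of al : R) :
  0 < al -> 0 <= Of ->
  (forall i, \sum_v z (upd i k v) ^+ 2 <= Dg) ->
  (forall i i', i k = j0 -> i' k = j0 -> i != i' ->
    `|\sum_v z (upd i k v) * z (upd i' k v)| <= Of) ->
  \sum_i z i * (a (i k) * \prod_(l | l != k) b l (i l)) <=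
  2^-1 * (al * \sum_v a v ^+ 2 +
    al^-1 * ((\prod_(l | l != k) \sum_j b l j ^+ 2) * Dg +
             (\prod_(l | l != k) \sum_j `|b l j|) ^+ 2 * Of)).
Proof.
move=> al0 Of0 zD zO.
pose c i := \prod_(l | l != k) b l (i l).
pose G v := \sum_(i : cube r N | i k == j0) z (upd i k v) * c i.
have -> : \sum_i z i * (a (i k) * \prod_(l | l != k) b l (i l)) =
    \sum_v a v * G v.
  rewrite (sum_fiber k j0) exchange_big/=; apply: eq_bigr => v _.
  rewrite mulr_sumr; apply: eq_bigr => i _.
  rewrite upd_k mulrCA; congr (_ * (_ * _)).
  by apply: eq_bigr => l lk; rewrite upd_other.
have amgm : \sum_v a v * G v <=
    2^-1 * (al * \sum_v a v ^+ 2 + al^-1 * \sum_v G v ^+ 2).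
  rewrite !mulr_sumr -big_split/= mulr_sumr; apply: ler_sum => v _.
  have := sqr_ge0 (al * a v - G v).
  rewrite -(pmulr_rge0 _ (x := al^-1)) ?invr_gt0// => h.
  have : al^-1 * (al * a v - G v) ^+ 2 =
    al * a v ^+ 2 + al^-1 * G v ^+ 2 - 2 * (a v * G v).
    by field; rewrite gt_eqF.
  lra.
apply: le_trans amgm _; rewrite ler_wpM2l ?invr_ge0// lerD2l.
rewrite ler_wpM2l ?invr_ge0 ?(ltW al0)//.
have -> : \sum_v G v ^+ 2 = \sum_(i : cube r N | i k == j0)
    \sum_(i' : cube r N | i' k == j0)
      c i * c i' * \sum_v z (upd i k v) * z (upd i' k v).
  rewrite (eq_bigr (fun v => \sum_(i : cube r N | i k == j0)
    \sum_(i' : cube r N | i' k == j0)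
      c i * c i' * (z (upd i k v) * z (upd i' k v)))); last first.
    move=> v _; rewrite expr2 {1}/G mulr_suml; apply: eq_bigr => i _.
    rewrite mulr_sumr; apply: eq_bigr => i' _; ring.
  rewrite exchange_big/=; apply: eq_bigr => i _.
  by rewrite exchange_big/=; apply: eq_bigr => i' _; rewrite mulr_sumr.
have pt i i' : i k == j0 -> i' k == j0 ->
    c i * c i' * \sum_v z (upd i k v) * z (upd i' k v) <=
    (if i' == i then c i ^+ 2 * Dg else 0) + `|c i| * `|c i'| * Of.
  move=> /eqP ik /eqP i'k; case: eqP => [->|/eqP ne].
    rewrite -expr2 (_ : \sum_v _ = \sum_v z (upd i k v) ^+ 2)//.
    rewrite ler_wpDr ?mulr_ge0// ler_wpM2l ?sqr_ge0//.
  rewrite add0r (le_trans (ler_norm _))// !normrM ler_wpM2l ?mulr_ge0//.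
  by apply: zO => //; rewrite eq_sym.
apply: (@le_trans _ _ (\sum_(i : cube r N | i k == j0)
    \sum_(i' : cube r N | i' k == j0)
    ((if i' == i then c i ^+ 2 * Dg else 0) + `|c i| * `|c i'| * Of))).
  by apply: ler_sum => i ik; apply: ler_sum => i' i'k; exact: pt.
under [leLHS]eq_bigr do rewrite big_split/=.
rewrite big_split/=; apply: lerD.
  rewrite le_eqVlt; apply/orP; left; apply/eqP.
  rewrite -(sum_base k j0 (fun l j => b l j ^+ 2)) mulr_suml.
  apply: eq_bigr => i ik; rewrite -big_mkcondr/= (big_pred1 i) => [|i'].
    by rewrite /c -prodrXl.
  by rewrite /=; have [->|] := eqVneq i' i; rewrite ?ik ?andbF.
rewrite -(sum_base k j0 (fun l j => `|b l j|)) expr2 mulr_suml mulr_suml.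
rewrite le_eqVlt; apply/orP; left; apply/eqP; apply: eq_bigr => i _.
rewrite mulr_sumr mulr_suml; apply: eq_bigr => i' _.
by rewrite /c !normr_prod.
Qed.

End fibers.

Section classes.
Context {R : realType} {r N : nat}.
Variables (thr bet : R) (u : 'I_r -> 'I_N -> R).
Hypothesis thr_bet : thr <= bet.

Definition light_idx (i : cube r N) : bool :=
  [exists k, (`|u k (i k)| <= thr) &&
    [exists l, (l != k) && (`|u l (i l)| <= bet)]].

Definition cut (P : pred R) (t : R) : R := if P t then t else 0.

(** Outside [light_idx], either all coordinates exceed [thr], or some [k] has one at most [thr] and
    then all the others exceed [bet]. As [thr <= bet], this [k] is unique, so the three cases are
    disjoint and the cuts act as indicators. *)
Lemma form_split (z : cube r N -> R) :
  form z u = \sum_(i | light_idx i) z i * wt u i +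
    form z (fun k j => cut (fun t => thr < `|t|) (u k j)) +
    \sum_k \sum_i z i * (cut (fun t => `|t| <= thr) (u k (i k)) *
      \prod_(l | l != k) cut (fun t => bet < `|t|) (u l (i l))).
Proof.
rewrite exchange_big/= /form [X in X + _ + _]big_mkcond/= -!big_split/=.
apply: eq_bigr => i _; rewrite -mulr_sumr.
rewrite (_ : (if _ then _ else _) = z i * ((light_idx i)%:R * wt u i)); last first.
  by case: ifP => _; rewrite ?mul1r ?mul0r ?mulr0.
rewrite -!mulrDr; congr (_ * _).
have -> : wt (fun k j => cut (fun t => thr < `|t|) (u k j)) i =
    [forall k, thr < `|u k (i k)|]%:R * wt u i.
  have [/forallP h|/forallPn[k hk]] := boolP [forall k, thr < `|u k (i k)|].
    by rewrite mul1r /wt; apply: eq_bigr => k _; rewrite /cut h.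
  by rewrite mul0r /wt (bigD1 k)//= {1}/cut (negbTE hk) mul0r.
pose os k := (`|u k (i k)| <= thr) &&
  [forall l, (l != k) ==> (bet < `|u l (i l)|)].
rewrite (eq_bigr (fun k => (os k)%:R * wt u i)); last first.
  move=> k _; rewrite /os /cut; case: ifP => _; last by rewrite !mul0r.
  rewrite andTb; have [/forallP h|/forallPn[l]] :=
    boolP [forall l, (l != k) ==> (bet < `|u l (i l)|)].
    rewrite mul1r /wt [RHS](bigD1 k)//=; congr (_ * _); apply: eq_bigr => l lk.
    by have /implyP/(_ lk) -> := h l.
  rewrite negb_imply => /andP[lk lb].
  by rewrite (bigD1 l)//= (negbTE lb) mul0r mulr0 mul0r.
rewrite -mulr_suml -!mulrDl -{1}[wt u i]mul1r; congr (_ * _).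
have [zs|] := boolP [forall k, thr < `|u k (i k)|].
  rewrite big1 => [|k _]; last first.
    by rewrite /os leNgt (forallP zs k).
  suff -> : light_idx i = false by rewrite add0r addr0.
  by apply/negbTE/negP => /existsP[k /andP[]]; rewrite leNgt (forallP zs k).
move=> /forallPn[k]; rewrite -leNgt => uk.
have [/existsP[k' /andP[uk' /existsP[l /andP[lk' ul]]]]|nl] := boolP (light_idx i).
  rewrite big1 ?addr0// => m _; rewrite /os.
  suff -> : [forall l0, (l0 != m) ==> (bet < `|u l0 (i l0)|)] = false.
    by rewrite andbF.
  apply/negbTE/negP => /forallP h.
  have [E|ne] := eqVneq k' m.
    by have := h l; rewrite -E lk' /= ltNge ul.
  by have := h k'; rewrite ne /= ltNge (le_trans uk').
have osk l : l != k -> bet < `|u l (i l)|.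
  move=> lk; rewrite ltNge; apply: contra nl => ul.
  by apply/existsP; exists k; rewrite uk; apply/existsP; exists l; rewrite lk.
rewrite (bigD1 k)//= big1 => [|l lk].
  rewrite /os uk (_ : [forall l, (l != k) ==> (bet < `|u l (i l)|)]).
    by rewrite /= mulr1n !addr0 add0r.
  by apply/forallP => l; apply/implyP => /osk.
by rewrite /os leNgt (le_lt_trans thr_bet (osk l lk)).
Qed.

Lemma light_wt_le (i : cube r N) : 0 <= thr -> in_ball u -> light_idx i ->
  `|wt u i| <= 2 ^+ r * (thr * bet).
Proof.
move=> thr0 uB /existsP[k /andP[uk /existsP[l /andP[lk ul]]]].
have bet0 := le_trans thr0 thr_bet.
rewrite norm_wt (bigD1 k)//= (bigD1 l)//= [leLHS]mulrA [leLHS]mulrC.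
apply: ler_pM.
- by apply: prodr_ge0.
- by rewrite mulr_ge0.
- apply: (@le_trans _ _ (\prod_(m | (m != k) && (m != l)) 2)).
    by apply: ler_prod => m _; rewrite normr_ge0 (in_ball_coord_le _ _ uB).
  rewrite prodr_const ler_weXn2l//; first lra.
  by rewrite -[leqRHS](card_ord r) max_card.
- by rewrite ler_pM.
Qed.

End classes.

(** * The peeling argument *)

Section peeling.
Context {R : realType} {r N : nat}.
Variables (S : pred (cube r N)) (x : cube r N -> R) (u : 'I_r -> 'I_N -> R).

Definition box (B : 'I_r -> {set 'I_N}) (i : cube r N) : bool :=
  S i && [forall k, i k \in B k].

(** Budget of the peeling: a slice [i k = v] with at most [D] entries costs half of what removing
    [v] from [B k] takes off the [k]-th summand, and the other summands do not increase. *)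
Definition potential (D : nat) (al : R) (B : 'I_r -> {set 'I_N}) : R :=
  \sum_k (al * D%:R * (\sum_(v in B k) u k v ^+ 2) +
    al^-1 * \sum_(i | box B i) x i ^+ 2 * \prod_(l | l != k) u l (i l) ^+ 2).

Let sq_ge0 k (i : cube r N) :
  0 <= x i ^+ 2 * \prod_(l | l != k) u l (i l) ^+ 2.
Proof. by rewrite mulr_ge0 ?sqr_ge0// prodr_ge0// => l _; exact: sqr_ge0. Qed.

Lemma potential_ge0 D al B : 0 < al -> 0 <= potential D al B.
Proof.
move=> al0; apply: sumr_ge0 => k _; apply: addr_ge0; apply: mulr_ge0.
- by rewrite mulr_ge0 ?(ltW al0).
- by apply: sumr_ge0 => v _; exact: sqr_ge0.
- by rewrite invr_ge0 ltW.
- by apply: sumr_ge0.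
Qed.

(** Induction on the total size of the sides. If at most [Lam] entries are left, each is bounded by
    [tau]. Otherwise averaging over [B k] finds a slice with at most [D] entries, which is estimated
    by [2 a b <= al a^2 + b^2 / al] and removed. *)
Lemma peel (D : nat) (Lam tau al : R) (A B : 'I_r -> {set 'I_N}) :
  0 < al -> 0 <= Lam -> 0 <= tau ->
  (forall B : 'I_r -> {set 'I_N}, (forall k, B k \subset A k) ->
    #|box B|%:R <= Lam \/ exists k, (#|box B| <= D * #|B k|)%N) ->
  (forall i, box A i -> `|x i * wt u i| <= tau) ->
  (forall k, B k \subset A k) ->
  \sum_(i | box B i) `|x i * wt u i| <= Lam * tau + 2^-1 * potential D al B.
Proof.
move=> al0 Lam0 tau0 disc small.
have [m] := ubnP (\sum_k #|B k|)%N; elim: m B => // m IHm B; rewrite ltnS => Bm BA.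
have pot0 := potential_ge0 D B al0.
have boxA i : box B i -> box A i.
  move=> /andP[Si /forallP iB]; rewrite /box Si; apply/forallP => k.
  exact: (fintype.subsetP (BA k) _ (iB k)).
have [BL|[k BD]] := disc B BA.
  rewrite -[leLHS]addr0; apply: lerD; last by rewrite mulr_ge0 ?invr_ge0.
  apply: (@le_trans _ _ (\sum_(i | box B i) tau)).
    by apply: ler_sum => i /boxA; exact: small.
  by rewrite sumr_const -mulr_natl ler_wpM2r.
have [/existsP[i0 Bi0]|/existsPn B0] := boolP [exists i, box B i]; last first.
  rewrite big_pred0 => [|i]; last exact/negbTE.
  by rewrite addr_ge0 ?mulr_ge0 ?invr_ge0.
have cardB : (#|box B| = \sum_(v in B k) #|[pred i | box B i && (i k == v)]|)%N.
  rewrite -sum1_card (partition_big (fun i : cube r N => i k) (mem (B k))) /=.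
    apply: eq_bigr => v _; rewrite sum1_card; apply: eq_card => i.
    by rewrite !inE.
  by move=> i /andP[_ /forallP]; exact.
(* If all slices had more than [D] entries, the box would have more than [D * #|B k|]. The strict
   inequality needs an element of [B k], supplied by [i0]. *)
have [v vB vD] : exists2 v, v \in B k &
    (#|[pred i | box B i && (i k == v)]| <= D)%N.
  apply/exists_inP; apply: contraLR BD => /exists_inPn h.
  rewrite -ltnNge cardB mulnC -sum_nat_const.
  have vB : i0 k \in B k by case/andP: Bi0 => _ /forallP.
  rewrite (bigD1 (i0 k))//= [ltnRHS](bigD1 (i0 k))//= -addSn leq_add//.
    by rewrite ltnNge h.
  by apply: leq_sum => w /andP[wB _]; rewrite ltnW// ltnNge h.
pose B' l := if l == k then B k :\ v else B l.
have boxB' i : box B' i = box B i && (i k != v).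
  rewrite /box -andbA; congr (_ && _); apply/forallP/andP => [h|[/forallP h iv] l].
    split; last by have := h k; rewrite /B' eqxx in_setD1 => /andP[].
    apply/forallP => l; have := h l; rewrite /B'; case: eqP => // ->.
    by rewrite in_setD1 => /andP[].
  by rewrite /B'; case: eqP => [->|_]; rewrite ?in_setD1 ?iv h.
have B'A l : B' l \subset A l.
  rewrite /B'; case: eqP => // ->; apply: fintype.subset_trans (BA k).
  exact: subsetDl.
have B'm : (\sum_l #|B' l| < m)%N.
  apply: leq_trans Bm; rewrite (bigD1 k)//= [leqRHS](bigD1 k)//= -addSn leq_add//.
    by rewrite /B' eqxx [leqRHS](cardsD1 v) vB.
  by apply: leq_sum => l /negbTE lk; rewrite /B' lk.
have {IHm} IH := IHm B' B'm B'A.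
rewrite (bigID (fun i : cube r N => i k == v))/=.
rewrite [X in _ + X <= _](eq_bigl (box B')); last by move=> i; rewrite boxB'.
pose Q k' i := x i ^+ 2 * \prod_(l | l != k') u l (i l) ^+ 2.
have potB : potential D al B' + al * D%:R * u k v ^+ 2 +
    al^-1 * \sum_(i : cube r N | box B i && (i k == v)) Q k i <= potential D al B.
  rewrite /potential [X in _ <= X](bigD1 k)//= [X in X + _ + _](bigD1 k)//=.
  have E1 : \sum_(w in B k) u k w ^+ 2 =
      u k v ^+ 2 + \sum_(w in B' k) u k w ^+ 2.
    rewrite (bigD1 v)//=; congr (_ + _); apply: eq_bigl => w.
    by rewrite /B' eqxx in_setD1 andbC.
  have E2 : \sum_(i | box B i) Q k i =
      \sum_(i : cube r N | box B i && (i k == v)) Q k i + \sum_(i | box B' i) Q k i.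
    rewrite (bigID (fun i : cube r N => i k == v))/=; congr (_ + _).
    by apply: eq_bigl => i; rewrite boxB'.
  rewrite E1 -/(Q k) E2.
  have H : \sum_(l | l != k) (al * D%:R * (\sum_(w in B' l) u l w ^+ 2) +
      al^-1 * \sum_(i | box B' i) x i ^+ 2 * \prod_(l0 | l0 != l) u l0 (i l0) ^+ 2)
    <= \sum_(l | l != k) (al * D%:R * (\sum_(w in B l) u l w ^+ 2) +
      al^-1 * \sum_(i | box B i) x i ^+ 2 * \prod_(l0 | l0 != l) u l0 (i l0) ^+ 2).
    apply: ler_sum => l /negbTE lk; rewrite {1}/B' lk lerD2l.
    rewrite ler_wpM2l ?invr_ge0 ?(ltW al0)//.
    rewrite (eq_bigl _ _ boxB') big_mkcondr/=; apply: ler_sum => i _.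
    by case: ifP.
  lra.
have fib : \sum_(i : cube r N | box B i && (i k == v)) `|x i * wt u i| <=
    2^-1 * (al * D%:R * u k v ^+ 2 +
      al^-1 * \sum_(i : cube r N | box B i && (i k == v)) Q k i).
  apply: (@le_trans _ _ (\sum_(i : cube r N | box B i && (i k == v))
      2^-1 * (al * u k v ^+ 2 + al^-1 * Q k i))).
    apply: ler_sum => i /andP[_ /eqP ik].
    rewrite /Q prodrXl -exprMn -/(_ ^+ 2).
    rewrite /wt (bigD1 k)//= ik.
    set c := \prod_(l | _) _.
    have := sqr_ge0 (al * `|u k v| - `|x i * c|).
    rewrite -(pmulr_rge0 _ (x := al^-1)) ?invr_gt0//.
    have -> : al^-1 * (al * `|u k v| - `|x i * c|) ^+ 2 =
      al * `|u k v| ^+ 2 + al^-1 * `|x i * c| ^+ 2 - 2 * (`|u k v| * `|x i * c|).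
      by field; rewrite gt_eqF.
    have -> : `|x i * (u k v * c)| = `|u k v| * `|x i * c|.
      by rewrite mulrCA normrM.
    rewrite !real_normK ?num_real//; lra.
  rewrite -mulr_sumr ler_wpM2l ?invr_ge0// big_split/= -[X in _ + X <= _]mulr_sumr lerD2r.
  rewrite sumr_const -[leLHS]mulr_natr [leLHS]mulrAC ler_wpM2r ?sqr_ge0//.
  by rewrite ler_wpM2l ?(ltW al0)// ler_nat.
lra.
Qed.

End peeling.

(** * Heavy terms: levels of entries, blocks of coordinates *)

Lemma last_true (P : pred nat) (m : nat) : P 0%N -> ~~ P m ->
  exists2 j : 'I_m, P j & ~~ P j.+1.
Proof.
move=> P0; elim: m => [|m IHm] Pm; first by rewrite P0 in Pm.
have [Pm'|/IHm[j Pj Pj1]] := boolP (P m); first by exists ord_max.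
by exists (widen_ord (leqnSn m) j).
Qed.

(** How the density exponent is spent in a block: two factors for the upper end of the level,
    [q^(2r)] for the width of the blocks, and one [q] against the factor [q] of the discrepancy
    bound. *)
Lemma exprn_density (R : realType) (q : R) (b r : nat) :
  q ^+ (2 * b + 2 * r + 3) = q ^+ b.+1 * q ^+ b.+1 * q ^+ (2 * r) * q.
Proof. by rewrite -!exprD -exprSr; congr (_ ^+ _); lia. Qed.

Section heavy_part.
Context {R : realType} {r N : nat}.
Variables (x : cube r N -> R) (u : 'I_r -> 'I_N -> R).
Variables (q K al F2 : R) (a h L D : nat).
Hypotheses (q2 : 2 < q) (q2r : 2 ^+ r <= q) (K0 : 0 <= K) (al0 : 0 < al).
Hypothesis uB : in_ball u.
Hypothesis u_min : forall k j, u k j != 0 -> q ^- h <= `|u k j|.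
Hypothesis x_max : forall i, `|x i| <= q ^+ (a + L).
Hypothesis F2_ge0 : 0 <= F2.
Hypothesis F2_fiber : forall k i, \sum_v x (upd i k v) ^+ 2 <= F2.

Definition big_count (t : R) (B : 'I_r -> {set 'I_N}) : nat :=
  #|box (fun i => t < `|x i|) B|.

(** Tail bound of an entry at [q^(a+l)], from Markov's inequality at exponent [2 + eps] with
    [eps a >= 2r + 3]: up to [K] it beats the variance bound by [q^(2r+3)]. *)
Definition density (l : nat) : R := K / q ^+ (2 * (a + l) + 2 * r + 3).

Hypothesis discrepancy : forall (l : 'I_L) (B : 'I_r -> {set 'I_N}),
  (big_count (q ^+ (a + l)) B)%:R <= q * density l * \prod_k #|B k|%:R \/
  exists k, (big_count (q ^+ (a + l)) B <= D * #|B k|)%N.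

Definition heavy (i : cube r N) : bool :=
  (q ^+ a < `|x i|) && (1 < q ^+ h * `|x i * wt u i|).

Let q0 : 0 < q. Proof. exact: lt_trans q2. Qed.
Let q1 : 1 < q. Proof. by apply: lt_trans q2; rewrite ltr1n. Qed.

Let lev (l : 'I_L) (i : cube r N) : bool :=
  (q ^+ (a + l) < `|x i|) && (`|x i| <= q ^+ (a + l).+1).

(** Scales [2 q^-j] with [j <= h] suffice: the ball bounds coordinates by 2, and nonzero lattice
    coordinates are at least [q^-h], which exceeds [2 q^-(h+1)] as [q > 2]. *)
Let blk (J : {ffun 'I_r -> 'I_h.+1}) (k : 'I_r) : {set 'I_N} :=
  [set v | (2 * q ^- (J k).+1 < `|u k v|) && (`|u k v| <= 2 * q ^- (J k))]%SET.

Let heavy_located (i : cube r N) : heavy i ->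
  exists l J, box (lev l) (blk J) i.
Proof.
move=> /andP[xa xw].
have xa0 : q ^+ (a + 0) < `|x i| by rewrite addn0.
have xaL : ~~ (q ^+ (a + L) < `|x i|) by rewrite -leNgt.
have [l l1 l2] := @last_true (fun l => q ^+ (a + l) < `|x i|) L xa0 xaL.
have blk_ex k : exists j : 'I_h.+1,
    (2 * q ^- j.+1 < `|u k (i k)|) && (`|u k (i k)| <= 2 * q ^- j).
  have uk0 : u k (i k) != 0.
    apply/eqP => uk0; move: xw.
    by rewrite /wt (bigD1 k)//= uk0 mul0r mulr0 normr0 mulr0 ltr10.
  have u0 : `|u k (i k)| <= 2 * q ^- 0.
    by rewrite expr0 invr1 mulr1 (in_ball_coord_le _ _ uB).
  have uh : ~~ (`|u k (i k)| <= 2 * q ^- h.+1).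
    rewrite -ltNge (lt_le_trans _ (u_min uk0))// exprS invfM mulrA.
    by rewrite gtr_pMl ?invr_gt0 ?exprn_gt0// ltr_pdivrMr ?mul1r.
  have [j j1 j2] := @last_true (fun j => `|u k (i k)| <= 2 * q ^- j) h.+1 u0 uh.
  by exists j; rewrite j1 ltNge j2.
have /(_ _)/cid-/all_sig[J JP] := blk_ex.
exists l, [ffun k => J k]; rewrite /box /lev l1 -addnS leNgt l2/=.
by apply/forallP => k; rewrite inE ffunE JP.
Qed.

Let block_bound : R :=
  K * 2 ^+ r * q ^+ h + 2^-1 * (r%:R * (al * D%:R * 4 + al^-1 * (F2 * 4 ^+ r))).

Let potential_le (S : pred (cube r N)) (B : 'I_r -> {set 'I_N}) :
  potential S x u D al B <= r%:R * (al * D%:R * 4 + al^-1 * (F2 * 4 ^+ r)).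
Proof.
rewrite -[r in r%:R](card_ord r) mulr_natl -sumr_const; apply: ler_sum => k _.
have sub (J : finType) (Q : pred J) (f : J -> R) : (forall j, 0 <= f j) ->
    \sum_(j | Q j) f j <= \sum_j f j.
  by move=> f0; rewrite [leRHS](bigID Q)/= lerDl sumr_ge0.
apply: lerD; rewrite ler_wpM2l ?mulr_ge0 ?invr_ge0 ?(ltW al0)//.
  apply: le_trans (in_ballP _ uB k); apply: sub => j; exact: sqr_ge0.
case: (pickP (fun _ : cube r N => true)) => [i _|e]; last first.
  rewrite big1 => [|i]; last by have := e i.
  by rewrite mulr_ge0 ?exprn_ge0.
apply: (@le_trans _ _ (\sum_i x i ^+ 2 * \prod_(l | l != k) u l (i l) ^+ 2)).
  apply: sub => i'; rewrite mulr_ge0 ?sqr_ge0// prodr_ge0// => l _.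
  exact: sqr_ge0.
apply: le_trans (sum_fiber_sqr (i k) _ (F2_fiber k)) _.
rewrite ler_wpM2l //.
apply: (@le_trans _ _ (\prod_(l < r | l != k) 4)).
  apply: ler_prod => l _; rewrite (in_ballP _ uB) andbT.
  by apply: sumr_ge0 => j _; exact: sqr_ge0.
rewrite prodr_const ler_weXn2l//; first lra.
by rewrite -[leqRHS](card_ord r) max_card.
Qed.

Let block_le (l : 'I_L) (J : {ffun 'I_r -> 'I_h.+1}) (i0 : cube r N) :
  heavy i0 -> box (lev l) (blk J) i0 ->
  \sum_(i | box (lev l) (blk J) i) `|x i * wt u i| <= block_bound.
Proof.
move=> /andP[_ heavy0] box0.
set j := (\sum_k J k)%N.
pose Lam := q * density l * \prod_k q ^+ (2 * (J k).+1).
pose tau := q ^+ (a + l).+1 * \prod_k (2 * q ^- (J k)).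
have dens0 : 0 <= density l by rewrite divr_ge0// exprn_ge0// ltW.
have Lam0 : 0 <= Lam.
  apply: mulr_ge0; first by apply: mulr_ge0 => //; exact: ltW.
  by apply: prodr_ge0 => k _; rewrite exprn_ge0// ltW.
have tau0 : 0 <= tau.
  rewrite mulr_ge0 ?exprn_ge0 ?(ltW q0)// prodr_ge0// => k _.
  by rewrite mulr_ge0// invr_ge0 exprn_ge0// ltW.
have small i : box (lev l) (blk J) i -> `|x i * wt u i| <= tau.
  move=> /andP[/andP[_ xl] /forallP iJ]; rewrite normrM ler_pM// norm_wt.
  apply: ler_prod => k _; rewrite normr_ge0 /=.
  by have := iJ k; rewrite inE => /andP[].
(* Every element of the block contributes more than [4 q^-(2(J+1))] to a sum of squares bounded by
   4. *)
have cardblk k : #|blk J k|%:R <= q ^+ (2 * (J k).+1).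
  rewrite -[leRHS]mulr1 -ler_pdivrMl ?exprn_gt0//.
  rewrite -(ler_pM2l (x := 4))// mulr1; apply: le_trans (in_ballP _ uB k).
  rewrite mulrA mulr_natr -sumr_const.
  apply: (@le_trans _ _ (\sum_(v in blk J k) u k v ^+ 2)).
    apply: ler_sum => v; rewrite inE => /andP[uv _].
    rewrite -[leRHS]real_normK ?num_real//.
    have -> : 4 / q ^+ (2 * (J k).+1) = (2 * q ^- (J k).+1) ^+ 2.
      by rewrite mulnC exprM exprMn exprVn; congr (_ * _); ring.
    rewrite lerXn2r ?nnegrE ?(ltW uv)// mulr_ge0// invr_ge0 exprn_ge0// ltW//.
  by rewrite [leRHS](bigID (mem (blk J k)))/= lerDl sumr_ge0// => v _; exact: sqr_ge0.
have disc (B : 'I_r -> {set 'I_N}) : (forall k, B k \subset blk J k) ->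
    #|box (lev l) B|%:R <= Lam \/ exists k, (#|box (lev l) B| <= D * #|B k|)%N.
  move=> BJ; have sub : (#|box (lev l) B| <= big_count (q ^+ (a + l)) B)%N.
    apply: subset_leq_card; apply/fintype.subsetP => i.
    by move=> /andP[/andP[xl _] iB]; rewrite unfold_in /box xl.
  have [dl|[k dk]] := discrepancy l B; last first.
    by right; exists k; apply: leq_trans dk.
  left; apply: (@le_trans _ _ (big_count (q ^+ (a + l)) B)%:R).
    by rewrite ler_nat.
  apply: le_trans dl _.
  apply: ler_wpM2l; first by apply: mulr_ge0 => //; exact: ltW.
  apply: ler_prod => k _; rewrite ler0n /=; apply: le_trans (cardblk k).
  by rewrite ler_nat subset_leq_card.
have peeled := @peel _ _ _ (lev l) x u D Lam tau al (blk J) (blk J)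
  al0 Lam0 tau0 disc small (fun k => subxx _).
apply: le_trans peeled _; apply: lerD; last first.
  by rewrite ler_wpM2l ?invr_ge0//; exact: potential_le.
have prod1 : \prod_k q ^+ (2 * (J k).+1) = q ^+ (2 * j + 2 * r) :> R.
  rewrite prodrXr; congr (_ ^+ _).
  rewrite -big_distrr/= -mulnDr; congr (_ * _)%N.
  by under eq_bigr do rewrite -addn1; rewrite big_split/= sum1_card card_ord.
have prod2 : \prod_k (2 * q ^- (J k)) = 2 ^+ r * q ^- j :> R.
  rewrite big_split/= prodr_const card_ord; congr (_ * _).
  by rewrite prodfV prodrXr.
(* The heavy entry of the block forces [1 < q^h tau]. Since [2^r <= q], the constant in [tau] costs
   one power of [q], and the strict inequality between integer exponents recovers it. *)
have qj : q ^+ j <= q ^+ h * q ^+ (a + l).+1.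
  rewrite -exprD ler_eXn2l// -ltnS -(ltr_eXn2l q1).
  have h1 : 1 < q ^+ h * tau.
    by apply: lt_le_trans heavy0 _; rewrite ler_pM2l ?exprn_gt0// small.
  have h2 : q ^+ h * tau <= q ^+ (h + (a + l).+1).+1 * q ^- j.
    have -> : q ^+ (h + (a + l).+1).+1 * q ^- j =
        (q ^+ h * q ^+ (a + l).+1 * q ^- j) * q by rewrite exprS exprD; ring.
    have -> : q ^+ h * tau = (q ^+ h * q ^+ (a + l).+1 * q ^- j) * 2 ^+ r.
      by rewrite /tau prod2; ring.
    by rewrite ler_pM2l// !mulr_gt0 ?invr_gt0 ?exprn_gt0.
  have := lt_le_trans h1 h2.
  by rewrite -(ltr_pM2r (x := q ^+ j)) ?exprn_gt0// mul1r mulfVK// gt_eqF// exprn_gt0.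
have -> : Lam * tau = K * 2 ^+ r * (q ^+ j / q ^+ (a + l).+1).
  rewrite /Lam /tau prod1 prod2 /density exprn_density exprD.
  have -> : q ^+ (2 * j) = q ^+ j * q ^+ j by rewrite mul2n -addnn exprD.
  by field; rewrite !expf_neq0 ?gt_eqF.
rewrite ler_wpM2l ?mulr_ge0 ?exprn_ge0// ler_pdivrMr ?exprn_gt0//.
Qed.

(** A union over the pairs of a level and a block that contain a heavy index. Their number does not
    involve [N], because [q] is a fixed power of [N]. *)
Lemma heavy_sum_le :
  \sum_(i | heavy i) `|x i * wt u i| <=
  (L * h.+1 ^ r)%:R *
  (K * 2 ^+ r * q ^+ h + 2^-1 * (r%:R * (al * D%:R * 4 + al^-1 * (F2 * 4 ^+ r)))).
Proof.
rewrite -/block_bound.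
pose act (p : 'I_L * {ffun 'I_r -> 'I_h.+1}) :=
  [exists i, heavy i && box (lev p.1) (blk p.2) i].
have bb0 : 0 <= block_bound.
  rewrite addr_ge0 ?mulr_ge0 ?exprn_ge0 ?(ltW q0)//.
  by rewrite addr_ge0 ?mulr_ge0 ?invr_ge0 ?exprn_ge0 ?(ltW al0).
apply: (@le_trans _ _ (\sum_(p | act p)
    \sum_(i | box (lev p.1) (blk p.2) i) `|x i * wt u i|)).
  rewrite (exchange_big_dep xpredT)//= big_mkcond/=; apply: ler_sum => i _.
  case: ifPn => hi; last by rewrite sumr_ge0.
  have [l [J iJ]] := heavy_located hi.
  rewrite (bigD1 (l, J))/=; last first.
    by rewrite iJ andbT; apply/existsP; exists i; rewrite hi.
  by rewrite lerDl sumr_ge0.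
apply: (@le_trans _ _ (\sum_(p | act p) block_bound)).
  by apply: ler_sum => -[l J] /existsP[i /andP[hi iJ]]; exact: block_le hi iJ.
rewrite sumr_const -[leLHS]mulr_natl ler_wpM2r// ler_nat.
apply: leq_trans (max_card _) _.
by rewrite card_prod card_ffun !card_ord.
Qed.

End heavy_part.

(** * Light, sparse and heavy parts *)

Definition trunc (R : realType) (c t : R) : R := if `|t| <= c then t else 0.

Section decomposition.
Context {R : realType} {r N : nat}.
Variables (s A thr bet : R) (m : cube r N -> R).
Hypotheses (s0 : 0 < s) (A0 : 0 < A) (thr_bet : thr <= bet).
Hypothesis m_le : forall i, `|m i| <= A^-1.

Definition centered (i : cube r N) (t : R) : R := trunc A t - m i.

(** The first summand compares the truncation at [1 / (s |w|)] with the centered truncation at [A],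
    which is treated separately; the second is the part of the latter at indices of small weight.
    Both are [O(1/s)], the size for which an exponential moment at [lam ~ s] exists. *)
Definition light_fun (u : 'I_r -> 'I_N -> R) (i : cube r N) (t : R) : R :=
  (if s * A * `|wt u i| <= 1
   then ((if s * `|t * wt u i| <= 1 then t else 0) - trunc A t + m i) * wt u i
   else 0) +
  (if light_idx thr bet u i then centered i t * wt u i else 0).

Lemma trunc_norm_le (c t : R) : 0 <= c -> `|trunc c t| <= c.
Proof. by move=> c0; rewrite /trunc; case: ifP => //; rewrite normr0. Qed.

Lemma trunc_norm_le_id (c t : R) : `|trunc c t| <= `|t|.
Proof. by rewrite /trunc; case: ifP; rewrite ?normr0. Qed.

Lemma centered_norm_le i t : A^-1 <= A -> `|centered i t| <= 2 * A.
Proof.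
move=> A1; rewrite (le_trans (ler_normB _ _))//.
have := trunc_norm_le t (ltW A0); have := m_le i; lra.
Qed.

Lemma decompose (x : cube r N -> R) (u : 'I_r -> 'I_N -> R) : in_ball u ->
  form x u <=
    \sum_i light_fun u i (x i) +
    form (fun i => centered i (x i)) (fun k j => cut (fun t => thr < `|t|) (u k j)) +
    \sum_k \sum_i centered i (x i) * (cut (fun t => `|t| <= thr) (u k (i k)) *
      \prod_(l | l != k) cut (fun t => bet < `|t|) (u l (i l))) +
    \sum_(i | (A < `|x i|) && (1 < s * `|x i * wt u i|)) `|x i * wt u i| +
    s * 4 ^+ r.
Proof.
move=> uB.
have -> : form x u = form (fun i => centered i (x i)) u +
    \sum_i (x i - centered i (x i)) * wt u i.
  by rewrite /form -big_split/=; apply: eq_bigr => i _; ring.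
rewrite (form_split _ thr_bet).
have -> : \sum_i light_fun u i (x i) =
    \sum_(i | light_idx thr bet u i) centered i (x i) * wt u i +
    \sum_i (if s * A * `|wt u i| <= 1
   then ((if s * `|x i * wt u i| <= 1 then x i else 0) - trunc A (x i) + m i) * wt u i
   else 0).
  by rewrite [X in X + _]big_mkcond/= -big_split/=; apply: eq_bigr => i _; rewrite addrC.
have rest : \sum_i (x i - centered i (x i)) * wt u i <=
    \sum_i (if s * A * `|wt u i| <= 1
   then ((if s * `|x i * wt u i| <= 1 then x i else 0) - trunc A (x i) + m i) * wt u i
   else 0) +
    \sum_(i | (A < `|x i|) && (1 < s * `|x i * wt u i|)) `|x i * wt u i| +
    s * 4 ^+ r.
  apply: (@le_trans _ _ (\sum_i (if s * A * `|wt u i| <= 1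
   then ((if s * `|x i * wt u i| <= 1 then x i else 0) - trunc A (x i) + m i) * wt u i
   else 0) +
    \sum_(i | (A < `|x i|) && (1 < s * `|x i * wt u i|)) `|x i * wt u i| +
    \sum_i s * wt u i ^+ 2)); last first.
    by rewrite lerD2l -mulr_sumr ler_wpM2l ?(ltW s0)//; exact: sum_wt_sqr_le.
  rewrite [X in _ + X + _]big_mkcond/= -!big_split/=; apply: ler_sum => i _.
  have sw0 : 0 <= s * wt u i ^+ 2 by rewrite mulr_ge0 ?sqr_ge0 ?(ltW s0).
  rewrite /centered; set w := wt u i in sw0 *.
  have [sw|sw] := leP (s * A * `|w|) 1.
    have [sx|sx] := leP (s * `|x i * w|) 1.
      by rewrite andbF; nra.
    (* As [s A |w| <= 1], an entry of size at most [A] would give a light term. *)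
    have xA : A < `|x i|.
      rewrite ltNge; apply: contraTN sx => xA; rewrite -leNgt (le_trans _ sw)//.
      by rewrite normrM -mulrA ler_wpM2l ?(ltW s0)// ler_wpM2r.
    rewrite xA/=; have := ler_norm (x i * w); nra.
  rewrite add0r.
  (* Now [s A |w| > 1] and the mean [m i] is not part of [light_fun]. It is absorbed through
     [|m i| <= 1/A < s |w|]; summing over [i] gives the term [s * 4 ^+ r]. *)
  have mw : `|m i * w| <= s * w ^+ 2.
    rewrite normrM (le_trans (ler_wpM2r _ (m_le i)))//.
    rewrite -[w ^+ 2]real_normK ?num_real// expr2 mulrA ler_wpM2r//.
    by rewrite -[leLHS]mul1r ler_pdivrMr// mulrAC ltW.
  rewrite /trunc; have [xA|xA] := leP `|x i| A.
    rewrite /= add0r (_ : _ * w = m i * w); last by ring.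
    exact: le_trans (ler_norm _) mw.
  have -> : 1 < s * `|x i * w|.
    rewrite (lt_le_trans sw)// normrM -mulrA ler_wpM2l ?(ltW s0)// ler_wpM2r//.
    exact: ltW.
  rewrite /= (_ : (_ - _) * w = x i * w + m i * w); last by ring.
  by rewrite lerD ?ler_norm// (le_trans (ler_norm _) mw).
lra.
Qed.

Lemma light_fun_norm_le (u : 'I_r -> 'I_N -> R) (i : cube r N) (t : R) :
  in_ball u -> 0 <= thr -> 1 <= A -> 2 ^+ r * (thr * bet) * (s * A) <= 1 ->
  `|light_fun u i t| <= 4 / s.
Proof.
move=> uB thr0 A1 small.
have -> : 4 / s = 2 / s + 2 / s by field; rewrite gt_eqF.
have A1V : A^-1 <= A by rewrite (le_trans _ A1)// invf_le1.
rewrite (le_trans (ler_normD _ _))// lerD//.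
  case: ifP => [sw|_]; last by rewrite normr0 divr_ge0// ltW.
  have sA0 : 0 < s * A by rewrite mulr_gt0.
  have wA : `|wt u i| <= s^-1 / A.
    by rewrite -invfM -[leRHS]mul1r ler_pdivlMr// mulrC.
  rewrite mulrDl (le_trans (ler_normD _ _))//.
  have -> : 2 / s = s^-1 + s^-1 by ring.
  rewrite lerD//.
    have s00 : 0 <= s^-1 by rewrite invr_ge0 ltW.
    rewrite /trunc; have [st|st] := leP (s * `|t * wt u i|) 1.
      have [tA|tA] := leP `|t| A; first by rewrite subrr mul0r normr0.
      by rewrite subr0 -[leRHS]mul1r ler_pdivlMr// mulrC.
    suff /negbTE -> : ~~ (`|t| <= A) by rewrite subr0 mul0r normr0.
    apply: contraTN st => tA; rewrite -leNgt (le_trans _ sw)//.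
    by rewrite normrM -mulrA ler_wpM2l ?(ltW s0)// ler_wpM2r.
  rewrite normrM (le_trans (ler_pM _ _ (m_le i) wA))//.
  rewrite mulrA mulrAC -{2}[s^-1]mul1r ler_wpM2r ?invr_ge0 ?(ltW s0)//.
  by rewrite -invfM invf_le1 ?mulr_gt0// -[leLHS]mulr1 ler_pM.
case: ifP => [li|_]; last by rewrite normr0 divr_ge0// ltW.
rewrite normrM.
apply: (@le_trans _ _ (2 * A * (2 ^+ r * (thr * bet)))).
  by rewrite ler_pM// ?centered_norm_le// light_wt_le.
by rewrite ler_pdivlMr//; move: small; lra.
Qed.

End decomposition.

Lemma factorizes_comp (R : realType) (d : measure_display)
    (T : measurableType d) (P : probability T R) (I J : finType)
    (X : I -> T -> R) (e : J -> I) :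
  (forall i, measurable_fun [set: T] (X i)) -> injective e ->
  factorizes P X -> factorizes P (fun j => X (e j)).
Proof.
move=> mX e_inj facX f bf.
pose f' i t := \prod_(j | e j == i) f j t.
have bf' i : bounded_measurable (f' i) by apply: bm_prod.
transitivity (mean P (fun x => \prod_i f' i (X i x))).
  apply: eq_mean => x; rewrite (partition_big e predT)//=.
  apply: eq_bigr => i _; rewrite /f'; apply: eq_bigr => j /eqP ->//.
rewrite facX// (partition_big e predT)//=; apply: eq_bigr => i _.
case: (pickP (fun j => e j == i)) => [j /eqP ej|ne]; last first.
  rewrite [RHS]big_pred0// -[RHS](mean_cst P); apply: eq_mean => x.
  by rewrite /f' big_pred0.
have E k : (e k == i) = (k == j) by rewrite -ej (inj_eq e_inj).
rewrite [RHS](big_pred1 j)//; apply: eq_mean => x.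
by rewrite /f' (big_pred1 j)// ej.
Qed.

Section measurable_pieces.
Context {R : realType}.

Lemma measurable_trunc (c : R) : measurable_fun [set: R] (trunc c).
Proof.
by apply: measurable_fun_ifT => //; exact: measurable_fun_ler.
Qed.

Lemma bm_trunc (c : R) : bounded_measurable (trunc c).
Proof.
split; first exact: measurable_trunc.
exists `|c| => t; rewrite /trunc; case: ifP => [tc|_]; last by rewrite normr0.
by rewrite (le_trans tc)// ler_norm.
Qed.

Lemma bm_gt (c : R) :
  bounded_measurable (fun t : R => if c < `|t| then 1 else 0 : R).
Proof.
apply: bm_if; [|exact: bm_cst|exact: bm_cst].
exact: measurable_fun_ltr.
Qed.

End measurable_pieces.

(** * Exponential moments of the light, sparse, line and Gram sums *)

Section one_variable.
Context {R : realType} {d : measure_display} {T : measurableType d}.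
Variable P : probability T R.

Lemma mean_expR_le (f : T -> R) (v1 v2 : R) : bounded_measurable f ->
  (forall x, f x <= 2^-1) -> mean P f <= v1 ->
  mean P (fun x => f x ^+ 2) <= v2 ->
  mean P (fun x => expR (f x)) <= expR (v1 + 2 * v2).
Proof.
move=> bf f2 fv1 fv2.
have bf2 : bounded_measurable (fun x => f x ^+ 2) by exact: bmX.
apply: (@le_trans _ _ (mean P (fun x => 1 + f x + 2 * f x ^+ 2))).
  apply: le_mean; [exact: bm_expR| |by move=> x; exact: expR_le_quadratic].
  by apply: bmD; [apply: bmD => //; exact: bm_cst|exact: bmZ].
rewrite meanD; [|by apply: bmD => //; exact: bm_cst|exact: bmZ].
rewrite meanD ?mean_cst ?meanZ//; last exact: bm_cst.
by apply: le_trans (expR_ge1Dx _); lra.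
Qed.

Lemma mean_expR_le_square (f : T -> R) (c : R) : bounded_measurable f ->
  (forall x, `|f x| <= c) -> mean P f = 0 ->
  mean P (fun x => expR (f x)) <= expR (2 * c ^+ 2).
Proof.
move=> bf fc f0; have bf2 : bounded_measurable (fun x => expR (2 * f x ^+ 2)).
  by apply: bm_expR; apply: bmZ; exact: bmX.
apply: (@le_trans _ _ (mean P (fun x => f x + expR (2 * f x ^+ 2)))).
  apply: le_mean; [exact: bm_expR|exact: bmD|].
  by move=> x; exact: expR_le_linear_square.
rewrite meanD// f0 add0r -[leRHS](mean_cst P); apply: le_mean => // [|x].
  exact: bm_cst.
rewrite ler_expR ler_wpM2l// -[f x ^+ 2]real_normK ?num_real//.
by rewrite lerXn2r ?nnegrE// (le_trans _ (fc x)).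
Qed.

End one_variable.

Section light_mgf.
Context {R : realType} {d : measure_display} {T : measurableType d}.
Variable P : probability T R.
Context {r N : nat}.
Variable X : cube r N -> T -> R.
Hypothesis mX : forall i, measurable_fun [set: T] (X i).
Hypothesis facX : factorizes P X.
Hypothesis tmean : forall i c, 0 < c ->
  `|mean P (fun w => trunc c (X i w))| <= c^-1.
Hypothesis tsq : forall i c, 0 < c ->
  mean P (fun w => trunc c (X i w) ^+ 2) <= 1.
Variables (s A : R).
Hypotheses (s0 : 0 < s) (sN : s ^+ 2 = N%:R) (A1 : 1 <= A).

Definition trunc_mean (i : cube r N) : R := mean P (fun w => trunc A (X i w)).

Definition centered_rv (i : cube r N) (w : T) : R := centered A trunc_mean i (X i w).

Let A0 : 0 < A. Proof. exact: lt_le_trans A1. Qed.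

Lemma trunc_mean_le i : `|trunc_mean i| <= A^-1. Proof. exact: tmean. Qed.

Lemma trunc_mean_sqr_le i : trunc_mean i ^+ 2 <= 1.
Proof.
rewrite -[trunc_mean i ^+ 2]real_normK ?num_real// -(expr1n _ 2).
by rewrite lerXn2r ?nnegrE// (le_trans (trunc_mean_le i))// invf_le1.
Qed.

Lemma bm_truncX i c : bounded_measurable (fun w => trunc c (X i w)).
Proof. by apply: bm_comp (mX i); exact: bm_trunc. Qed.

Lemma bm_centered i : bounded_measurable (centered A trunc_mean i).
Proof. by apply: bmB; [exact: bm_trunc|exact: bm_cst]. Qed.

Lemma bm_centered_rv i : bounded_measurable (centered_rv i).
Proof. exact: bm_comp (bm_centered i) (mX i). Qed.

Lemma mean_centered_rv i : mean P (centered_rv i) = 0.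
Proof.
rewrite /centered_rv /centered meanB; [|exact: bm_truncX|exact: bm_cst].
by rewrite mean_cst subrr.
Qed.

Lemma centered_rv_norm_le i w : `|centered_rv i w| <= 2 * A.
Proof.
apply: centered_norm_le => //; first exact: trunc_mean_le.
by rewrite (le_trans _ A1)// invf_le1.
Qed.

Lemma mean_centered_rv_sqr i : mean P (fun w => centered_rv i w ^+ 2) <= 4.
Proof.
have bt := bmX 2 (bm_truncX i A).
apply: (@le_trans _ _ (mean P (fun w => 2 * trunc A (X i w) ^+ 2 + 2))).
  apply: le_mean => [||w]; first exact: bmX (bm_centered_rv i).
    by apply: bmD; [exact: bmZ|exact: bm_cst].
  rewrite /centered_rv /centered; have := trunc_mean_sqr_le i.
  have := sqr_ge0 (trunc A (X i w) + trunc_mean i); nra.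
rewrite meanD ?meanZ ?mean_cst//; [|exact: bmZ|exact: bm_cst].
by have := tsq i A0; lra.
Qed.

Section light.
Variables (thr bet : R) (u : 'I_r -> 'I_N -> R).
Hypotheses (uB : in_ball u) (thr0 : 0 <= thr) (thr_bet : thr <= bet).
Hypothesis small : 2 ^+ r * (thr * bet) * (s * A) <= 1.

Let lf := light_fun s A thr bet trunc_mean u.

Lemma bm_light_fun i : bounded_measurable (lf i).
Proof.
split; last first.
  by exists (4 / s) => t; apply: light_fun_norm_le => //; exact: trunc_mean_le.
apply: measurable_funD.
  case: (s * A * `|wt u i| <= 1); last exact: measurable_cst.
  apply: measurable_funM => //; apply: measurable_funD => //.
  apply: measurable_funB; last exact: measurable_trunc.
  apply: measurable_fun_ifT => //; apply: measurable_fun_ler => //.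
  apply: measurable_funM => //.
  apply: measurableT_comp; first exact: normr_measurable.
  exact: measurable_funM.
case: (light_idx thr bet u i); last exact: measurable_cst.
by apply: measurable_funM => //; case: (bm_centered i).
Qed.

(** With [c = 1 / (s |w|)] the condition [s |t w| <= 1] is truncation at [c]. The centered pieces
    have mean 0, so at most [w * mean (trunc c)] survives, and this is at most [|w| / c = s w^2]. *)
Lemma light_fun_moments i :
  mean P (fun w => lf i (X i w)) <= s * wt u i ^+ 2 /\
  mean P (fun w => lf i (X i w) ^+ 2) <= 16 * wt u i ^+ 2.
Proof.
have [w0|w0] := eqVneq (wt u i) 0.
  have lf0 t : lf i t = 0.
    by rewrite /lf /light_fun w0 !mulr0 !if_same addr0.
  rewrite w0 expr0n !mulr0; split.
    rewrite (eq_mean _ (g := fun=> 0)) ?mean_cst// => x; exact: lf0.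
  by rewrite (eq_mean _ (g := fun=> 0)) ?mean_cst// => x; rewrite lf0 expr0n.
set v := wt u i in w0 *.
have w_gt0 : 0 < `|v| by rewrite normr_gt0.
pose c := (s * `|v|)^-1.
have c0 : 0 < c by rewrite invr_gt0 mulr_gt0.
have cut_trunc t : (if s * `|t * v| <= 1 then t else 0) = trunc c t.
  rewrite /trunc /c; congr (if _ then _ else _).
  by rewrite -[(_ * _)^-1]mul1r ler_pdivlMr ?mulr_gt0// normrM mulrCA.
pose b1 : R := (s * A * `|v| <= 1)%R%:R.
pose b2 : R := (light_idx thr bet u i)%:R.
have lfE t : lf i t =
    v * (b1 * (trunc c t - trunc A t + trunc_mean i) + b2 * (trunc A t - trunc_mean i)).
  rewrite /lf /light_fun /centered -/v cut_trunc /b1 /b2.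
  by case: ifP => _; case: ifP => _; rewrite /= ?mulr1n ?mulr0n; ring.
have b1P : b1 = 0 \/ b1 = 1 by rewrite /b1; case: (_ <= _); [right|left].
have b2P : b2 = 0 \/ b2 = 1 by rewrite /b2; case: light_idx; [right|left].
have bc := bm_truncX i c; have bA := bm_truncX i A.
have b1m : bounded_measurable (fun w => trunc c (X i w) - trunc A (X i w) + trunc_mean i).
  by apply: bmD; [exact: bmB|exact: bm_cst].
have mlf : mean P (fun w => lf i (X i w)) =
    v * (b1 * mean P (fun w => trunc c (X i w))).
  rewrite (eq_mean _ (fun w => lfE (X i w))) meanZ; last first.
    apply: bmD; apply: bmZ => //; exact: bm_centered_rv.
  rewrite meanD; [|exact: bmZ|by apply: bmZ; exact: bm_centered_rv].
  rewrite meanZ// meanZ; last exact: bm_centered_rv.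
  rewrite [mean P (fun w => trunc A _ - _)](mean_centered_rv i) mulr0 addr0.
  rewrite meanD; [|exact: bmB|exact: bm_cst].
  by rewrite meanB// mean_cst -/(trunc_mean i) subrK.
split.
  rewrite mlf (le_trans (ler_norm _))// !normrM mulrCA.
  apply: (@le_trans _ _ (1 * (`|v| * c^-1))).
    rewrite ler_pM ?mulr_ge0// ?ler_wpM2l// ?tmean//.
    by case: b1P => ->; rewrite ?normr0 ?normr1.
  by rewrite mul1r /c invrK mulrCA -expr2 real_normK ?num_real.
have bc2 := bmX 2 bc; have bA2 := bmX 2 bA.
apply: (@le_trans _ _ (mean P (fun w => v ^+ 2 *
    (4 * trunc c (X i w) ^+ 2 + 4 * trunc A (X i w) ^+ 2 + 8)))).
  apply: le_mean => [||w].
  - by apply: bmX; apply: bm_comp (mX i); exact: bm_light_fun.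
  - by apply: bmZ; apply: bmD; [apply: bmD; exact: bmZ|exact: bm_cst].
  rewrite lfE exprMn ler_wpM2l ?sqr_ge0//.
  have t1 := trunc_mean_sqr_le i.
  (* When the first piece is active, [A <= c], so [trunc c - trunc A] is either 0 or all of
     [trunc c]. This keeps the constant at [4 + 4 + 8 = 16]. *)
  have [h|h] : trunc c (X i w) - trunc A (X i w) = trunc c (X i w) \/
      b1 * (trunc c (X i w) - trunc A (X i w)) = 0.
    rewrite /b1; have [sv|_] := leP (s * A * `|v|) 1; last by right; rewrite mul0r.
    have Ac : A <= c.
      by rewrite /c -[leRHS]mul1r ler_pdivlMr ?mulr_gt0// mulrCA mulrA.
    rewrite /trunc; have [tA|tA] := leP `|X i w| A.
      by right; rewrite (le_trans tA Ac) subrr mulr0.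
    by left; rewrite subr0.
  - rewrite h; set t := trunc c _; set t' := trunc A _.
    have := sqr_ge0 (t - trunc_mean i); have := sqr_ge0 (t' + trunc_mean i).
    have := sqr_ge0 (t + trunc_mean i - (t' - trunc_mean i)).
    have := sqr_ge0 t; have := sqr_ge0 t'.
    by case: b1P => ->; case: b2P => ->; nra.
  - rewrite mulrDr h add0r; set t := trunc c _; set t' := trunc A _.
    have := sqr_ge0 (t' + trunc_mean i); have := sqr_ge0 (trunc_mean i - (t' - trunc_mean i)).
    have := sqr_ge0 t; have := sqr_ge0 t'.
    by case: b1P => ->; case: b2P => ->; nra.
rewrite meanZ; last by apply: bmD; [apply: bmD; exact: bmZ|exact: bm_cst].
rewrite [leRHS]mulrC ler_wpM2l ?sqr_ge0//.
rewrite meanD; [|by apply: bmD; exact: bmZ|exact: bm_cst].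
rewrite meanD ?meanZ ?mean_cst//; [|exact: bmZ..].
by have := tsq i A0; have := tsq i c0; lra.
Qed.

(** The parameter [s / 8] against [|light_fun| <= 4 / s] keeps the exponent at most [1/2]. Each
    entry then contributes at most [(1/8 + 1/2) s^2 w^2], and [sum w^2 <= 4^r]. *)
Lemma light_mgf : mean P (fun w => expR (s / 8 * \sum_i lf i (X i w))) <=
  expR (4 ^+ r * N%:R).
Proof.
have s8 : 0 <= s / 8 by rewrite divr_ge0// ltW.
rewrite (eq_mean _ (g := fun w => expR (\sum_i (s / 8 * lf i (X i w))))); last first.
  by move=> w; rewrite mulr_sumr.
apply: (@le_trans _ _ (expR (\sum_i N%:R * wt u i ^+ 2))); last first.
  by rewrite ler_expR -mulr_sumr mulrC ler_wpM2r// sum_wt_sqr_le.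
apply: (mgf_sum facX (f := fun i t => s / 8 * lf i t)).
  by move=> i; apply: bmZ; exact: bm_light_fun.
move=> i; have [m1 m2] := light_fun_moments i.
have blf : bounded_measurable (fun w => lf i (X i w)).
  by apply: bm_comp (mX i); exact: bm_light_fun.
apply: (@le_trans _ _ (expR (s / 8 * (s * wt u i ^+ 2) +
    2 * ((s / 8) ^+ 2 * (16 * wt u i ^+ 2))))).
  apply: mean_expR_le; first exact: bmZ.
  - move=> w; rewrite (le_trans (ler_norm _))// normrM (ger0_norm s8).
    apply: (@le_trans _ _ (s / 8 * (4 / s))).
      by rewrite ler_wpM2l// light_fun_norm_le//; exact: trunc_mean_le.
    by rewrite le_eqVlt; apply/orP; left; apply/eqP; field; rewrite gt_eqF.
  - by rewrite meanZ// ler_wpM2l.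
  - under eq_fun do rewrite exprMn.
    by rewrite meanZ ?ler_wpM2l ?sqr_ge0//; exact: bmX.
rewrite ler_expR -sN; have := sqr_ge0 (s * wt u i); nra.
Qed.

End light.

End light_mgf.

Section pair_mgf.
Context {R : realType} {d : measure_display} {T : measurableType d}.
Variable P : probability T R.
Context {N : nat}.
Variable Y : bool * 'I_N -> T -> R.
Hypothesis mY : forall p, measurable_fun [set: T] (Y p).
Hypothesis facY : factorizes P Y.
Variable g : bool * 'I_N -> R -> R.
Hypothesis bg : forall p, bounded_measurable (g p).
Let G p w := g p (Y p w).
Hypothesis G_mean0 : forall p, mean P (G p) = 0.
Hypothesis G_sqr : forall p, mean P (fun w => G p w ^+ 2) <= 4.

Let bG p : bounded_measurable (G p). Proof. exact: bm_comp. Qed.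

(* e^u <= 1 + u + 2u^2 turns the exponential into a polynomial, whose expansion
   only contains products of functions of single variables. *)
Lemma pair_mgf (lam : R) :
  (forall v w, lam * (G (false, v) w * G (true, v) w) <= 2^-1) ->
  mean P (fun w => expR (lam * \sum_v G (false, v) w * G (true, v) w)) <=
  expR (32 * lam ^+ 2 * N%:R).
Proof.
move=> small.
pose cf (c : 'I_3) : R := [:: 1; lam; 2 * lam ^+ 2]`_c.
have bp p n : bounded_measurable (fun w => G p w ^+ n) by exact: bmX.
have poly w v : 1 + lam * (G (false, v) w * G (true, v) w) +
    2 * (lam * (G (false, v) w * G (true, v) w)) ^+ 2 =
    \sum_(c < 3) cf c * (G (false, v) w ^+ c * G (true, v) w ^+ c).
  by rewrite !big_ord_recl big_ord0 /cf /=; ring.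
apply: (@le_trans _ _ (mean P (fun w =>
    \prod_v \sum_(c < 3) cf c * (G (false, v) w ^+ c * G (true, v) w ^+ c)))).
  apply: le_mean.
  - apply: bm_expR; apply: bmZ; apply: bm_sum => v _; exact: bmM.
  - apply: bm_prod => v _; apply: bm_sum => c _; apply: bmZ; exact: bmM.
  move=> w; rewrite mulr_sumr expR_sum; apply: ler_prod => v _.
  by rewrite expR_ge0 -poly; exact: expR_le_quadratic.
have term (f : {ffun 'I_N -> 'I_3}) :
    mean P (fun w => \prod_v (cf (f v) *
      (G (false, v) w ^+ f v * G (true, v) w ^+ f v))) =
    \prod_v (cf (f v) * (mean P (fun w => G (false, v) w ^+ f v) *
      mean P (fun w => G (true, v) w ^+ f v))).
  have split_pairs (F : bool * 'I_N -> R) :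
      \prod_p F p = \prod_v (F (false, v) * F (true, v)).
    transitivity (\prod_b \prod_v F (b, v)).
      by rewrite pair_bigA; apply: eq_bigr => -[].
    by rewrite big_bool /= mulrC big_split.
  rewrite (eq_mean _ (g := fun w => (\prod_v cf (f v)) *
      \prod_p G p w ^+ f p.2)); last first.
    by move=> w; rewrite big_split/= split_pairs.
  rewrite meanZ; last by apply: bm_prod => p _; exact: bp.
  rewrite (facY (f := fun p t => g p t ^+ f p.2)); last first.
    by move=> p; exact: bmX.
  by rewrite split_pairs -big_split.
rewrite (eq_mean _ (g := fun w => \sum_(f : {ffun 'I_N -> 'I_3})
    \prod_v (cf (f v) * (G (false, v) w ^+ f v * G (true, v) w ^+ f v)))); last first.
  move=> w.
  exact: (bigA_distr_bigA (fun v (c : 'I_3) =>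
    cf c * (G (false, v) w ^+ c * G (true, v) w ^+ c))).
rewrite mean_sum; last first.
  move=> f _; apply: bm_prod => v _; apply: bmZ; exact: bmM.
rewrite (eq_bigr _ (fun f _ => term f)).
(* The sum over choices of exponents folds back into a product over [v]. In each factor the linear
   term vanishes by centering and the quadratic one is at most [2 lam^2 * 4 * 4]. *)
rewrite -(bigA_distr_bigA (fun v (c : 'I_3) => cf c *
  (mean P (fun w => G (false, v) w ^+ c) * mean P (fun w => G (true, v) w ^+ c)))).
have -> : 32 * lam ^+ 2 * N%:R = \sum_(v < N) 32 * lam ^+ 2.
  by rewrite sumr_const card_ord mulr_natr.
rewrite expR_sum; apply: ler_prod => v _.
rewrite !big_ord_recl big_ord0 /cf /= addr0.
have E1 p : mean P (fun w => G p w ^+ 1) = 0.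
  by rewrite -(G_mean0 p); apply: eq_mean => w; rewrite expr1.
have E0 p : mean P (fun w => G p w ^+ 0) = 1.
  by rewrite -(mean_cst P 1); apply: eq_mean => w; rewrite expr0.
rewrite /bump/= !E0 !E1 mulr1 mulr0 mulr0 add0r mulr1.
set m1 := mean _ _; set m2 := mean _ _.
have m10 : 0 <= m1 by apply: mean_ge0 => w; exact: sqr_ge0.
have m20 : 0 <= m2 by apply: mean_ge0 => w; exact: sqr_ge0.
have m14 : m1 <= 4 by exact: G_sqr.
have m24 : m2 <= 4 by exact: G_sqr.
have m12 : m1 * m2 <= 16.
  by rewrite (_ : 16 = 4 * 4); [rewrite ler_pM|ring].
have l20 := sqr_ge0 lam.
apply/andP; split; first by apply: addr_ge0 => //; apply: mulr_ge0; exact: mulr_ge0.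
apply: le_trans (expR_ge1Dx _); rewrite lerD2l.
have := ler_wpM2l l20 m12; lra.
Qed.

End pair_mgf.

Section unions.
Context {R : realType} {d : measure_display} {T : measurableType d}.
Variable P : probability T R.
Context {r N : nat}.
Variable X : cube r N -> T -> R.
Hypothesis mX : forall i, measurable_fun [set: T] (X i).
Hypothesis facX : factorizes P X.

Lemma upd_inj (i : cube r N) k : injective (upd i k).
Proof. by move=> v v' /(congr1 (fun j : cube r N => j k)); rewrite !upd_k. Qed.

(** The parameter [(2 * bt)^-1] keeps each exponent in [[0, 1/2]], where [expR u <= 1 + 2u]; a bound
    on the first moment of [g] is then enough. *)
Lemma fiber_mgf (g : cube r N -> R -> R) (bt : R) (k : 'I_r) (i : cube r N) :
  0 < bt -> (forall j, bounded_measurable (g j)) ->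
  (forall j t, 0 <= g j t <= bt) ->
  (forall j, mean P (fun w => g j (X j w)) <= 4) ->
  mean P (fun w => expR ((2 * bt)^-1 *
    \sum_v g (upd i k v) (X (upd i k v) w))) <= expR ((2 * bt)^-1 * (8 * N%:R)).
Proof.
move=> bt0 bg gb gm; set lam := (2 * bt)^-1.
have lam0 : 0 < lam by rewrite invr_gt0 mulr_gt0.
rewrite (eq_mean _ (g := fun w =>
  expR (\sum_v (lam * g (upd i k v) (X (upd i k v) w))))); last first.
  by move=> w; rewrite mulr_sumr.
have -> : lam * (8 * N%:R) = \sum_(v < N) lam * 8.
  by rewrite sumr_const card_ord -[RHS]mulr_natr mulrA.
apply: (mgf_sum (factorizes_comp mX (@upd_inj i k) facX)
  (f := fun v t => lam * g (upd i k v) t)) => v; first exact: bmZ.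
set j := upd i k v.
have bgX : bounded_measurable (fun w => g j (X j w)) by exact: bm_comp.
apply: (@le_trans _ _ (mean P (fun w => 1 + 2 * lam * g j (X j w)))).
  apply: le_mean => [||w]; first by apply: bm_expR; exact: bmZ.
    by apply: bmD; [exact: bm_cst|exact: bmZ].
  rewrite -mulrA; apply: expR_le_double.
  have /andP[g0 g1] := gb j (X j w).
  rewrite mulr_ge0 ?(ltW lam0)//= /lam.
  rewrite mulrC ler_pdivrMr ?mulr_gt0//; lra.
rewrite meanD ?mean_cst ?meanZ//; [|exact: bm_cst|exact: bmZ].
apply: le_trans (expR_ge1Dx _); rewrite lerD2l.
by have := ler_wpM2l (ltW lam0) (gm j); rewrite -/lam; lra.
Qed.

Hypothesis tmean : forall i c, 0 < c ->
  `|mean P (fun w => trunc c (X i w))| <= c^-1.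
Hypothesis tsq : forall i c, 0 < c ->
  mean P (fun w => trunc c (X i w) ^+ 2) <= 1.
Variables (A : R).
Hypothesis (A1 : 1 <= A).

Let z := centered_rv P X A.

Lemma sparse_mgf (u : 'I_r -> 'I_N -> R) (lam : R) : in_ball u -> 0 <= lam ->
  mean P (fun w => expR (lam * form (fun i => z i w) u)) <=
  expR (8 * lam ^+ 2 * A ^+ 2 * 4 ^+ r).
Proof.
move=> uB lam0.
rewrite (eq_mean _ (g := fun w => expR (\sum_i (lam * wt u i) * z i w))); last first.
  by move=> w; rewrite /form mulr_sumr; congr expR; apply: eq_bigr => i _; ring.
apply: (@le_trans _ _ (expR (\sum_i 8 * lam ^+ 2 * A ^+ 2 * wt u i ^+ 2))); last first.
  rewrite ler_expR -mulr_sumr ler_wpM2l ?sum_wt_sqr_le//.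
  by apply: mulr_ge0; rewrite ?sqr_ge0//; apply: mulr_ge0; rewrite ?sqr_ge0.
apply: (mgf_sum facX (f := fun i t => (lam * wt u i) * centered A (trunc_mean P X A) i t)).
  by move=> i; apply: bmZ; exact: bm_centered.
move=> i; have bz : bounded_measurable (z i) by exact: bm_centered_rv.
have -> : 8 * lam ^+ 2 * A ^+ 2 * wt u i ^+ 2 =
    2 * (lam * `|wt u i| * (2 * A)) ^+ 2.
  by rewrite !exprMn real_normK ?num_real//; ring.
apply: mean_expR_le_square; first exact: bmZ.
- move=> w; rewrite !normrM (ger0_norm lam0) ler_wpM2l ?mulr_ge0//.
  exact: centered_rv_norm_le.
- by rewrite meanZ// [mean _ _](mean_centered_rv P mX) mulr0.
Qed.

Lemma off_mgf (k : 'I_r) (i i' : cube r N) (lam : R) :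
  i k = i' k -> i != i' -> `|lam| * (4 * A ^+ 2) <= 2^-1 ->
  mean P (fun w => expR (lam * \sum_v z (upd i k v) w * z (upd i' k v) w)) <=
  expR (32 * lam ^+ 2 * N%:R).
Proof.
move=> ik ne small.
(* Distinct base points with equal [k]-th coordinate lie on disjoint parallel lines, so the [2 N]
   entries involved are independent. *)
pose e (p : bool * 'I_N) := upd (if p.1 then i' else i) k p.2.
have e_inj : injective e.
  move=> [b v] [b' v'] E.
  have vv : v = v' by have := congr1 (fun j : cube r N => j k) E; rewrite /e !upd_k.
  rewrite -vv; congr (_, _); apply/eqP/negPn/negP => bb.
  move/negP: ne; apply; apply/eqP/ffunP => l.
  have [->//|lk] := eqVneq l k.
  have := congr1 (fun j : cube r N => j l) E; rewrite /e !upd_other//=.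
  by case: b {E} bb; case: b'.
apply: (@pair_mgf _ _ _ P N (fun p => X (e p)) _ _
  (fun p => centered A (trunc_mean P X A) (e p))).
- by move=> p; exact: mX.
- exact: factorizes_comp.
- by move=> p; exact: bm_centered.
- by move=> p; exact: mean_centered_rv.
- by move=> p; exact: mean_centered_rv_sqr.
- move=> v w; rewrite (le_trans (ler_norm _))// normrM (le_trans _ small)//.
  rewrite ler_wpM2l// normrM.
  have -> : 4 * A ^+ 2 = (2 * A) * (2 * A) by ring.
  by apply: ler_pM => //; exact: centered_rv_norm_le.
Qed.

End unions.

(** * The exceptional event *)

Section counting_mgf.
Context {R : realType} {d : measure_display} {T : measurableType d}.
Variable P : probability T R.
Context {I : finType}.
Variable X : I -> T -> R.
Hypothesis mX : forall i, measurable_fun [set: T] (X i).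
Hypothesis facX : factorizes P X.

(** Factor of a Chernoff bound in base [q]: the product of jumps is [q] to the number of large
    entries. *)
Definition jump (q t : R) (b : bool) (x : R) : R :=
  if b && (t < `|x|) then q else 1.

Lemma bm_jump (q t : R) (b : bool) : bounded_measurable (jump q t b).
Proof.
rewrite /jump; case: b => /=; last exact: bm_cst.
by apply: bm_if; [exact: measurable_fun_ltr|exact: bm_cst|exact: bm_cst].
Qed.

Lemma prod_jump (q t : R) (Q : pred I) (x : I -> R) :
  \prod_i jump q t (Q i) (x i) = q ^+ #|[pred i | Q i && (t < `|x i|)]|.
Proof. by rewrite -prodr_const [RHS]big_mkcond. Qed.

Lemma bm_prod_jump (q t : R) (Q : pred I) :
  bounded_measurable (fun w => \prod_i jump q t (Q i) (X i w)).
Proof. by apply: bm_prod => i _; exact: bm_comp (bm_jump _ _ _) (mX i). Qed.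

Lemma mean_prod_jump (q t p : R) (Q : pred I) : 1 <= q ->
  (forall i, mean P (fun w => if t < `|X i w| then 1 else 0) <= p) ->
  mean P (fun w => \prod_i jump q t (Q i) (X i w)) <= expR (q * p * #|Q|%:R).
Proof.
move=> q1 tail; rewrite (facX (f := fun i => jump q t (Q i))); last first.
  by move=> i; exact: bm_jump.
have -> : q * p * #|Q|%:R = \sum_i (if Q i then q * p else 0).
  by rewrite -big_mkcond/= sumr_const mulr_natr.
rewrite expR_sum; apply: ler_prod => i _; apply/andP; split.
  apply: mean_ge0 => w; rewrite /jump; case: ifP => // _.
  exact: le_trans q1.
case: (Q i); last by rewrite /jump/= mean_cst expR0.
have bi : bounded_measurable (fun w => if t < `|X i w| then 1 else 0 : R).
  exact: (bm_comp (bm_gt t) (mX i)).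
rewrite (eq_mean _ (g := fun w => 1 + (q - 1) * (if t < `|X i w| then 1 else 0)));
  last by move=> w; rewrite /jump/=; case: ifP => _; ring.
rewrite meanD ?mean_cst ?meanZ//; [|exact: bm_cst|exact: bmZ].
apply: le_trans (expR_ge1Dx _); rewrite lerD2l.
set m := mean _ _.
have m0 : 0 <= m by apply: mean_ge0 => w; case: ifP.
have mp : m <= p := tail i.
nra.
Qed.

End counting_mgf.

Lemma expR1_le4 (R : realType) : expR 1 <= 4 :> R.
Proof.
have h : expR (2^-1 : R) <= 2.
  have := @expR_le_quadratic R 2^-1 (lexx _); lra.
have -> : 1 = 2^-1 + 2^-1 :> R by lra.
rewrite expRD; have := expR_ge0 (2^-1 : R); nra.
Qed.

Lemma sum_set_expr (R : realType) (I : finType) (c : R) :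
  \sum_(B : {set I}) c ^+ #|B| = (1 + c) ^+ #|I|.
Proof.
rewrite -prodr_const addrC (@bigA_distr R 0 1 *%R +%R I (fun=> c) (fun=> 1)).
apply: eq_bigr => B _.
by rewrite -big_mkcond/= prodr_const.
Qed.

Lemma expr1VD_le4 (R : realType) (N : nat) : (0 < N)%N ->
  (1 + N%:R^-1) ^+ N <= 4 :> R.
Proof.
move=> N0; apply: le_trans (expR1_le4 R).
have -> : expR 1 = expR (N%:R^-1) ^+ N :> R.
  by rewrite -expRM_natl mulfV// pnatr_eq0 -lt0n.
rewrite lerXn2r ?nnegrE ?expR_ge0 ?addr_ge0 ?invr_ge0//.
exact: expR_ge1Dx.
Qed.

Lemma exp_jump_balance (R : realType) (q : R) (e m : nat) : 0 < q ->
  expR (- (e + m)%:R) * (expR 1 / q) ^+ m * q ^+ (e + m) = (q / expR 1) ^+ e.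
Proof.
move=> q0; rewrite expRN -[(e + m)%:R]mulr1 expRM_natl !exprD !expr_div_n.
by field; rewrite !expf_neq0 ?gt_eqF ?expR_gt0.
Qed.

Section bad_event.
Context {R : realType} {r N : nat}.
Variables (q K : R) (a h L : nat).

(** The factor 2 serves [(expR 1 / q)^2 <= 1/q], valid for [q >= 16]. In each of the [r] directions,
    [4h + 1] then pays for [q^-(2h) = 1/N] per element of the side, to sum over all subsets, and for
    one more [q^-(2h+1)]. *)
Definition peel_const : nat := 2 * r * (4 * h + 1).
(** Gives [q^-(4hr) = N^(-2r)], which survives the union over the [r N^r] pairs of a direction and a
    point. *)
Definition fiber_const : nat := 4 * h * r.

Definition in_box (B : {ffun 'I_r -> {set 'I_N}}) (i : cube r N) : bool :=
  [forall k, i k \in B k].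

Definition nonempty_box (B : {ffun 'I_r -> {set 'I_N}}) : bool :=
  [forall k, (0 < #|B k|)%N].

Definition max_side (B : {ffun 'I_r -> {set 'I_N}}) : nat := \max_k #|B k|.

(** Markov majorant of the event that the box holds more than [mu = q * density * prod |B k|] and at
    least [m = peel_const * max_side] large entries. The product of jumps has mean at most
    [expR mu], cancelled by the first factor; the second, [(expR 1 / q)^m], is the probability that
    remains. On the event the whole is at least 1 by [exp_jump_balance]. *)
Definition bad_box (x : cube r N -> R) (l : nat)
    (B : {ffun 'I_r -> {set 'I_N}}) : R :=
  expR (- (q * @density R r q K a l * \prod_k #|B k|%:R)) *
  (expR 1 / q) ^+ (peel_const * max_side B) *
  \prod_i jump q (q ^+ (a + l)) (in_box B i) (x i).

Definition bad_fiber (x : cube r N -> R) (p : 'I_r * cube r N) : R :=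
  q ^- fiber_const *
  \prod_(v < N) jump q (q ^+ h.-1) true (x (upd p.2 p.1 v)).

(** Stand-in for the exceptional event, which is [1 <= bad]. Its mean is [O(N^-r)], so [N^r * bad]
    has bounded mean and can pay for a bound of size [N^r] there. *)
Definition bad (x : cube r N -> R) : R :=
  (\sum_(l < L) \sum_(B : {ffun 'I_r -> {set 'I_N}} | nonempty_box B) bad_box x l B +
  \sum_p bad_fiber x p) +
  \sum_i (if q ^+ (a + L) < `|x i| then 1 else 0).

Hypotheses (q16 : 16 <= q) (K0 : 0 <= K).

Let q0 : 0 < q. Proof. exact: lt_le_trans q16. Qed.
Let q1 : 1 <= q. Proof. by apply: le_trans q16; rewrite ler1n. Qed.

Let jump_ge0 t b y : 0 <= jump q t b y.
Proof. by rewrite /jump; case: ifP => _//; exact: ltW. Qed.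

Lemma bad_box_ge0 x l B : 0 <= bad_box x l B.
Proof.
rewrite !mulr_ge0 ?expR_ge0 ?exprn_ge0 ?divr_ge0 ?expR_ge0 ?(ltW q0)//.
exact: prodr_ge0.
Qed.

Lemma bad_fiber_ge0 x p : 0 <= bad_fiber x p.
Proof. by rewrite mulr_ge0 ?invr_ge0 ?exprn_ge0 ?(ltW q0)//; exact: prodr_ge0. Qed.

Lemma bad_ge0 x : 0 <= bad x.
Proof.
apply: addr_ge0; last by apply: sumr_ge0 => i _; case: ifP.
apply: addr_ge0; last by apply: sumr_ge0 => p _; exact: bad_fiber_ge0.
by apply: sumr_ge0 => l _; apply: sumr_ge0 => B _; exact: bad_box_ge0.
Qed.

Lemma bad_lt1_max x i : bad x < 1 -> `|x i| <= q ^+ (a + L).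
Proof.
move=> bx; rewrite leNgt; apply/negP => xi; move: bx; rewrite ltNge => /negP; apply.
rewrite /bad (bigD1 i)//= xi addrCA lerDl addr_ge0//.
  apply: addr_ge0; last by apply: sumr_ge0 => p _; exact: bad_fiber_ge0.
  by apply: sumr_ge0 => l _; apply: sumr_ge0 => B _; exact: bad_box_ge0.
by apply: sumr_ge0 => j _; case: ifP.
Qed.

Lemma bad_lt1_fiber x k i : bad x < 1 ->
  (#|[pred v | (q ^+ h.-1 < `|x (upd i k v)|)%R]| <= fiber_const)%N.
Proof.
move=> bx; rewrite leqNgt; apply/negP => cnt.
move: bx; rewrite ltNge => /negP; apply.
have : 1 <= bad_fiber x (k, i).
  rewrite /bad_fiber (prod_jump _ _ xpredT (fun v => x (upd i k v))).
  rewrite mulrC ler_pdivlMr ?exprn_gt0// mul1r ler_weXn2l//.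
  by rewrite ltnW// (leq_trans cnt)// subset_leq_card.
move=> /le_trans; apply; rewrite /bad [X in _ + X + _](bigD1 (k, i))//=.
rewrite -!addrA addrCA lerDl !addr_ge0//.
- by apply: sumr_ge0 => l _; apply: sumr_ge0 => B _; exact: bad_box_ge0.
- by apply: sumr_ge0 => p _; exact: bad_fiber_ge0.
- by apply: sumr_ge0 => j _; case: ifP.
Qed.

Lemma bad_lt1_discrepancy x (l : 'I_L) (B : 'I_r -> {set 'I_N}) : (0 < r)%N ->
  bad x < 1 ->
  (big_count x (q ^+ (a + l)) B)%:R <=
    q * @density R r q K a l * \prod_k #|B k|%:R \/
  exists k, (big_count x (q ^+ (a + l)) B <= peel_const * #|B k|)%N.
Proof.
move=> r0 bx; set c := big_count _ _ _; set mu := q * _ * _.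
have [cm|cm] := leP c%:R mu; first by left.
have [/existsP|/existsPn cB] :=
  boolP [exists k, (c <= peel_const * #|B k|)%N]; first by right.
exfalso; move: bx; rewrite ltNge => /negP; apply.
pose B' : {ffun 'I_r -> {set 'I_N}} := [ffun k => B k].
have cE : c = #|[pred i | in_box B' i && (q ^+ (a + l) < `|x i|)]|.
  apply: eq_card => i; rewrite !inE /= andbC; congr (_ && _).
  by apply: eq_forallb => k; rewrite ffunE.
have ne : nonempty_box B'.
  have : (0 < c)%N by rewrite (leq_trans _ (_ : (peel_const * #|B (Ordinal r0)| < c)%N))// ltnNge cB.
  rewrite cE => /card_gt0P[i]; rewrite inE => /andP[/forallP iB _].
  by apply/forallP => k; apply/card_gt0P; exists (i k); exact: iB.
have cmax : (peel_const * max_side B' <= c)%N.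
  rewrite /max_side; have [|k0 ->] := @bigop.eq_bigmax _ (fun k => #|B' k|); first by rewrite card_ord.
  by rewrite ffunE ltnW// ltnNge cB.
have : 1 <= bad_box x l B'.
  rewrite /bad_box prod_jump -cE.
  have -> : q * @density R r q K a l * \prod_k #|B' k|%:R = mu.
    by rewrite /mu; congr (_ * _); apply: eq_bigr => k _; rewrite ffunE.
  apply: (@le_trans _ _ (expR (- c%:R) * (expR 1 / q) ^+ (peel_const * max_side B')
      * q ^+ c)).
    rewrite -(subnK cmax) exp_jump_balance// exprn_ege1//.
    rewrite ler_pdivlMr ?expR_gt0// mul1r.
    by apply: le_trans (expR1_le4 R) _; apply: le_trans q16; rewrite ler_nat.
  rewrite ler_wpM2r ?exprn_ge0 ?(ltW q0)// ler_wpM2r//.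
    by rewrite exprn_ge0// divr_ge0 ?expR_ge0// ltW.
  by rewrite ler_expR lerN2 ltW.
move=> /le_trans; apply; rewrite /bad (bigD1 l)//= (bigD1 B')//= -!addrA lerDl.
rewrite !addr_ge0//.
- by apply: sumr_ge0 => B0 _; exact: bad_box_ge0.
- by apply: sumr_ge0 => l0 _; apply: sumr_ge0 => B0 _; exact: bad_box_ge0.
- by apply: sumr_ge0 => p _; exact: bad_fiber_ge0.
- by apply: sumr_ge0 => j _; case: ifP.
Qed.

End bad_event.

Lemma card_in_box (R : realType) (r N : nat) (B : {ffun 'I_r -> {set 'I_N}}) :
  #|in_box B|%:R = \prod_k #|B k|%:R :> R.
Proof.
rewrite (eq_card (_ : in_box B =i family (fun k => mem (B k)))).
  by rewrite card_family foldrE big_map big_enum natr_prod.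
by move=> i; rewrite !inE.
Qed.

Lemma box_decay (R : realType) (q : R) (h r N : nat)
    (B : {ffun 'I_r -> {set 'I_N}}) :
  16 <= q -> nonempty_box B ->
  (expR 1 / q) ^+ (@peel_const r h * max_side B) <=
  \prod_k (q ^- (2 * h + 1) * (q ^- (2 * h)) ^+ #|B k|).
Proof.
move=> q16 /forallP Bne.
have q0 : 0 < q by exact: lt_le_trans q16.
have q1 : 1 <= q by apply: le_trans q16; rewrite ler1n.
rewrite /peel_const -!mulnA exprM.
have e2 : (expR 1 / q) ^+ 2 <= q^-1.
  have e0 := expR_ge0 (1 : R); have e4 := expR1_le4 R.
  rewrite expr_div_n ler_pdivrMr ?exprn_gt0// expr2 mulKf ?gt_eqF//.
  by nra.
apply: (@le_trans _ _ (q^-1 ^+ (r * ((4 * h + 1) * max_side B)))).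
  rewrite lerXn2r ?nnegrE ?sqr_ge0 ?invr_ge0 ?(ltW q0)//.
have -> : q^-1 ^+ (r * ((4 * h + 1) * max_side B)) =
    \prod_(k < r) q^-1 ^+ ((4 * h + 1) * max_side B).
  by rewrite prodr_const card_ord -exprM mulnC.
apply: ler_prod => k _; rewrite exprn_ge0 ?invr_ge0 ?(ltW q0)//=.
rewrite -!exprVn -exprM -exprD ler_wiXn2l ?invr_ge0 ?(ltW q0) ?invf_le1//.
have := Bne k.
have : (#|B k| <= max_side B)%N by rewrite /max_side; exact: leq_bigmax.
by move: #|B k| (max_side B) => b m; clear; nia.
Qed.

(** In each direction the subsets contribute [(1 + 1/N)^N <= 4 <= q], and [q^-(2h+1) = 1/(q N)]
    leaves [1/N]. *)
Lemma sum_box_decay (R : realType) (q : R) (h r N : nat) :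
  16 <= q -> (0 < N)%N -> q ^+ (2 * h) = N%:R ->
  \sum_(B : {ffun 'I_r -> {set 'I_N}})
    \prod_k (q ^- (2 * h + 1) * (q ^- (2 * h)) ^+ #|B k|) <= N%:R ^- r.
Proof.
move=> q16 N0 qN.
have q0 : 0 < q by exact: lt_le_trans q16.
rewrite -(bigA_distr_bigA (fun (_ : 'I_r) (B : {set 'I_N}) =>
  q ^- (2 * h + 1) * (q ^- (2 * h)) ^+ #|B|)).
rewrite prodr_const card_ord -exprVn.
have s0 : 0 <= \sum_(B : {set 'I_N}) (N%:R^-1 : R) ^+ #|B|.
  by apply: sumr_ge0 => B _; rewrite exprn_ge0// invr_ge0.
rewrite lerXn2r ?nnegrE ?invr_ge0//; rewrite -mulr_sumr qN.
  by rewrite mulr_ge0// invr_ge0 exprn_ge0// ltW.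
rewrite sum_set_expr card_ord exprD expr1 qN invfM -mulrA ler_piMr ?invr_ge0//.
rewrite mulrC ler_pdivrMr// mul1r (le_trans (expr1VD_le4 R N0))//.
by apply: le_trans q16; rewrite ler_nat.
Qed.

Section bad_mean.
Context {R : realType} {d : measure_display} {T : measurableType d}.
Variable P : probability T R.
Context {r N : nat}.
Variable X : cube r N -> T -> R.
Hypothesis mX : forall i, measurable_fun [set: T] (X i).
Hypothesis facX : factorizes P X.
Variables (q K : R) (a h : nat).
Hypotheses (q16 : 16 <= q) (K0 : 0 <= K) (N0 : (0 < N)%N) (h0 : (0 < h)%N).
Hypothesis qN : q ^+ (2 * h) = N%:R.
Hypothesis tail_level : forall i l,
  mean P (fun w => if q ^+ (a + l) < `|X i w| then 1 else 0) <= @density R r q K a l.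
Hypothesis tail_fiber : forall i,
  mean P (fun w => if q ^+ h.-1 < `|X i w| then 1 else 0) <= K / q ^+ (2 * h.-1 + 3).
Hypothesis tail_sqr : forall i t, 0 < t ->
  mean P (fun w => if t < `|X i w| then 1 else 0) <= t ^- 2.

(** Here [q^L = N^r]: above [q^(a+L)] the second moment bounds each tail by [N^(-2r)], enough for a
    union over all [N^r] entries. Hence [L] levels suffice. *)
Let L := (2 * h * r)%N.
Let q0 : 0 < q. Proof. exact: lt_le_trans q16. Qed.
Let q1 : 1 <= q. Proof. by apply: le_trans q16; rewrite ler1n. Qed.

Let bm_box l B :
  bounded_measurable (fun w => bad_box q K a h (fun i => X i w) l B).
Proof. by apply: bmZ; exact: bm_prod_jump. Qed.

Let bm_fiber p :
  bounded_measurable (fun w => bad_fiber q h (fun i => X i w) p).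
Proof. by apply: bmZ; apply: (bm_prod_jump (X := fun v => X (upd p.2 p.1 v))). Qed.

Let bm_max i :
  bounded_measurable (fun w => if q ^+ (a + L) < `|X i w| then 1 else 0 : R).
Proof. exact: (bm_comp (bm_gt _) (mX i)). Qed.

Lemma bm_bad : bounded_measurable (fun w => bad q K a h L (fun i => X i w)).
Proof.
apply: bmD; last by apply: bm_sum => i _; exact: bm_max.
apply: bmD; last by apply: bm_sum => p _; exact: bm_fiber.
by apply: bm_sum => l _; apply: bm_sum => B _; exact: bm_box.
Qed.

Lemma mean_bad :
  mean P (fun w => bad q K a h L (fun i => X i w)) <=
  (L%:R + r%:R * expR K + 1) * N%:R ^- r.
Proof.
have NL : q ^+ L = N%:R ^+ r by rewrite /L exprM qN.
have Nr0 : 0 < N%:R ^+ r :> R by rewrite exprn_gt0// ltr0n.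
have card_cube : #|cube r N|%:R = N%:R ^+ r :> R.
  by rewrite card_ffun !card_ord natrX.
have boxes : mean P (fun w => \sum_(l < L)
    \sum_(B : {ffun 'I_r -> {set 'I_N}} | nonempty_box B)
      bad_box q K a h (fun i => X i w) l B) <= L%:R * N%:R ^- r.
  rewrite mean_sum; last by move=> l _; apply: bm_sum => B _; exact: bm_box.
  have -> : L%:R * N%:R ^- r = \sum_(l < L) N%:R ^- r :> R.
    by rewrite sumr_const card_ord mulr_natl.
  apply: ler_sum => l _.
  rewrite mean_sum; last by move=> B _; exact: bm_box.
  apply: le_trans (sum_box_decay r q16 N0 qN).
  rewrite [leRHS](bigID (@nonempty_box r N))/= -[leLHS]addr0; apply: lerD; last first.
    apply: sumr_ge0 => B _; apply: prodr_ge0 => k _.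
    by rewrite mulr_ge0 ?exprn_ge0 ?invr_ge0 ?exprn_ge0 ?(ltW q0).
  apply: ler_sum => B Bne; apply: le_trans (box_decay h q16 Bne).
  rewrite meanZ; last exact: bm_prod_jump.
  have e0 : 0 <= (expR 1 / q) ^+ (@peel_const r h * max_side B).
    by rewrite exprn_ge0// divr_ge0 ?expR_ge0// ltW.
  have := mean_prod_jump mX facX (in_box B) q1 (fun i => tail_level i l).
  rewrite card_in_box => hm.
  rewrite mulrAC expRN -[leRHS]mul1r ler_wpM2r//.
  by rewrite mulrC ler_pdivrMr ?expR_gt0// mul1r.
have fibers : mean P (fun w => \sum_p bad_fiber q h (fun i => X i w) p) <=
    r%:R * expR K * N%:R ^- r.
  rewrite mean_sum; last by move=> p _; exact: bm_fiber.
  apply: (@le_trans _ _ (\sum_(p : 'I_r * cube r N) expR K * q ^- (2 * L))).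
    apply: ler_sum => p _; rewrite meanZ; last first.
      exact: (bm_prod_jump (X := fun v => X (upd p.2 p.1 v))).
    have -> : @fiber_const r h = (2 * L)%N by rewrite /fiber_const /L; lia.
    rewrite mulrC ler_wpM2r ?invr_ge0 ?exprn_ge0 ?(ltW q0)//.
    have := @mean_prod_jump _ _ _ P _ (fun v => X (upd p.2 p.1 v))
      (fun v => mX _) (factorizes_comp mX (@upd_inj r N p.2 p.1) facX)
      q (q ^+ h.-1) _ xpredT q1 (fun v => tail_fiber _).
    move=> /le_trans; apply; rewrite ler_expR card_ord.
    (* The tail exponent is [2(h-1) + 3 = 2h + 1], so that [q * (K / q^(2h+1)) * N = K]. *)
    have -> : N%:R = q ^+ (2 * h.-1 + 2) :> R.
      by rewrite -qN; congr (_ ^+ _); case: (h) h0 => //= m _; rewrite mulnS addnC.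
    rewrite (exprD _ _ 3) (exprD _ _ 2) le_eqVlt; apply/orP; left; apply/eqP.
    by field; rewrite expf_neq0 gt_eqF.
  rewrite sumr_const card_prod card_ord -[leLHS]mulr_natl natrM card_cube.
  rewrite mulnC exprM NL le_eqVlt; apply/orP; left; apply/eqP.
  by field; rewrite expf_neq0// gt_eqF// ltr0n.
have maxes : mean P (fun w => \sum_i (if q ^+ (a + L) < `|X i w| then 1 else 0)) <=
    N%:R ^- r.
  rewrite mean_sum; last by move=> i _; exact: bm_max.
  apply: (@le_trans _ _ (\sum_(i : cube r N) (q ^+ (a + L)) ^- 2)).
    by apply: ler_sum => i _; apply: tail_sqr; rewrite exprn_gt0.
  rewrite sumr_const -[leLHS]mulr_natl card_cube ler_pdivrMr ?exprn_gt0//.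
  rewrite -[leLHS]mul1r [leRHS]mulrC ler_pdivlMr// mul1r -expr2 -NL.
  by rewrite lerXn2r ?nnegrE ?exprn_ge0 ?(ltW q0)// ler_weXn2l// leq_addl.
rewrite /bad meanD; [|apply: bmD|by apply: bm_sum => i _; exact: bm_max].
- rewrite meanD; last 2 first.
  + by apply: bm_sum => l _; apply: bm_sum => B _; exact: bm_box.
  + by apply: bm_sum => p _; exact: bm_fiber.
  by rewrite !mulrDl mul1r; apply: lerD => //; exact: lerD.
- by apply: bm_sum => l _; apply: bm_sum => B _; exact: bm_box.
- by apply: bm_sum => p _; exact: bm_fiber.
Qed.

End bad_mean.

(** * Expectation of the partial suprema *)

Lemma scale_split (R : realType) (q : R) (a r : nat) :
  q ^+ (4 * a.+1 * r).+1 = (q ^+ a.+1) ^+ (4 * r) * q.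
Proof. by rewrite exprSr -exprM; congr (q ^+ _ * q); lia. Qed.

(** The bound [q <= expR q] takes the place of the logarithm of [q]: every use has a power of [q] to
    spare. *)
Lemma cube_count_le (R : realType) (q : R) (h r N : nat) : 0 <= q ->
  q ^+ (2 * h) = N%:R ->
  (r * N ^ r)%:R <= expR (r%:R + 2 * h%:R * r%:R * q) :> R.
Proof.
move=> q0 qN; rewrite natrM natrX -qN -exprM expRD.
apply: ler_pM; rewrite ?exprn_ge0//; first exact: le_expR_id.
by apply: le_trans (exprn_le_expR _ q0) _; rewrite ler_expR !natrM.
Qed.

Section unions.
Context {R : realType} {d : measure_display} {T : measurableType d}.
Variable P : probability T R.
Context {r N : nat}.
Variable X : cube r N -> T -> R.
Hypothesis mX : forall i, measurable_fun [set: T] (X i).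
Hypothesis facX : factorizes P X.
Hypothesis tmean : forall i c, 0 < c ->
  `|mean P (fun w => trunc c (X i w))| <= c^-1.
Hypothesis tsq : forall i c, 0 < c ->
  mean P (fun w => trunc c (X i w) ^+ 2) <= 1.
Variables (q : R) (a h : nat).
Hypotheses (q16 : 16 <= q) (q2r : 2 ^+ r <= q) (r0 : (0 < r)%N).
Hypothesis hE : h = (4 * a.+1 * r).+1.
Hypothesis qN : q ^+ (2 * h) = N%:R.

Definition scale : R := q ^+ h.
Definition cutoff : R := q ^+ a.
(** Vectors cut at this level have l1 norm at most [4 / large_thr], and
    [(4 / large_thr)^(2r) q = 16^r * scale] by the choice of [h]. Off-diagonal Gram entries of order
    [scale * q] thus cost [O(scale^2)]. *)
Definition large_thr : R := (q ^+ a.+1) ^- 2.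
(** Chosen so that [2^r * small_thr * large_thr * scale * cutoff = 2^r / q <= 1]. It exceeds
    [cutoff / scale] by the factor [q], which makes the entropy of sparse vectors affordable. *)
Definition small_thr : R := q ^+ a.+1 / scale.

Let q0 : 0 < q. Proof. exact: lt_le_trans q16. Qed.
Let q1 : 1 <= q. Proof. by apply: le_trans q16; rewrite ler1n. Qed.

Lemma scale_gt0 : 0 < scale. Proof. by rewrite exprn_gt0. Qed.
Lemma cutoff_ge1 : 1 <= cutoff. Proof. by rewrite exprn_ege1. Qed.
Lemma scale_sqr : scale ^+ 2 = N%:R. Proof. by rewrite -exprM mulnC. Qed.
Lemma large_thr_gt0 : 0 < large_thr. Proof. by rewrite invr_gt0 !exprn_gt0. Qed.
Lemma small_thr_gt0 : 0 < small_thr. Proof. by rewrite divr_gt0 ?scale_gt0// exprn_gt0. Qed.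

Let B := q ^+ a.+1.
Let B0 : 0 < B. Proof. by rewrite exprn_gt0. Qed.
Let B_lev : B = q * cutoff. Proof. by rewrite /B exprS. Qed.
Let q_leB : q <= B. Proof. by rewrite /B exprS ler_peMr ?cutoff_ge1 ?(ltW q0). Qed.

Lemma scaleE : scale = B ^+ (4 * r) * q.
Proof. by rewrite /scale hE scale_split. Qed.

Lemma pow4_le_scale : B ^+ 4 * q <= scale.
Proof.
rewrite scaleE ler_wpM2r ?(ltW q0)// ler_weXn2l//; first exact: le_trans q_leB.
by rewrite -{1}[4%N]muln1 leq_mul.
Qed.

Lemma scale_ge1 : 1 <= scale. Proof. by rewrite exprn_ege1. Qed.

Lemma small_le_large : small_thr <= large_thr.
Proof.
rewrite /small_thr /large_thr ler_pdivrMr ?scale_gt0// mulrC ler_pdivlMr ?exprn_gt0//.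
apply: le_trans pow4_le_scale; rewrite -/B.
have B1 : 1 <= B := le_trans q1 q_leB.
have -> : B * B ^+ 2 = B ^+ 3 by ring.
rewrite -[leLHS]mulr1; apply: ler_pM => //; first by rewrite exprn_ge0// ltW.
exact: ler_weXn2l.
Qed.

Lemma small_light : 2 ^+ r * (small_thr * large_thr) * (scale * cutoff) <= 1.
Proof.
have -> : 2 ^+ r * (small_thr * large_thr) * (scale * cutoff) = 2 ^+ r / q.
  rewrite /small_thr /large_thr -/B B_lev; field.
  by rewrite !gt_eqF ?scale_gt0// (lt_le_trans ltr01 cutoff_ge1).
by rewrite ler_pdivrMr// mul1r.
Qed.

Lemma cutoff_sqr_le : cutoff ^+ 2 * q <= scale ^+ 2.
Proof.
have lev0 := lt_le_trans ltr01 cutoff_ge1.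
have h1 : cutoff <= B by rewrite B_lev ler_peMl ?(ltW lev0).
have h2 : cutoff ^+ 2 <= B ^+ 4.
  apply: (@le_trans _ _ (B ^+ 2)); first by rewrite lerXn2r ?nnegrE ?(ltW lev0) ?(ltW B0).
  by rewrite ler_weXn2l// (le_trans q1).
apply: (@le_trans _ _ scale).
  by apply: le_trans pow4_le_scale; rewrite ler_wpM2r ?(ltW q0).
by rewrite expr2 ler_peMl ?scale_ge1// ltW ?scale_gt0.
Qed.

Lemma cutoff_sqr_le_sqr : cutoff ^+ 2 <= scale ^+ 2.
Proof. by apply: le_trans cutoff_sqr_le; rewrite ler_peMr// sqr_ge0. Qed.

Lemma cutoff_sqr_small : 8 * cutoff ^+ 2 <= scale.
Proof.
have lev0 := lt_le_trans ltr01 cutoff_ge1.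
have h1 : cutoff <= B by rewrite B_lev ler_peMl ?(ltW lev0).
have h2 : cutoff ^+ 2 <= B ^+ 4.
  apply: (@le_trans _ _ (B ^+ 2)); first by rewrite lerXn2r ?nnegrE ?(ltW lev0) ?(ltW B0).
  by rewrite ler_weXn2l// (le_trans q1).
apply: le_trans pow4_le_scale; rewrite mulrC ler_pM// ?sqr_ge0//.
by apply: le_trans q16; rewrite ler_nat.
Qed.

Let z := centered_rv P X cutoff.
Let A0 : 0 < cutoff. Proof. exact: lt_le_trans ltr01 cutoff_ge1. Qed.

Definition light_form (y : lattice r N) (w : T) : R :=
  \sum_i light_fun scale cutoff small_thr large_thr (trunc_mean P X cutoff) (coord scale y) i (X i w).

Definition light_union : T -> R :=
  exp_union [pred y : lattice r N | in_ball (coord scale y)] light_form (scale / 8)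
    (4 ^+ r * N%:R + (6 * r * N)%:R).

Lemma bm_light_form y : in_ball (coord scale y) -> bounded_measurable (light_form y).
Proof.
move=> yB; apply: bm_sum => i _; apply: bm_comp (mX i).
apply: bm_light_fun => //; [exact: scale_gt0|exact: cutoff_ge1| | |].
- exact: ltW small_thr_gt0.
- exact: small_le_large.
- exact: small_light.
Qed.

Lemma bm_light_union : bounded_measurable light_union.
Proof. by apply: bm_exp_union => y; exact: bm_light_form. Qed.

Lemma mean_light_union :
  mean P light_union <= 8 * (4 ^+ r + 6 * r%:R + 1) * scale.
Proof.
have s8 : 0 < scale / 8 by rewrite divr_gt0// scale_gt0.
apply: (@le_trans _ _ ((scale / 8)^-1 * (4 ^+ r * N%:R + (6 * r * N)%:R + 1))).
  apply: mean_exp_union => //; last exact: ball_count scale_gt0 scale_sqr.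
  - by move=> y; exact: bm_light_form.
  - move=> y yB; apply: light_mgf => //; [exact: scale_gt0|exact: scale_sqr|exact: cutoff_ge1| | |].
    + exact: ltW small_thr_gt0.
    + exact: small_le_large.
    + exact: small_light.
rewrite ler_pdivrMl// !natrM -scale_sqr.
have s1 : 1 <= scale ^+ 2 by rewrite exprn_ege1// scale_ge1.
have -> : scale / 8 * (8 * (4 ^+ r + 6 * r%:R + 1) * scale) =
  (4 ^+ r + 6 * r%:R + 1) * scale ^+ 2 by field.
lra.
Qed.

(** With [lam = s / A^2] the Hoeffding exponent [8 lam^2 A^2 4^r] and the entropy, of order
    [h q s^2 / (q A)^2], are both [O(lam s)]. The factor [(4h + 2) q] bounds the logarithm of
    [4 N^2], as [sparse_count] requires. *)
Definition sparse_union : T -> R :=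
  exp_union [pred y : lattice r N | in_ball (coord scale y) && sparse scale small_thr y]
    (fun y w => form (fun i => z i w) (coord scale y)) (scale / cutoff ^+ 2)
    (8 * (scale / cutoff ^+ 2) ^+ 2 * cutoff ^+ 2 * 4 ^+ r +
     ((4 * h%:R + 2) * q * (4 * r%:R / small_thr ^+ 2) + r%:R)).

Lemma bm_z i : bounded_measurable (z i). Proof. exact: bm_centered_rv. Qed.

Lemma bm_form u : bounded_measurable (fun w => form (fun i => z i w) u).
Proof.
by apply: bm_sum => i _; apply: bmM; [exact: bm_z|exact: bm_cst].
Qed.

Lemma bm_sparse_union : bounded_measurable sparse_union.
Proof. by apply: bm_exp_union => y _; exact: bm_form. Qed.

Lemma mean_sparse_union :
  mean P sparse_union <= (8 * 4 ^+ r + 4 * r%:R * (4 * h%:R + 2) + r%:R + 1) * scale.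
Proof.
have lam0 : 0 < scale / cutoff ^+ 2 by rewrite divr_gt0 ?scale_gt0 ?exprn_gt0.
have h0 : (0 : R) <= 4 * h%:R + 2 by rewrite addr_ge0// mulr_ge0.
apply: (@le_trans _ _ ((scale / cutoff ^+ 2)^-1 *
    (8 * (scale / cutoff ^+ 2) ^+ 2 * cutoff ^+ 2 * 4 ^+ r +
     ((4 * h%:R + 2) * q * (4 * r%:R / small_thr ^+ 2) + r%:R) + 1))).
  apply: mean_exp_union => //.
  - by move=> y _; exact: bm_form.
  - move=> y /andP[yB _]; apply: sparse_mgf => //; [exact: cutoff_ge1|exact: ltW].
  - apply: (sparse_count scale_gt0 scale_sqr small_thr_gt0); first by rewrite mulr_ge0// ltW.
    rewrite expRN ler_pdivrMr ?expR_gt0// mul1r mulrDl expRD !natrM -qN -mulrA -exprD.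
    rewrite [leRHS]mulrC; apply: ler_pM; rewrite ?exprn_ge0 ?(ltW q0)//.
      apply: (@le_trans _ _ (1 + 2 * q)); last exact: expR_ge1Dx.
      by have := q16; lra.
    apply: le_trans (exprn_le_expR _ (ltW q0)) _; rewrite ler_expR ler_wpM2r ?(ltW q0)//.
    by rewrite -natrM ler_nat; lia.
rewrite /small_thr -/B B_lev.
have l2 := cutoff_sqr_le_sqr; have s0 := scale_gt0.
have -> : (scale / cutoff ^+ 2)^-1 * (8 * (scale / cutoff ^+ 2) ^+ 2 * cutoff ^+ 2 * 4 ^+ r +
    ((4 * h%:R + 2) * q * (4 * r%:R / (q * cutoff / scale) ^+ 2) + r%:R) + 1) =
    8 * 4 ^+ r * scale + (4 * r%:R * (4 * h%:R + 2)) * (scale / q) +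
    (r%:R + 1) * (cutoff ^+ 2 / scale).
  by field; rewrite !gt_eqF.
have k1 : scale / q <= scale by rewrite ler_pdivrMr// ler_peMr// ltW.
have k2 : cutoff ^+ 2 / scale <= scale by rewrite ler_pdivrMr// -expr2.
have k3 : 0 <= 4 * r%:R * (4 * h%:R + 2) :> R by rewrite !mulr_ge0.
have k4 : 0 <= r%:R + 1 :> R by rewrite addr_ge0.
have := ler_wpM2l k3 k1; have := ler_wpM2l k4 k2; lra.
Qed.

Definition log_cube_bound : R := r%:R + 2 * h%:R * r%:R * q.

Definition fiber_union (g : cube r N -> R -> R) (bt : R) : T -> R :=
  exp_union (fun _ : 'I_r * cube r N => true)
    (fun p w => \sum_v g (upd p.2 p.1 v) (X (upd p.2 p.1 v) w)) (2 * bt)^-1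
    ((2 * bt)^-1 * (8 * N%:R) + log_cube_bound).

Lemma log_cube_bound_ge0 : 0 <= log_cube_bound.
Proof. by rewrite addr_ge0// !mulr_ge0// ltW. Qed.

Lemma bm_fiber_sum (g : cube r N -> R -> R) (p : 'I_r * cube r N) :
  (forall j, bounded_measurable (g j)) ->
  bounded_measurable (fun w => \sum_v g (upd p.2 p.1 v) (X (upd p.2 p.1 v) w)).
Proof. by move=> bg; apply: bm_sum => v _; exact: bm_comp. Qed.

Lemma bm_fiber_union g bt : (forall j, bounded_measurable (g j)) ->
  bounded_measurable (fiber_union g bt).
Proof. by move=> bg; apply: bm_exp_union => p _; exact: bm_fiber_sum. Qed.

Lemma mean_fiber_union (g : cube r N -> R -> R) (bt : R) :
  0 < bt -> (forall j, bounded_measurable (g j)) ->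
  (forall j t, 0 <= g j t <= bt) ->
  (forall j, mean P (fun w => g j (X j w)) <= 4) ->
  mean P (fiber_union g bt) <= 8 * scale ^+ 2 + 2 * bt * (log_cube_bound + 1).
Proof.
move=> bt0 bg gb gm.
apply: (@le_trans _ _ ((2 * bt)^-1^-1 * ((2 * bt)^-1 * (8 * N%:R) + log_cube_bound + 1))).
  apply: mean_exp_union.
  - by rewrite invr_gt0 mulr_gt0.
  - by move=> p _; exact: bm_fiber_sum.
  - by move=> p _; exact: (fiber_mgf mX facX p.1 p.2 bt0 bg gb gm).
  - have := cube_count_le r (ltW q0) qN; congr (_ <= _); congr (_%:R).
    by rewrite card_prod card_ffun !card_ord.
rewrite invrK -scale_sqr le_eqVlt; apply/orP; left; apply/eqP.
by field; rewrite gt_eqF.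
Qed.

Definition diag_union : T -> R :=
  fiber_union (fun j t => centered cutoff (trunc_mean P X cutoff) j t ^+ 2) (4 * cutoff ^+ 2).

Lemma bm_diag_union : bounded_measurable diag_union.
Proof. by apply: bm_fiber_union => j; apply: bmX; exact: bm_centered. Qed.

Lemma mean_diag_union :
  mean P diag_union <= (8 + 8 * (r%:R + 2 * h%:R * r%:R + 1)) * scale ^+ 2.
Proof.
have bt0 : 0 < 4 * cutoff ^+ 2 by rewrite mulr_gt0// exprn_gt0.
apply: (le_trans (mean_fiber_union bt0 _ _ _)).
- by move=> j; apply: bmX; exact: bm_centered.
- move=> j t; rewrite sqr_ge0/= -[leLHS]real_normK ?num_real//.
  have -> : 4 * cutoff ^+ 2 = (2 * cutoff) ^+ 2 by ring.
  rewrite lerXn2r ?nnegrE ?mulr_ge0 ?(ltW A0)//.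
  apply: centered_norm_le => //; last first.
    by apply: le_trans cutoff_ge1; rewrite invf_le1 ?cutoff_ge1.
  by apply: trunc_mean_le => //; exact: cutoff_ge1.
- by move=> j; apply: mean_centered_rv_sqr => //; exact: cutoff_ge1.
have l1 := cutoff_sqr_le; have l2 := cutoff_sqr_le_sqr.
have k : 0 <= 2 * h%:R * r%:R :> R by rewrite !mulr_ge0.
have k' : 0 <= r%:R + 1 :> R by rewrite addr_ge0.
have := ler_wpM2l k l1; have := ler_wpM2l k' l2; rewrite /log_cube_bound; lra.
Qed.

(** Truncation one power of [q] below [s]: the squared level times [q] is at most [s^2], which pays
    for [log_cube_bound], of order [q]. The larger entries of a line are few off the exceptional
    event. *)
Definition mid_union : T -> R :=
  fiber_union (fun j t => trunc (q ^+ h.-1) t ^+ 2) ((q ^+ h.-1) ^+ 2).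

Lemma bm_mid_union : bounded_measurable mid_union.
Proof. by apply: bm_fiber_union => j; apply: bmX; exact: bm_trunc. Qed.

Lemma mean_mid_union :
  mean P mid_union <= (8 + 2 * (r%:R + 2 * h%:R * r%:R + 1)) * scale ^+ 2.
Proof.
have bt0 : 0 < (q ^+ h.-1) ^+ 2 by rewrite !exprn_gt0.
apply: (le_trans (mean_fiber_union bt0 _ _ _)).
- by move=> j; apply: bmX; exact: bm_trunc.
- move=> j t; rewrite sqr_ge0/= -[leLHS]real_normK ?num_real//.
  by rewrite lerXn2r ?nnegrE ?exprn_ge0 ?trunc_norm_le ?exprn_ge0 ?(ltW q0).
- move=> j; apply: (@le_trans _ _ 1); last by rewrite ler1n.
  by rewrite tsq// exprn_gt0.
have scq : scale = q * q ^+ h.-1 by rewrite /scale hE exprS.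
have l1 : (q ^+ h.-1) ^+ 2 * q <= scale ^+ 2.
  rewrite scq exprMn mulrC ler_wpM2r ?sqr_ge0// expr2 ler_peMl// ltW//.
have l2 : (q ^+ h.-1) ^+ 2 <= scale ^+ 2.
  by apply: le_trans l1; rewrite ler_peMr// sqr_ge0.
have k : 0 <= 2 * h%:R * r%:R :> R by rewrite !mulr_ge0.
have k' : 0 <= r%:R + 1 :> R by rewrite addr_ge0.
have := ler_wpM2l k l1; have := ler_wpM2l k' l2; rewrite /log_cube_bound; lra.
Qed.

Variable j0 : 'I_N.

(** The Boolean is a sign, turning an absolute value into a maximum. With parameter [1 / scale] the
    moment bound costs [32 N / scale^2 = 32], and the number of indices is at most
    [expR (1 + r + 4 h r q)]. *)
Definition off_union : T -> R :=
  exp_union (fun p : ('I_r * cube r N * cube r N) * bool =>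
      [&& p.1.1.2 p.1.1.1 == j0, p.1.2 p.1.1.1 == j0 & p.1.1.2 != p.1.2])
    (fun p w => (-1) ^+ p.2 * \sum_v z (upd p.1.1.2 p.1.1.1 v) w *
                                     z (upd p.1.2 p.1.1.1 v) w) scale^-1
    (32 + (1 + r%:R + 4 * h%:R * r%:R * q)).

Let bm_off k (i i' : cube r N) : bounded_measurable
  (fun w => \sum_v z (upd i k v) w * z (upd i' k v) w).
Proof. by apply: bm_sum => v _; apply: bmM; exact: bm_z. Qed.

Lemma bm_off_union : bounded_measurable off_union.
Proof. by apply: bm_exp_union => p _; apply: bmZ; exact: bm_off. Qed.

Lemma mean_off_union :
  mean P off_union <= (34 + r%:R + 4 * h%:R * r%:R) * (scale * q).
Proof.
have s0 := scale_gt0.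
apply: (@le_trans _ _ (scale^-1^-1 * (32 + (1 + r%:R + 4 * h%:R * r%:R * q) + 1))).
  apply: mean_exp_union.
  - by rewrite invr_gt0 scale_gt0.
  - by move=> p _; apply: bmZ; exact: bm_off.
  - move=> [[[k i] i'] b] /= /and3P[/eqP ik /eqP i'k ne].
    rewrite (eq_mean _ (g := fun w => expR ((scale^-1 * (-1) ^+ b) *
      \sum_v z (upd i k v) w * z (upd i' k v) w))); last by move=> w; rewrite mulrA.
    apply: le_trans (off_mgf mX facX tmean tsq cutoff_ge1 (etrans ik (esym i'k)) ne _) _.
      rewrite normrM normr_sign mulr1 ger0_norm ?invr_ge0 ?(ltW s0)//.
      rewrite mulrC ler_pdivrMr//; have := cutoff_sqr_small; lra.
    rewrite ler_expR exprMn sqrr_sign mulr1 -scale_sqr exprVn -mulrA mulVf ?mulr1//.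
    by rewrite expf_neq0// gt_eqF.
  - apply: (@le_trans _ _ (2 * (r * N ^ r)%:R * (N ^ r)%:R)).
      rewrite -!natrM ler_nat (leq_trans (max_card _))//.
      rewrite !card_prod card_bool !card_ffun !card_ord; lia.
    apply: (@le_trans _ _ (expR 1 * expR (r%:R + 2 * h%:R * r%:R * q) *
        expR (2 * h%:R * r%:R * q))).
      apply: ler_pM; rewrite ?mulr_ge0//.
        apply: ler_pM => //; last exact: cube_count_le (ltW q0) qN.
        by have := expR_ge1Dx (1 : R); lra.
      rewrite natrX -qN -exprM.
      by apply: le_trans (exprn_le_expR _ (ltW q0)) _; rewrite ler_expR !natrM.
    by rewrite -!expRD ler_expR; lra.
rewrite invrK mulrCA ler_wpM2l ?(ltW s0)//.
have k' : 0 <= 34 + r%:R :> R by rewrite addr_ge0.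
have := ler_wpM2l k' q1; lra.
Qed.

End unions.

(** * Combination of the partial bounds on a cube of side [N] *)

Lemma coord_min (R : realType) (r N : nat) (s : R) (y : lattice r N) k j :
  0 < s -> coord s y k j != 0 -> s^-1 <= `|coord s y k j|.
Proof.
move=> s0; rewrite /coord /digit_val mulf_eq0 signr_eq0/= mulf_eq0 negb_or.
rewrite pnatr_eq0 => /andP[v0 _]; rewrite normrM normr_sign mul1r ger0_norm.
  by rewrite -[leLHS]mul1r ler_wpM2r ?invr_ge0 ?(ltW s0)// ler1n lt0n.
by rewrite divr_ge0// ltW.
Qed.

Lemma quadruple_power (R : realType) (b q : R) (r : nat) :
  (4 * b ^+ 2) ^+ (2 * r) * q = 16 ^+ r * (b ^+ (4 * r) * q).
Proof.
rewrite exprMn -exprM mulrA; congr (_ * _ * _); last by congr (_ ^+ _); lia.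
by rewrite exprM; congr (_ ^+ _); ring.
Qed.

Section cut_bounds.
Context {R : realType} {r N : nat}.
Variables (u : 'I_r -> 'I_N -> R).
Hypothesis uB : in_ball u.

Lemma cut_sqr_le (Q : pred R) k : \sum_j cut Q (u k j) ^+ 2 <= 4.
Proof.
apply: le_trans (in_ballP _ uB k); apply: ler_sum => j _; rewrite /cut.
by case: ifP => // _; rewrite expr0n sqr_ge0.
Qed.

Lemma prod_cut_sqr_le (Q : pred R) k :
  \prod_(l | l != k) \sum_j cut Q (u l j) ^+ 2 <= 4 ^+ r.
Proof.
apply: (@le_trans _ _ (\prod_(l < r | l != k) 4)).
  apply: ler_prod => l _; rewrite cut_sqr_le andbT.
  by apply: sumr_ge0 => j _; exact: sqr_ge0.
rewrite prodr_const ler_weXn2l ?ler1n//.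
by rewrite -[leqRHS](card_ord r) max_card.
Qed.

(** Coordinates that survive the cut satisfy [|t| <= t^2 / large_thr], which trades the l1 norm for
    the l2 norm. *)
Lemma prod_cut_norm_le (large_thr : R) k : 0 < large_thr <= 1 ->
  \prod_(l | l != k) \sum_j `|cut (fun t => large_thr < `|t|) (u l j)| <= (4 / large_thr) ^+ r.
Proof.
move=> /andP[bet0 bet1].
have ge0 l : 0 <= \sum_j `|cut (fun t => large_thr < `|t|) (u l j)| by apply: sumr_ge0.
apply: (@le_trans _ _ (\prod_(l < r | l != k) (4 / large_thr))).
  apply: ler_prod => l _; rewrite ge0/= ler_pdivlMr//.
  apply: le_trans (cut_sqr_le (fun t => large_thr < `|t|) l).
  rewrite mulr_suml; apply: ler_sum => j _; rewrite /cut.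
  case: ifP => [bu|_]; last by rewrite normr0 mul0r sqr_ge0.
  by rewrite -[u l j ^+ 2]real_normK ?num_real// expr2 ler_wpM2l// ltW.
rewrite prodr_const ler_weXn2l//; last by rewrite -[leqRHS](card_ord r) max_card.
by rewrite ler_pdivlMr// mul1r (le_trans bet1)// ler1n.
Qed.

End cut_bounds.

Section core.
Context {R : realType} {d : measure_display} {T : measurableType d}.
Variable P : probability T R.
Context {r N : nat}.
Variable X : cube r N -> T -> R.
Hypothesis mX : forall i, measurable_fun [set: T] (X i).
Hypothesis facX : factorizes P X.
Hypothesis tmean : forall i c, 0 < c ->
  `|mean P (fun w => trunc c (X i w))| <= c^-1.
Hypothesis tsq : forall i c, 0 < c ->
  mean P (fun w => trunc c (X i w) ^+ 2) <= 1.
Variables (q K : R) (a h : nat).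
Hypotheses (q16 : 16 <= q) (q2r : 2 ^+ r <= q) (r0 : (0 < r)%N) (K0 : 0 <= K).
Hypothesis hE : h = (4 * a.+1 * r).+1.
Hypothesis qN : q ^+ (2 * h) = N%:R.
Hypothesis tail_level : forall i l,
  mean P (fun w => if q ^+ (a + l) < `|X i w| then 1 else 0) <= @density R r q K a l.
Hypothesis tail_fiber : forall i,
  mean P (fun w => if q ^+ h.-1 < `|X i w| then 1 else 0) <= K / q ^+ (2 * h.-1 + 3).
Hypothesis tail_sqr : forall i t, 0 < t ->
  mean P (fun w => if t < `|X i w| then 1 else 0) <= t ^- 2.
Variable j0 : 'I_N.
Variable M : T -> R.
Hypothesis M_ge : forall i w, `|X i w| <= M w.

Let s := scale q h.
Let A := cutoff q a.
Let be := large_thr q a.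
Let z := centered_rv P X A.
Let L := (2 * h * r)%N.
Let D := @peel_const r h.
Let C0 := @fiber_const r h.
Let HC : R := (L * h.+1 ^ r)%:R.
Let q0 : 0 < q. Proof. exact: lt_le_trans q16. Qed.
Let q1 : 1 <= q. Proof. by apply: le_trans q16; rewrite ler1n. Qed.
Let s0 : 0 < s. Proof. exact: scale_gt0. Qed.
Let s1 : 1 <= s. Proof. exact: scale_ge1. Qed.
Let A1 : 1 <= A. Proof. exact: cutoff_ge1. Qed.
Let A0 : 0 < A. Proof. exact: lt_le_trans A1. Qed.
Let sN : s ^+ 2 = N%:R. Proof. exact: scale_sqr. Qed.
Let N0 : (0 < N)%N. Proof. exact: leq_trans (ltn_ord j0). Qed.
Let h0 : (0 < h)%N. Proof. by rewrite hE. Qed.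
Let be0 : 0 < be. Proof. exact: large_thr_gt0. Qed.
Let be1 : be <= 1.
Proof. by rewrite /be /large_thr invf_le1 ?exprn_gt0// !exprn_ege1// exprn_ege1. Qed.
Let M0 w : 0 <= M w.
Proof. by apply: le_trans (M_ge [ffun=> j0] w). Qed.

Let Lu := light_union P X q a h.
Let Su := sparse_union P X q a h.
Let Du := diag_union P X q a h.
Let Ou := off_union P X q a h j0.
Let Mu := mid_union X q h.

(** The share of the bound that has mean [O(s)], built from bounded majorants so that its mean is
    taken termwise. The factor [1 / (2 s)] comes from the Gram bound at [al = s]; the last term is
    at least [N^r / 2] on the exceptional event. *)
Definition bounded_part (w : T) : R :=
  Lu w + Su w + r%:R * (2 * s + (2 * s)^-1 * (4 ^+ r * Du w +
    (4 / be) ^+ (2 * r) * Ou w)) +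
  HC * (K * 2 ^+ r * s + 2^-1 * (r%:R * (4 * D%:R * s + 4 ^+ r * (Mu w / s)))) +
  4 ^+ r * s + 2^-1 * (N%:R ^+ r * bad q K a h L (fun i => X i w)).

Definition max_coef : R := HC * (2^-1 * (r%:R * (4 * D%:R + 4 ^+ r * C0%:R))).

Let Mu_ge0 w : 0 <= Mu w.
Proof.
apply: exp_union_ge0; first by rewrite invr_gt0 mulr_gt0 ?exprn_gt0.
apply: addr_ge0; last exact: log_cube_bound_ge0.
by rewrite mulr_ge0// invr_ge0 mulr_ge0// !exprn_ge0// ltW.
Qed.

Let Du_ge0 w : 0 <= Du w.
Proof.
apply: exp_union_ge0; first by rewrite invr_gt0 !mulr_gt0 ?exprn_gt0.
apply: addr_ge0; last exact: log_cube_bound_ge0.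
by rewrite mulr_ge0// invr_ge0 mulr_ge0// mulr_ge0// exprn_ge0// ltW.
Qed.

Let Ou_ge0 w : 0 <= Ou w.
Proof.
apply: exp_union_ge0; first by rewrite invr_gt0.
by rewrite !addr_ge0// !mulr_ge0// ltW.
Qed.

Let gram_part w (y : lattice r N) k : in_ball (coord s y) ->
  \sum_i z i w * (cut (fun t => `|t| <= small_thr q a h) (coord s y k (i k)) *
    \prod_(l | l != k) cut (fun t => be < `|t|) (coord s y l (i l))) <=
  2 * s + (2 * s)^-1 * (4 ^+ r * Du w + (4 / be) ^+ (2 * r) * Ou w).
Proof.
move=> yB.
have zD i : \sum_v z (upd i k v) w ^+ 2 <= Du w.
  apply: (exp_union_ge (fun (p : 'I_r * cube r N) w =>
    \sum_v z (upd p.2 p.1 v) w ^+ 2) _ (y := (k, i))) => //.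
  by rewrite invr_gt0 !mulr_gt0 ?exprn_gt0.
have zO (i i' : cube r N) : i k = j0 -> i' k = j0 -> i != i' ->
    `|\sum_v z (upd i k v) w * z (upd i' k v) w| <= Ou w.
  move=> ik i'k ne.
  have O (b : bool) : (-1) ^+ b * \sum_v z (upd i k v) w * z (upd i' k v) w <= Ou w.
    apply: (exp_union_ge (fun (p : ('I_r * cube r N * cube r N) * bool) w =>
      (-1) ^+ p.2 * \sum_v z (upd p.1.1.2 p.1.1.1 v) w *
        z (upd p.1.2 p.1.1.1 v) w) _ (y := ((k, i, i'), b))).
      by rewrite invr_gt0.
    by rewrite /= ik i'k !eqxx.
  have := O false; have := O true; rewrite expr0 expr1 mul1r mulN1r => h1 h2.
  by rewrite ler_norml h2 lerNl h1.
have := @gram_bound R r N k j0 (fun i => z i w) (fun v => cut (fun t => `|t| <= small_thr q a h) (coord s y k v))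
  (fun l j => cut (fun t => be < `|t|) (coord s y l j)) (Du w) (Ou w) s
  s0 (Ou_ge0 w) zD zO.
move=> /le_trans; apply.
have h1 := cut_sqr_le yB (fun t => `|t| <= small_thr q a h) k.
have h2 := prod_cut_sqr_le yB (fun t => be < `|t|) k.
have h3 : \prod_(l | l != k) \sum_j `|cut (fun t => be < `|t|) (coord s y l j)| <=
    (4 / be) ^+ r by apply: prod_cut_norm_le => //; rewrite be0.
have p0 : 0 <= \prod_(l | l != k) \sum_j `|cut (fun t => be < `|t|) (coord s y l j)|.
  by apply: prodr_ge0 => l _; apply: sumr_ge0.
have h4 : (\prod_(l | l != k) \sum_j `|cut (fun t => be < `|t|) (coord s y l j)|) ^+ 2
    <= (4 / be) ^+ (2 * r).
  by rewrite mulnC exprM lerXn2r ?nnegrE// exprn_ge0// divr_ge0// ltW.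
have k1 := ler_wpM2r (Du_ge0 w) h2; have k2 := ler_wpM2r (Ou_ge0 w) h4.
have si0 : 0 <= s^-1 by rewrite invr_ge0 ltW.
have k3 := ler_wpM2l si0 (lerD k1 k2).
have k4 := ler_wpM2l (ltW s0) h1.
rewrite invfM -mulrA; lra.
Qed.

Let fiber_part w k i : bad q K a h L (fun i => X i w) < 1 ->
  \sum_v X (upd i k v) w ^+ 2 <= Mu w + C0%:R * M w ^+ 2.
Proof.
move=> good.
have big := bad_lt1_fiber q16 k i good.
apply: (@le_trans _ _ (\sum_v trunc (q ^+ h.-1) (X (upd i k v) w) ^+ 2 +
    \sum_(v | q ^+ h.-1 < `|X (upd i k v) w|) M w ^+ 2)).
  rewrite [X in _ + X]big_mkcond/= -big_split/=; apply: ler_sum => v _.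
  rewrite /trunc; have [_|_] := leP `|X (upd i k v) w| (q ^+ h.-1).
    by rewrite addr0.
  rewrite expr0n add0r -[leLHS]real_normK ?num_real//.
  by rewrite lerXn2r ?nnegrE.
apply: lerD.
  apply: (exp_union_ge (fun (p : 'I_r * cube r N) w =>
    \sum_v trunc (q ^+ h.-1) (X (upd p.2 p.1 v) w) ^+ 2) _ (y := (k, i))) => //.
  by rewrite invr_gt0 mulr_gt0 ?exprn_gt0.
by rewrite sumr_const -[leLHS]mulr_natl ler_wpM2r ?sqr_ge0// ler_nat.
Qed.

Let good_bound w (y : lattice r N) : bad q K a h L (fun i => X i w) < 1 ->
  in_ball (coord s y) ->
  form (fun i => X i w) (coord s y) <= bounded_part w + max_coef * M w.
Proof.
move=> good yB.
have be_thr : small_thr q a h <= be by exact: small_le_large q16 r0 hE.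
have tmA i : `|trunc_mean P X A i| <= A^-1 by apply: tmean.
apply: le_trans (decompose s0 A0 be_thr tmA (fun i => X i w) yB) _.
have p1 : \sum_i light_fun s A (small_thr q a h) be (trunc_mean P X A) (coord s y) i (X i w) <= Lu w.
  apply: (exp_union_ge (light_form P X q a h)) => //.
  by rewrite divr_gt0.
have p2 : form (fun i => centered A (trunc_mean P X A) i (X i w))
    (fun k j => cut (fun t => small_thr q a h < `|t|) (coord s y k j)) <= Su w.
  have -> : (fun k j => cut (fun t => small_thr q a h < `|t|) (coord s y k j)) =
      coord s (sparsify s (small_thr q a h) y).
    by apply/funext => k; apply/funext => j; rewrite coord_sparsify.
  apply: (exp_union_ge (fun (y : lattice r N) w =>
    form (fun i => z i w) (coord s y)) _ (y := sparsify s (small_thr q a h) y)).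
    by rewrite divr_gt0 ?exprn_gt0.
  by rewrite /= in_ball_sparsify// sparse_sparsify.
have p3 : \sum_k \sum_i centered A (trunc_mean P X A) i (X i w) *
    (cut (fun t => `|t| <= small_thr q a h) (coord s y k (i k)) *
    \prod_(l | l != k) cut (fun t => be < `|t|) (coord s y l (i l))) <=
    r%:R * (2 * s + (2 * s)^-1 * (4 ^+ r * Du w + (4 / be) ^+ (2 * r) * Ou w)).
  have -> : forall c : R, r%:R * c = \sum_(k < r) c.
    by move=> c; rewrite sumr_const card_ord mulr_natl.
  by apply: ler_sum => k _; exact: gram_part.
(* With [al = s + M] the peeling costs [D (s + M)] for the vectors, and for the lines
   [(Mu + C0 M^2) / al <= Mu / s + C0 M]: linear in [M]. *)
have al0 : 0 < s + M w by rewrite ltr_pwDl.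
have F0 : 0 <= Mu w + C0%:R * M w ^+ 2.
  by rewrite addr_ge0// mulr_ge0// sqr_ge0.
have q2 : 2 < q by apply: lt_le_trans q16; rewrite ltr_nat.
have p4 := heavy_sum_le q2 q2r K0 al0 yB
  (fun k j => @coord_min _ _ _ s y k j s0)
  (fun i => bad_lt1_max (a := a) q16 i good) F0
  (fun k i => fiber_part k i good)
  (fun l B => bad_lt1_discrepancy q16 l B r0 good).
have p5 : (s + M w)^-1 * (Mu w + C0%:R * M w ^+ 2) <= Mu w / s + C0%:R * M w.
  rewrite mulrDr; apply: lerD.
    by rewrite mulrC ler_wpM2l// lef_pV2 ?posrE// lerDl.
  rewrite mulrC ler_pdivrMr// -mulrA ler_wpM2l// expr2 ler_wpM2l//.
  by rewrite lerDr ltW.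
have r4 : 0 <= r%:R * 4 ^+ r :> R by rewrite mulr_ge0// exprn_ge0.
have p6 := ler_wpM2l r4 p5.
have HC0 : 0 <= HC by [].
have p7 : HC * (K * 2 ^+ r * q ^+ h + 2^-1 * (r%:R * ((s + M w) * D%:R * 4 +
    (s + M w)^-1 * ((Mu w + C0%:R * M w ^+ 2) * 4 ^+ r)))) <=
    HC * (K * 2 ^+ r * s + 2^-1 * (r%:R * (4 * D%:R * s + 4 ^+ r * (Mu w / s)))) +
    max_coef * M w.
  rewrite /max_coef -[HC * (2^-1 * _) * M w]mulrA -mulrDr ler_wpM2l//.
  rewrite -/(scale q h) -/s; lra.
have b0 : 0 <= 2^-1 * (N%:R ^+ r * bad q K a h L (fun i => X i w)).
  by rewrite !mulr_ge0 ?invr_ge0 ?exprn_ge0// bad_ge0.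
rewrite /bounded_part mulrC; move: p4; rewrite -/HC => p4; lra.
Qed.

Let light_ge0 w : 0 <= Lu w.
Proof.
by apply: exp_union_ge0; rewrite ?divr_gt0// addr_ge0// mulr_ge0// exprn_ge0.
Qed.

Let sparse_ge0 w : 0 <= Su w.
Proof.
apply: exp_union_ge0; first by rewrite divr_gt0 ?exprn_gt0.
apply: addr_ge0; last first.
  apply: addr_ge0 => //; apply: mulr_ge0.
    by rewrite mulr_ge0 ?(ltW q0)// addr_ge0// mulr_ge0.
  by apply: mulr_ge0; rewrite ?mulr_ge0// invr_ge0 sqr_ge0.
apply: mulr_ge0; last exact: exprn_ge0.
by apply: mulr_ge0; rewrite ?sqr_ge0//; apply: mulr_ge0; rewrite ?sqr_ge0.
Qed.

Let max_coef_ge0 : 0 <= max_coef.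
Proof. by rewrite mulr_ge0// mulr_ge0 ?invr_ge0// mulr_ge0// addr_ge0// mulr_ge0// exprn_ge0. Qed.

Lemma bounded_part_ge w :
  2^-1 * (N%:R ^+ r * bad q K a h L (fun i => X i w)) <= bounded_part w.
Proof.
have s00 := ltW s0; have r4 : 0 <= 4 ^+ r :> R by rewrite exprn_ge0.
rewrite /bounded_part lerDr; apply: addr_ge0; last exact: mulr_ge0.
apply: addr_ge0; first apply: addr_ge0; first exact: addr_ge0.
- apply: mulr_ge0 => //; apply: addr_ge0; first exact: mulr_ge0.
  apply: mulr_ge0; first by rewrite invr_ge0 mulr_ge0.
  apply: addr_ge0; first exact: mulr_ge0.
  by apply: mulr_ge0 => //; rewrite exprn_ge0// divr_ge0// ltW.
- apply: mulr_ge0 => //; apply: addr_ge0.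
    by rewrite mulr_ge0// mulr_ge0// exprn_ge0.
  apply: mulr_ge0; rewrite ?invr_ge0//; apply: mulr_ge0 => //; apply: addr_ge0.
    by rewrite mulr_ge0// mulr_ge0.
  by apply: mulr_ge0 => //; rewrite divr_ge0.
Qed.

Lemma bounded_part_ge0 w : 0 <= bounded_part w.
Proof.
apply: le_trans (bounded_part_ge w).
by rewrite !mulr_ge0 ?invr_ge0 ?exprn_ge0// bad_ge0.
Qed.

(** Off the exceptional event this is rounding followed by [good_bound]. On it,
    [2 x w <= N^-r x^2 + N^r w^2] summed over all entries, with [N^r <= N^r * bad] absorbed by
    [bounded_part]. *)
Lemma form_le_core w (u : 'I_r -> 'I_N -> R) :
  (forall k, \sum_j u k j ^+ 2 <= 1) ->
  form (fun i => X i w) u <= bounded_part w + max_coef * M w +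
    2^-1 * (N%:R ^- r * \sum_i X i w ^+ 2).
Proof.
move=> u1.
have S0 : 0 <= \sum_i X i w ^+ 2 by apply: sumr_ge0 => i _; exact: sqr_ge0.
have Nr0 : 0 < N%:R ^+ r :> R by rewrite exprn_gt0// ltr0n.
have S1 : 0 <= 2^-1 * (N%:R ^- r * \sum_i X i w ^+ 2).
  by rewrite mulr_ge0 ?invr_ge0// mulr_ge0// invr_ge0 ltW.
have [good|badw] := ltP (bad q K a h L (fun i => X i w)) 1.
  have [y [yB /le_trans]] := lattice_round s0 sN (fun i => X i w) u1; apply.
  by rewrite -[leLHS]addr0 lerD// good_bound.
have w1 : \sum_i wt u i ^+ 2 <= 1.
  rewrite sum_wt_sqr -[leRHS](expr1n _ #|'I_r|) -prodr_const.
  apply: ler_prod => k _; rewrite u1 andbT.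
  by apply: sumr_ge0 => j _; exact: sqr_ge0.
have f1 : form (fun i => X i w) u <= 2^-1 * (N%:R ^- r * (\sum_i X i w ^+ 2) +
    N%:R ^+ r * \sum_i wt u i ^+ 2).
  rewrite !mulr_sumr -big_split/= mulr_sumr; apply: ler_sum => i _.
  have := sqr_ge0 (X i w - N%:R ^+ r * wt u i).
  rewrite -(pmulr_rge0 _ (x := N%:R ^- r)) ?invr_gt0//.
  have -> : N%:R ^- r * (X i w - N%:R ^+ r * wt u i) ^+ 2 =
    N%:R ^- r * X i w ^+ 2 + N%:R ^+ r * wt u i ^+ 2 - 2 * (X i w * wt u i).
    by field; rewrite expf_neq0// pnatr_eq0 -lt0n.
  lra.
apply: le_trans f1 _.
have b1 := bounded_part_ge w.
have m1 : 0 <= max_coef * M w by rewrite mulr_ge0.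
have n1 := ler_wpM2l (ltW Nr0) (le_trans w1 badw).
lra.
Qed.

Lemma bm_bounded_part : bounded_measurable bounded_part.
Proof.
apply: bmD; last by apply: bmZ; apply: bmZ; apply: bm_bad.
apply: bmD; last exact: bm_cst.
apply: bmD; first apply: bmD; first apply: bmD.
- exact: bm_light_union.
- exact: bm_sparse_union.
- apply: bmZ; apply: bmD; first exact: bm_cst.
  by apply: bmZ; apply: bmD; apply: bmZ; [exact: bm_diag_union|exact: bm_off_union].
- apply: bmZ; apply: bmD; first exact: bm_cst.
  apply: bmZ; apply: bmZ; apply: bmD; first exact: bm_cst.
  by apply: bmZ; apply: bmM; [exact: bm_mid_union|exact: bm_cst].
Qed.

(** Free of [N]; the summands follow those of [bounded_part] in order. *)
Definition bounded_coef : R :=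
  8 * (4 ^+ r + 6 * r%:R + 1) +
  (8 * 4 ^+ r + 4 * r%:R * (4 * h%:R + 2) + r%:R + 1) +
  r%:R * (2 + 2^-1 * (4 ^+ r * (8 + 8 * (r%:R + 2 * h%:R * r%:R + 1)) +
    16 ^+ r * (34 + r%:R + 4 * h%:R * r%:R))) +
  HC * (K * 2 ^+ r + 2^-1 * (r%:R * (4 * D%:R +
    4 ^+ r * (8 + 2 * (r%:R + 2 * h%:R * r%:R + 1))))) +
  4 ^+ r + 2^-1 * (L%:R + r%:R * expR K + 1).

Lemma mean_bounded_part : mean P bounded_part <= bounded_coef * s.
Proof.
have bL := bm_light_union mX tmean q16 q2r r0 hE.
have bS := bm_sparse_union P mX q a h.
have bDu := bm_diag_union P mX q a h.
have bO := bm_off_union P mX q a h j0.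
have bMu := bm_mid_union mX q h.
have bB := @bm_bad _ _ _ r N X mX q K a h.
have b3 : bounded_measurable (fun w => (4 : R) ^+ r * Du w + (4 / be) ^+ (2 * r) * Ou w).
  by apply: bmD; exact: bmZ.
have b4 : bounded_measurable (fun w => r%:R * (2 * s + (2 * s)^-1 * (4 ^+ r * Du w +
    (4 / be) ^+ (2 * r) * Ou w))).
  by apply: bmZ; apply: bmD; [exact: bm_cst|exact: bmZ].
have b5 : bounded_measurable (fun w => Mu w / s).
  by apply: bmM => //; exact: bm_cst.
have b6 : bounded_measurable (fun w => 4 * D%:R * s + 4 ^+ r * (Mu w / s)).
  by apply: bmD; [exact: bm_cst|exact: bmZ].
have b7 : bounded_measurable (fun w => HC * (K * 2 ^+ r * s + 2^-1 * (r%:R *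
    (4 * D%:R * s + 4 ^+ r * (Mu w / s))))).
  by apply: bmZ; apply: bmD; [exact: bm_cst|apply: bmZ; exact: bmZ].
have b8 : bounded_measurable
    (fun w => 2^-1 * (N%:R ^+ r * bad q K a h L (fun i => X i w))).
  by apply: bmZ; exact: bmZ.
have b9 : bounded_measurable (fun w => Lu w + Su w) by exact: bmD.
have E : mean P bounded_part = mean P Lu + mean P Su +
    r%:R * (2 * s + (2 * s)^-1 * (4 ^+ r * mean P Du + (4 / be) ^+ (2 * r) * mean P Ou)) +
    HC * (K * 2 ^+ r * s + 2^-1 * (r%:R * (4 * D%:R * s + 4 ^+ r * (mean P Mu / s)))) +
    4 ^+ r * s + 2^-1 * (N%:R ^+ r * mean P (fun w => bad q K a h L (fun i => X i w))).
  have m3 : mean P (fun w => 4 ^+ r * Du w + (4 / be) ^+ (2 * r) * Ou w) =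
      4 ^+ r * mean P Du + (4 / be) ^+ (2 * r) * mean P Ou.
    by rewrite (meanD P (bmZ _ bDu) (bmZ _ bO)) (meanZ P _ bDu) (meanZ P _ bO).
  have m4 : mean P (fun w => r%:R * (2 * s + (2 * s)^-1 * (4 ^+ r * Du w +
      (4 / be) ^+ (2 * r) * Ou w))) = r%:R * (2 * s + (2 * s)^-1 *
      (4 ^+ r * mean P Du + (4 / be) ^+ (2 * r) * mean P Ou)).
    rewrite (meanZ P _ (bmD (bm_cst (2 * s)) (bmZ (2 * s)^-1 b3))).
    by rewrite (meanD P (bm_cst (2 * s)) (bmZ (2 * s)^-1 b3)) mean_cst (meanZ P _ b3) m3.
  have m5 : mean P (fun w => Mu w / s) = mean P Mu / s.
    rewrite (eq_mean _ (g := fun w => s^-1 * Mu w)); last by move=> w; rewrite mulrC.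
    by rewrite (meanZ P _ bMu) mulrC.
  have m6 : mean P (fun w => 4 * D%:R * s + 4 ^+ r * (Mu w / s)) =
      4 * D%:R * s + 4 ^+ r * (mean P Mu / s).
    by rewrite (meanD P (bm_cst _) (bmZ _ b5)) mean_cst (meanZ P _ b5) m5.
  have m7 : mean P (fun w => HC * (K * 2 ^+ r * s + 2^-1 * (r%:R *
      (4 * D%:R * s + 4 ^+ r * (Mu w / s))))) = HC * (K * 2 ^+ r * s + 2^-1 * (r%:R *
      (4 * D%:R * s + 4 ^+ r * (mean P Mu / s)))).
    rewrite (meanZ P _ (bmD (bm_cst (K * 2 ^+ r * s)) (bmZ 2^-1 (bmZ r%:R b6)))).
    rewrite (meanD P (bm_cst (K * 2 ^+ r * s)) (bmZ 2^-1 (bmZ r%:R b6))) mean_cst.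
    by rewrite (meanZ P _ (bmZ r%:R b6)) (meanZ P _ b6) m6.
  have m8 : mean P (fun w => 2^-1 * (N%:R ^+ r * bad q K a h L (fun i => X i w))) =
      2^-1 * (N%:R ^+ r * mean P (fun w => bad q K a h L (fun i => X i w))).
    by rewrite (meanZ P _ (bmZ _ bB)) (meanZ P _ bB).
  have b10 := bmD (bmD b9 b4) b7.
  rewrite /bounded_part (meanD P (bmD b10 (bm_cst (4 ^+ r * s))) b8).
  rewrite (meanD P b10 (bm_cst (4 ^+ r * s))) mean_cst (meanD P (bmD b9 b4) b7).
  by rewrite (meanD P b9 b4) (meanD P bL bS) m4 m7 m8.
have e1 := mean_light_union mX facX tmean tsq q16 q2r r0 hE qN.
have e2 := mean_sparse_union mX facX tmean q16 q2r r0 hE qN.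
have e3 := mean_diag_union mX facX tmean tsq q16 r0 hE qN.
have e4 := mean_off_union mX facX tmean tsq q16 q2r r0 hE qN j0.
have e5 := mean_mid_union mX facX tsq q16 hE qN.
have e6 := mean_bad mX facX q16 K0 N0 h0 qN tail_level tail_fiber tail_sqr.
have e3' : (2 * s)^-1 * (4 ^+ r * mean P Du) <=
    2^-1 * (4 ^+ r * (8 + 8 * (r%:R + 2 * h%:R * r%:R + 1))) * s.
  have c0 : 0 <= (2 * s)^-1 * 4 ^+ r.
    by rewrite mulr_ge0 ?exprn_ge0// invr_ge0 mulr_ge0// ltW.
  rewrite [leLHS]mulrA; apply: le_trans (ler_wpM2l c0 e3) _.
  by rewrite le_eqVlt; apply/orP; left; apply/eqP; rewrite -/s; field; rewrite gt_eqF.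
have e4' : (2 * s)^-1 * ((4 / be) ^+ (2 * r) * mean P Ou) <=
    2^-1 * (16 ^+ r * (34 + r%:R + 4 * h%:R * r%:R)) * s.
  have c0 : 0 <= (2 * s)^-1 * (4 / be) ^+ (2 * r).
    by rewrite mulr_ge0 ?exprn_ge0 ?divr_ge0 ?(ltW be0)// invr_ge0 mulr_ge0// ltW.
  rewrite [leLHS]mulrA; apply: le_trans (ler_wpM2l c0 e4) _.
  (* Here the choice [h = 4(a+1)r + 1] is spent: the l1 norms and the spare [q] of [mean_off_union]
     multiply to exactly [16^r s]. *)
  have beE : (4 / be) ^+ (2 * r) * q = 16 ^+ r * s.
    by rewrite /s (scaleE q hE) /be /large_thr invrK quadruple_power.
  have -> : (2 * s)^-1 * (4 / be) ^+ (2 * r) * ((34 + r%:R + 4 * h%:R * r%:R) *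
      (scale q h * q)) = (2 * s)^-1 * (34 + r%:R + 4 * h%:R * r%:R) * s *
      ((4 / be) ^+ (2 * r) * q) by rewrite -/s; ring.
  rewrite beE le_eqVlt; apply/orP; left; apply/eqP.
  by field; rewrite gt_eqF.
have e5' : mean P Mu / s <= (8 + 2 * (r%:R + 2 * h%:R * r%:R + 1)) * s.
  by rewrite ler_pdivrMr//; apply: le_trans e5 _; rewrite -/s expr2 [leLHS]mulrA.
have e6' : N%:R ^+ r * mean P (fun w => bad q K a h L (fun i => X i w)) <=
    (L%:R + r%:R * expR K + 1) * s.
  have Nr0 : 0 < N%:R ^+ r :> R by rewrite exprn_gt0// ltr0n.
  rewrite mulrC -ler_pdivlMr//; apply: le_trans e6 _.
  apply: ler_wpM2r; first by rewrite invr_ge0 ltW.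
  apply: ler_peMr => //; apply: addr_ge0 => //.
have r4 : 0 <= 4 ^+ r :> R by rewrite exprn_ge0.
have HC0 : 0 <= HC by [].
have hr0 : 0 <= HC * (2^-1 * r%:R) by rewrite mulr_ge0// mulr_ge0// invr_ge0.
have f5 := ler_wpM2l hr0 (ler_wpM2l r4 e5').
have f34 := ler_wpM2l (ler0n R r) (lerD e3' e4').
rewrite E /bounded_coef; rewrite -/s -/Lu -/Su in e1 e2 *; lra.
Qed.

End core.

(* The integral of a nonnegative function is a supremum over simple functions
   below it, so monotonicity needs no measurability. *)
Lemma ge0_le_integral_pointwise (R : realType) (d : measure_display)
    (T : measurableType d) (mu : {measure set T -> \bar R}) (f g : T -> R) :
  (forall x, 0 <= f x) -> (forall x, f x <= g x) ->
  (\int[mu]_x (f x)%:E <= \int[mu]_x (g x)%:E)%E.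
Proof.
move=> f0 fg.
rewrite ge0_integralTE => [|x]; last by rewrite lee_fin.
rewrite ge0_integralTE => [|x]; last by rewrite lee_fin (le_trans (f0 x)).
apply: le_ereal_sup => _ [s /= sf <-]; exists s => //= x.
by rewrite (le_trans (sf x))// lee_fin.
Qed.

Section ge0_real_integral.
Context {R : realType} {d : measure_display} {T : measurableType d}.
Variable mu : {measure set T -> \bar R}.
Implicit Types f g : T -> R.

Lemma ge0_integral_addr f g :
  measurable_fun [set: T] f -> measurable_fun [set: T] g ->
  (forall x, 0 <= f x) -> (forall x, 0 <= g x) ->
  (\int[mu]_x (f x + g x)%:E = \int[mu]_x (f x)%:E + \int[mu]_x (g x)%:E)%E.
Proof.
move=> mf mg f0 g0; rewrite -ge0_integralD//.
- by move=> x _; rewrite lee_fin.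
- exact/measurable_EFinP.
- by move=> x _; rewrite lee_fin.
- exact/measurable_EFinP.
Qed.

Lemma ge0_integral_scaler (k : R) f : measurable_fun [set: T] f ->
  (forall x, 0 <= f x) -> 0 <= k ->
  (\int[mu]_x (k * f x)%:E = k%:E * \int[mu]_x (f x)%:E)%E.
Proof.
move=> mf f0 k0; rewrite -ge0_integralZl//.
- exact/measurable_EFinP.
- by move=> x _; rewrite lee_fin.
Qed.

End ge0_real_integral.

(** * Choice of the exponents and of the base [q]; a measurable majorant *)

Lemma exprn_powR (R : realType) (q e : R) (j m : nat) : 1 <= q ->
  m%:R <= e * j%:R -> q ^+ m <= (q ^+ j) `^ e.
Proof.
move=> q1 me; have q0 : 0 <= q by exact: le_trans q1.
by rewrite -!powR_mulrn// -powRrM mulrC ler_powR// ?mulrC.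
Qed.

Section core_upper.
Context {R : realType} {r : nat}.
Variables (eps K : R).
Hypotheses (r0 : (0 < r)%N) (eps0 : 0 < eps) (K0 : 0 <= K).

Let a := (Num.trunc ((2 * r + 3)%:R / eps)).+1.
Let h := (4 * a.+1 * r).+1.
Let qmin : R := Num.max 16 (2 ^+ r).

Let a_large : (2 * r + 3)%:R <= eps * a%:R.
Proof.
rewrite mulrC -ler_pdivrMr// ltW//; apply: truncnS_gt.
Qed.

Let h_large : (a <= h.-1)%N.
Proof. by rewrite /h /=; move: (a) r0; clear; nia. Qed.

Definition upper_const : R :=
  `|@bounded_coef R r K h| + `|@max_coef R r h| + 1 + qmin ^+ (2 * h * r).

Section with_data.
Context {d : measure_display} {T : measurableType d}.
Variables (P : probability T R) (N : nat) (X : cube r N -> T -> R).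
Hypothesis N0 : (0 < N)%N.
Hypothesis mX : forall i, measurable_fun [set: T] (X i).
Hypothesis facX : factorizes P X.
Hypothesis tmean : forall i c, 0 < c ->
  `|mean P (fun w => trunc c (X i w))| <= c^-1.
Hypothesis tsq : forall i c, 0 < c ->
  mean P (fun w => trunc c (X i w) ^+ 2) <= 1.
Hypothesis tail_sqr : forall i t, 0 < t ->
  mean P (fun w => if t < `|X i w| then 1 else 0) <= t ^- 2.
Hypothesis tail_eps : forall i t, 1 <= t ->
  mean P (fun w => if t < `|X i w| then 1 else 0) <= K / t `^ (2 + eps).
Hypothesis Xsq : forall i, (\int[P]_w (X i w ^+ 2)%:E <= 1)%E.
Variable M : T -> R.
Hypothesis mM : measurable_fun [set: T] M.
Hypothesis M_ge : forall i w, `|X i w| <= M w.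
Let M_ge0 w : 0 <= M w.
Proof. exact: le_trans (M_ge [ffun=> Ordinal N0] w). Qed.

Let frob : (\int[P]_w (\sum_i X i w ^+ 2)%:E <= (N%:R ^+ r)%:E)%E.
Proof.
under eq_integral do rewrite -sumEFin.
rewrite ge0_integral_sum//.
- apply: (@le_trans _ _ (\sum_(i : cube r N) 1%E)%E).
    by apply: lee_sum => i _; exact: Xsq.
  by rewrite sumEFin lee_fin sumr_const card_ffun !card_ord -natrX.
- by move=> i; apply/measurable_EFinP; exact: measurable_funX.
- by move=> i w _; rewrite lee_fin sqr_ge0.
Qed.

Let mfrob : measurable_fun [set: T] (fun w => \sum_i X i w ^+ 2).
Proof. by apply: measurable_sum => i; exact: measurable_funX. Qed.

Let frob0 w : 0 <= \sum_i X i w ^+ 2.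
Proof. by apply: sumr_ge0 => i _; exact: sqr_ge0. Qed.

Let q : R := N%:R `^ (2 * h)%:R^-1.

Let qN : q ^+ (2 * h) = N%:R.
Proof.
by rewrite -powR_mulrn ?powR_ge0// -powRrM mulVf ?powRr1// pnatr_eq0.
Qed.

Let q1 : 1 <= q.
Proof.
by rewrite -(powRr0 N%:R) ler_powR ?ler1n// invr_ge0.
Qed.

Let sqrtN : q ^+ h = Num.sqrt N%:R.
Proof.
rewrite -qN mulnC exprM sqrtr_sqr ger0_norm// exprn_ge0//.
exact: le_trans q1.
Qed.

Let upper_ge0 : 0 <= `|@bounded_coef R r K h| + `|@max_coef R r h| + 1.
Proof. by rewrite addr_ge0// addr_ge0. Qed.

Let qmin_ge0 : 0 <= qmin ^+ (2 * h * r).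
Proof. by rewrite exprn_ge0// le_max ler0n. Qed.

Let sqrtN1 : 1 <= Num.sqrt N%:R :> R.
Proof. by rewrite -sqrtN exprn_ege1. Qed.

Let IM0 : (0 <= \int[P]_w (M w)%:E)%E.
Proof. by apply: integral_ge0 => w _; rewrite lee_fin. Qed.

(** A single measurable [H] dominates the form for all [u], in place of the supremum over [u]
    itself. *)
Lemma core_upper : exists H : T -> R,
  [/\ measurable_fun [set: T] H, forall w, 0 <= H w,
      forall w (u : 'I_r -> 'I_N -> R), (forall k, \sum_j u k j ^+ 2 <= 1) ->
        form (fun i => X i w) u <= H w &
      (\int[P]_w (H w)%:E <=
        upper_const%:E * ((Num.sqrt N%:R)%:E + \int[P]_w (M w)%:E))%E].
Proof.
(* For [q < qmin] the side [N] is below the constant [qmin^(2h)], and [2 x w <= x^2 + w^2] suffices;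
   this is the origin of the last term of [upper_const]. *)
have [q_large|q_small] := leP qmin q; last first.
  exists (fun w => 2^-1 * (1 + \sum_i X i w ^+ 2)); split.
  - by apply: measurable_funM => //; exact: measurable_funD.
  - by move=> w; rewrite mulr_ge0 ?invr_ge0// addr_ge0.
  - move=> w u u1.
    have w1 : \sum_i wt u i ^+ 2 <= 1.
      rewrite sum_wt_sqr -[leRHS](expr1n _ #|'I_r|) -prodr_const.
      apply: ler_prod => k _; rewrite u1 andbT.
      by apply: sumr_ge0 => j _; exact: sqr_ge0.
    apply: (@le_trans _ _ (2^-1 * (\sum_i wt u i ^+ 2 + \sum_i X i w ^+ 2))); last first.
      by rewrite ler_wpM2l ?invr_ge0// lerD2r.
    rewrite -big_split/= mulr_sumr; apply: ler_sum => i _.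
    by have := sqr_ge0 (X i w - wt u i); nra.
  apply: (@le_trans _ _ (2^-1 * (1 + N%:R ^+ r))%:E).
    have m1 : measurable_fun [set: T] (fun w => 1 + \sum_i X i w ^+ 2).
      exact: measurable_funD.
    have m0 w : 0 <= 1 + \sum_i X i w ^+ 2 by rewrite addr_ge0.
    have half0 : 0 <= 2^-1 :> R by rewrite invr_ge0.
    rewrite (ge0_integral_scaler P m1 m0 half0).
    rewrite [leRHS]EFinM lee_wpmul2l ?lee_fin ?invr_ge0//.
    rewrite (ge0_integral_addr P (measurable_cst (1 : R)) mfrob)//.
    by rewrite (integral_mean P (bm_cst 1)) mean_cst EFinD leeD2l.
  have Nr1 : 1 <= N%:R ^+ r :> R by rewrite exprn_ege1// ler1n.
  have Nq : N%:R ^+ r <= qmin ^+ (2 * h * r).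
    rewrite -qN -exprM lerXn2r ?nnegrE ?(ltW q_small)//; first exact: le_trans q1.
    by rewrite le_max ler0n.
  apply: (@le_trans _ _ (upper_const * Num.sqrt N%:R)%:E).
    rewrite lee_fin; apply: (@le_trans _ _ upper_const).
      rewrite /upper_const; have := normr_ge0 (@bounded_coef R r K h).
      have := normr_ge0 (@max_coef R r h); lra.
    by rewrite ler_peMr// addr_ge0.
  by rewrite EFinM lee_wpmul2l ?lee_fin ?addr_ge0// leeDl.
have q16 : 16 <= q by apply: le_trans q_large; rewrite le_max lexx.
have q2r : 2 ^+ r <= q by apply: le_trans q_large; rewrite le_max lexx orbT.
(* Markov's inequality at [q^j]: the surplus [eps j >= m] in the exponent becomes the factor
   [q^-m]. *)
have tail_gen i j m : (m%:R <= eps * j%:R) ->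
    mean P (fun w => if q ^+ j < `|X i w| then 1 else 0) <= K / q ^+ (2 * j + m).
  move=> mj; apply: le_trans (tail_eps i (exprn_ege1 _ q1)) _.
  rewrite ler_wpM2l// lef_pV2 ?posrE ?powR_gt0 ?exprn_gt0 ?(lt_le_trans ltr01 q1)//.
  by apply: exprn_powR => //; rewrite natrD natrM; lra.
have tail_level i l : mean P (fun w => if q ^+ (a + l) < `|X i w| then 1 else 0) <=
    @density R r q K a l.
  rewrite /density -addnA; apply: tail_gen; apply: le_trans a_large _.
  by rewrite ler_wpM2l ?(ltW eps0)// ler_nat leq_addr.
have tail_fiber i : mean P (fun w => if q ^+ h.-1 < `|X i w| then 1 else 0) <=
    K / q ^+ (2 * h.-1 + 3).
  apply: tail_gen; apply: (@le_trans _ _ (eps * a%:R)).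
    by apply: le_trans a_large; rewrite ler_nat leq_addl.
  by rewrite ler_wpM2l ?(ltW eps0)// ler_nat.
pose j0 := Ordinal N0.
pose V := bounded_part P X q K a h j0.
have bV : bounded_measurable V.
  exact: (@bm_bounded_part _ _ _ P r N X mX tmean q K a h q16 q2r r0 (erefl h) j0).
have V0 w : 0 <= V w.
  exact: bounded_part_ge0.
have mV : mean P V <= @bounded_coef R r K h * q ^+ h.
  exact: (@mean_bounded_part _ _ _ P r N X mX facX tmean tsq q K a h q16 q2r r0 K0
    (erefl h) qN tail_level tail_fiber tail_sqr j0).
pose cM := `|@max_coef R r h|.
have Nr0 : 0 <= 2^-1 * N%:R ^- r :> R by rewrite mulr_ge0 ?invr_ge0 ?exprn_ge0.
have cM0 : 0 <= cM by exact: normr_ge0.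
have m1 : measurable_fun [set: T] (fun w => cM * M w) by apply: measurable_funM.
have m2 : measurable_fun [set: T] (fun w => 2^-1 * N%:R ^- r * \sum_i X i w ^+ 2).
  by apply: measurable_funM.
exists (fun w => V w + (cM * M w + 2^-1 * N%:R ^- r * \sum_i X i w ^+ 2)); split.
- by apply: measurable_funD; [case: bV|exact: measurable_funD].
- by move=> w; rewrite addr_ge0// addr_ge0// mulr_ge0.
- move=> w u u1.
  apply: le_trans (@form_le_core _ _ _ P r N X tmean q K a h q16 q2r r0 K0
    (erefl h) qN j0 M M_ge w u u1) _.
  rewrite -/V -[leLHS]addrA; apply: lerD => //; apply: lerD; last by rewrite [leLHS]mulrA.
  by rewrite ler_wpM2r//; exact: ler_norm.
rewrite ge0_integral_addr//; last 3 first.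
- by case: bV.
- exact: measurable_funD.
- by move=> w; rewrite addr_ge0// mulr_ge0.
rewrite (integral_mean P bV) ge0_integral_addr//; last 2 first.
- by move=> w; rewrite mulr_ge0.
- by move=> w; rewrite mulr_ge0.
rewrite !ge0_integral_scaler//.
apply: (@le_trans _ _ ((`|@bounded_coef R r K h| * Num.sqrt N%:R)%:E +
    (cM%:E * \int[P]_w (M w)%:E + (2^-1)%:E))%E).
  apply: leeD.
    rewrite lee_fin (le_trans mV)// sqrtN ler_wpM2r ?sqrtr_ge0//.
    exact: ler_norm.
  rewrite leeD2l//; apply: (@le_trans _ _ ((2^-1 * N%:R ^- r)%:E * (N%:R ^+ r)%:E)%E).
    by rewrite lee_wpmul2l ?lee_fin.
  rewrite -EFinM lee_fin -mulrA mulVf ?mulr1// expf_neq0// pnatr_eq0 -lt0n//.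
have u0 : 0 <= upper_const by rewrite addr_ge0.
rewrite [leRHS]ge0_muleDr ?lee_fin ?sqrtr_ge0// (addeC (cM%:E * _)%E) addeA.
apply: leeD.
  rewrite -EFinD -EFinM lee_fin.
  have k1 : 2^-1 <= Num.sqrt N%:R :> R by apply: le_trans sqrtN1; rewrite invf_le1 ?ler1n.
  have k2 : (`|@bounded_coef R r K h| + 1) * Num.sqrt N%:R <= upper_const * Num.sqrt N%:R.
    rewrite ler_wpM2r ?sqrtr_ge0// /upper_const.
    by have := normr_ge0 (@max_coef R r h); have := qmin_ge0; lra.
  by move: k1 k2; lra.
rewrite lee_wpmul2r// lee_fin /upper_const /cM.
by have := normr_ge0 (@bounded_coef R r K h); have := qmin_ge0; lra.
Qed.

End with_data.

Lemma upper_const_gt0 : 0 < upper_const.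
Proof.
rewrite ltr_wpDr ?ltr_wpDl ?addr_ge0//.
by rewrite exprn_ge0// le_max ler0n.
Qed.

End core_upper.

(** * Moments and reduction to a cube *)

Lemma sqr_integrable (R : realType) (d : measure_display) (T : measurableType d)
    (P : probability T R) (Y : T -> R) : measurable_fun [set: T] Y ->
  (\int[P]_w (Y w ^+ 2)%:E < +oo)%E -> P.-integrable [set: T] (EFin \o Y).
Proof.
move=> mY Ysq; apply/integrableP; split; first exact/measurable_EFinP.
apply: (@le_lt_trans _ _ (\int[P]_w (1 + Y w ^+ 2)%:E)%E).
  under eq_integral do rewrite /=.
  apply: ge0_le_integral_pointwise => // w.
  by have := sqr_ge0 (`|Y w| - 1); rewrite -[Y w ^+ 2]real_normK ?num_real//; nra.
rewrite (ge0_integral_addr P (measurable_cst (1 : R)))//.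
- rewrite (integral_mean P (bm_cst 1)) mean_cst.
  by apply: lte_add_pinfty; rewrite ?ltry.
- exact: measurable_funX.
- by move=> w; exact: sqr_ge0.
Qed.

Section moments.
Context {R : realType} {d : measure_display} {T : measurableType d}.
Variables (P : probability T R) (Y : T -> R).
Hypothesis mY : measurable_fun [set: T] Y.
Hypothesis Ysq : (\int[P]_w (Y w ^+ 2)%:E <= 1)%E.

Lemma mean_trunc_sqr (c : R) : mean P (fun w => trunc c (Y w) ^+ 2) <= 1.
Proof.
rewrite -lee_fin -integral_mean; last by apply: bmX; exact: bm_comp (bm_trunc c) mY.
apply: le_trans Ysq; apply: ge0_le_integral_pointwise => w; first exact: sqr_ge0.
rewrite -[leLHS]real_normK ?num_real// -[leRHS]real_normK ?num_real//.
by rewrite lerXn2r ?nnegrE// trunc_norm_le_id.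
Qed.

Lemma mean_tail (g : R -> R) (t B : R) : measurable_fun [set: R] g ->
  0 < t -> (forall x, 0 <= g x) -> (forall x, t < `|x| -> g t <= g x) -> 0 < g t ->
  (\int[P]_w (g (Y w))%:E <= B%:E)%E ->
  mean P (fun w => if t < `|Y w| then 1 else 0) <= B / g t.
Proof.
move=> mg t0 g0 gt gt0 gB; rewrite ler_pdivlMr// mulrC.
have bt : bounded_measurable (fun w => if t < `|Y w| then 1 else 0 : R).
  exact: (bm_comp (bm_gt t) mY).
rewrite -meanZ// -lee_fin -integral_mean; last exact: bmZ.
apply: le_trans gB; apply: ge0_le_integral_pointwise => w.
  by rewrite mulr_ge0 ?(ltW gt0)//; case: ifP.
by case: ifP => [/gt h|_]; rewrite ?mulr1 ?mulr0.
Qed.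

Lemma mean_tail_sqr (t : R) : 0 < t ->
  mean P (fun w => if t < `|Y w| then 1 else 0) <= t ^- 2.
Proof.
move=> t0; rewrite -[leRHS]mul1r.
apply: (mean_tail (g := fun x => x ^+ 2)) => //.
- by move=> x; exact: sqr_ge0.
- move=> x tx; rewrite -[leRHS]real_normK ?num_real//.
  by rewrite lerXn2r ?nnegrE ?(ltW t0) ?(ltW tx).
- by rewrite exprn_gt0.
Qed.

Lemma mean_tail_powR (p K t : R) : 0 < p -> 0 < t ->
  (\int[P]_w (`|Y w| `^ p)%:E <= K%:E)%E ->
  mean P (fun w => if t < `|Y w| then 1 else 0) <= K / t `^ p.
Proof.
move=> p0 t0 YK; have -> : t `^ p = `|t| `^ p by rewrite ger0_norm// ltW.
apply: (mean_tail (g := fun x => `|x| `^ p)) => //.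
- exact: (measurableT_comp (@measurable_powR R p) (@normr_measurable R setT)).
- move=> x tx; rewrite ge0_ler_powR ?nnegrE ?(ltW p0)//.
  by rewrite ger0_norm ltW.
- by rewrite powR_gt0 ?normr_gt0 ?gt_eqF.
Qed.

(** As [Y] has mean 0, the truncated mean is minus the mean of the removed part, and the latter is
    at most [Y^2 / c] pointwise. *)
Lemma mean_trunc_le (c : R) : mean P Y = 0 -> 0 < c ->
  `|mean P (fun w => trunc c (Y w))| <= c^-1.
Proof.
move=> Y0 c0.
have bt : bounded_measurable (fun w => trunc c (Y w)).
  exact: bm_comp (bm_trunc c) mY.
have it := bm_integrable P bt.
have iY : P.-integrable [set: T] (EFin \o Y).
  exact: sqr_integrable mY (le_lt_trans Ysq (ltry 1)).
have -> : mean P (fun w => trunc c (Y w)) = - mean P (fun w => Y w - trunc c (Y w)).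
  by rewrite /mean RintegralB// -/(mean P Y) Y0 sub0r opprK.
rewrite normrN.
have iD : P.-integrable [set: T] (EFin \o (fun w => Y w - trunc c (Y w))).
  by rewrite (_ : _ \o _ = (EFin \o Y) \- (EFin \o (fun w => trunc c (Y w))))%E//;
    exact: integrableB.
rewrite (le_trans (le_normr_Rintegral _ iD))// -lee_fin /Rintegral fineK; last first.
  apply: integrable_fin_num => //.
  exact: (integrable_norm iD).
have mY2 : measurable_fun [set: T] (fun w => Y w ^+ 2) by exact: measurable_funX.
apply: (@le_trans _ _ (\int[P]_w (c^-1 * Y w ^+ 2)%:E)%E).
  apply: ge0_le_integral_pointwise => // w; rewrite /trunc.
  have [_|cY] := leP `|Y w| c.
    by rewrite subrr normr0 mulr_ge0 ?invr_ge0 ?sqr_ge0// ltW.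
  rewrite subr0 mulrC ler_pdivlMr// -[leRHS]real_normK ?num_real// expr2.
  by rewrite ler_wpM2l// ltW.
rewrite ge0_integral_scaler// ?invr_ge0 ?(ltW c0)//; last by move=> w; exact: sqr_ge0.
by rewrite -[leRHS]mule1 lee_wpmul2l// lee_fin invr_ge0 ltW.
Qed.

End moments.

Section same_law_integral.
Context {R : realType} {d d' : measure_display}.
Context {T : measurableType d} {T' : measurableType d'}.
Variables (P : probability T R) (P' : probability T' R).
Variables (X : {RV P >-> R}) (Z : {RV P' >-> R}).
Hypothesis XZ : same_law X Z.

Lemma same_law_ge0_integral (g : R -> R) : measurable_fun [set: R] g ->
  (forall x, 0 <= g x) ->
  (\int[P]_w (g (X w))%:E = \int[P']_w (g (Z w))%:E)%E.
Proof.
move=> mg g0.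
have mG : measurable_fun [set: R] (EFin \o g) by exact/measurable_EFinP.
have G0 x : (0 <= (EFin \o g) x)%E by rewrite lee_fin.
rewrite -[LHS](ge0_integral_distribution X mG G0).
rewrite -[RHS](ge0_integral_distribution Z mG G0).
by apply: eq_measure_integral => A mA _; exact: XZ.
Qed.

Lemma same_law_integral : P.-integrable [set: T] (EFin \o X) ->
  P'.-integrable [set: T'] (EFin \o Z) ->
  (\int[P]_w (X w)%:E = \int[P']_w (Z w)%:E)%E.
Proof.
move=> iX iZ.
have mE : measurable_fun [set: R] (@EFin R) by exact/measurable_EFinP.
rewrite -[LHS](integral_distribution mE iX) -[RHS](integral_distribution mE iZ).
by apply: eq_measure_integral => A mA _; exact: XZ.
Qed.

End same_law_integral.

Section padding.
Context {r : nat} (n : 'I_r -> nat).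

Definition max_dim : nat := \max_k n k.

Lemma le_max_dim k : (n k <= max_dim)%N.
Proof. exact: leq_bigmax. Qed.

Definition emb (j : tensor_index n) : cube r max_dim :=
  [ffun k => widen_ord (le_max_dim k) (j k)].

Lemma emb_inj : injective emb.
Proof.
move=> j j' /ffunP jj'; apply/ffunP => k; apply: val_inj.
by have := jj' k; rewrite !ffunE => /(congr1 val).
Qed.

Definition unemb (i : cube r max_dim) : option (tensor_index n) :=
  [pick j | emb j == i].

Lemma embK j : unemb (emb j) = Some j.
Proof.
rewrite /unemb; case: pickP => [j' /eqP/emb_inj -> //|/(_ j)].
by rewrite eqxx.
Qed.

Lemma unembK i : isSome (unemb i) -> omap emb (unemb i) = Some i.
Proof. by rewrite /unemb; case: pickP => //= j /eqP ->. Qed.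

Lemma prod_split_emb (R : realType) (G : cube r max_dim -> R) :
  \prod_i G i = \prod_j G (emb j) * \prod_(i | ~~ isSome (unemb i)) G i.
Proof.
rewrite (bigID (fun i => isSome (unemb i)))/=; congr (_ * _).
rewrite (reindex_omap emb unemb) /=; last exact: unembK.
by apply: eq_bigl => j; rewrite embK eqxx.
Qed.

Definition padded (R : realType) (F : tensor_index n -> R)
    (i : cube r max_dim) : R := oapp F 0 (unemb i).

Lemma padded_emb (R : realType) (F : tensor_index n -> R) j :
  padded F (emb j) = F j.
Proof. by rewrite /padded embK. Qed.

Lemma sum_padded (R : realType) (F : tensor_index n -> R)
    (W : cube r max_dim -> R) :
  \sum_i padded F i * W i = \sum_j F j * W (emb j).
Proof.
rewrite (bigID (fun i => isSome (unemb i)))/= [X in _ + X]big1 ?addr0.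
  rewrite (reindex_omap emb unemb) /=; last exact: unembK.
  apply: eq_big => [j|j _]; first by rewrite embK eqxx.
  by rewrite padded_emb.
by move=> i; rewrite /padded; case: unemb => //= _; rewrite mul0r.
Qed.

Section vectors.
Context {R : realType}.
Variable x : forall k : 'I_r, 'rV[R]_(n k).

Definition pad_vec (k : 'I_r) (j : 'I_max_dim) : R :=
  oapp (fun v : 'I_(n k) => x k ord0 v) 0 (insub (j : nat)).

Lemma pad_vec_widen k (v : 'I_(n k)) :
  pad_vec k (widen_ord (le_max_dim k) v) = x k ord0 v.
Proof. by rewrite /pad_vec /= valK. Qed.

Lemma sum_pad_vec_sqr k : l2norm (x k) = 1 -> \sum_j pad_vec k j ^+ 2 <= 1.
Proof.
move=> xk.
have S0 : 0 <= \sum_(v < n k) x k ord0 v ^+ 2.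
  by apply: sumr_ge0 => v _; exact: sqr_ge0.
have <- : \sum_(v < n k) x k ord0 v ^+ 2 = 1.
  by rewrite -(sqr_sqrtr S0) -/(l2norm (x k)) xk expr1n.
rewrite (bigID (fun j : 'I_max_dim => (j < n k)%N))/= [X in _ + X]big1 ?addr0.
  rewrite (big_ord_narrow (le_max_dim k)) le_eqVlt; apply/orP; left; apply/eqP.
  by apply: eq_bigr => v _; rewrite pad_vec_widen.
by move=> j jn; rewrite /pad_vec insubF ?(negbTE jn)//= expr0n.
Qed.

Lemma wt_pad_vec j : wt pad_vec (emb j) = rank_one x j.
Proof. by apply: eq_bigr => k _; rewrite ffunE pad_vec_widen. Qed.

End vectors.

(** A negative value of the form at the maximizer is made positive by flipping the sign of the
    vector in one direction [k0]. *)
Lemma inj_norm_le_form (R : realType) (F : tensor R n) (r0 : (0 < r)%N)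
    (n0 : forall k, (0 < n k)%N) :
  exists2 u : 'I_r -> 'I_max_dim -> R, forall k, \sum_j u k j ^+ 2 <= 1 &
    inj_norm F = form (padded F) u.
Proof.
have [x [x1 ->] _] := inj_norm_max n0 F.
have formE : form (padded F) (pad_vec x) = tensor_dot F (rank_one x).
  by rewrite /form sum_padded; apply: eq_bigr => j _; rewrite wt_pad_vec.
have [t0|t0] := leP 0 (tensor_dot F (rank_one x)).
  exists (pad_vec x); last by rewrite formE ger0_norm.
  by move=> k; exact: sum_pad_vec_sqr.
pose k0 := Ordinal r0.
exists (fun k j => (if k == k0 then -1 else 1) * pad_vec x k j).
  move=> k; under eq_bigr do rewrite exprMn.
  rewrite -mulr_sumr (_ : (if _ then _ else _) ^+ 2 = 1) ?mul1r ?sum_pad_vec_sqr//.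
  by case: ifP => _; rewrite ?sqrrN expr1n.
rewrite ltr0_norm// -formE /form -sumrN; apply: eq_bigr => i _.
rewrite -mulrN; congr (_ * _).
rewrite /wt big_split/= (_ : \prod_k (if k == k0 then -1 else 1) = -1) ?mulN1r//.
by rewrite (bigD1 k0)//= big1 ?mulr1// => k /negbTE ->.
Qed.

End padding.

Section padding_independence.
Context {R : realType} {d : measure_display} {T : measurableType d}.
Variable P : probability T R.
Context {r : nat} {n : 'I_r -> nat}.
Variable Y : tensor_index n -> T -> R.
Hypothesis mY : forall j, measurable_fun [set: T] (Y j).

Definition padded_rv (i : cube r (max_dim n)) (w : T) : R :=
  padded (fun j => Y j w) i.

Lemma padded_rvP (Q : (T -> R) -> Prop) i : (forall j, Q (Y j)) ->
  Q (fun=> 0) -> Q (padded_rv i).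
Proof.
by move=> QY Q0; rewrite /padded_rv /padded; case: unemb => [j|] /=.
Qed.

(** A padded coordinate is the constant 0, so its factor [f i 0] leaves the mean on both sides. *)
Lemma factorizes_padded : factorizes P Y -> factorizes P padded_rv.
Proof.
move=> facY f bf.
have bfY j : bounded_measurable (fun w => f (emb j) (Y j w)) by exact: bm_comp.
have E w : \prod_i f i (padded_rv i w) =
    \prod_(i : cube r (max_dim n) | ~~ isSome (unemb i)) f i 0 *
    \prod_j f (emb j) (Y j w).
  rewrite prod_split_emb mulrC; congr (_ * _).
    by apply: eq_bigr => i; rewrite /padded_rv /padded; case: unemb.
  by apply: eq_bigr => j _; rewrite /padded_rv padded_emb.
rewrite (eq_mean _ E) meanZ; last exact: bm_prod.
rewrite (facY (fun j => f (emb j)))// [RHS]prod_split_emb mulrC; congr (_ * _).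
  apply: eq_bigr => j _; apply: eq_mean => w.
  by rewrite /padded_rv padded_emb.
apply: eq_bigr => i; rewrite /padded_rv /padded; case: unemb => //= _.
by rewrite mean_cst.
Qed.

End padding_independence.

Lemma factorizes_scale (R : realType) (d : measure_display)
    (T : measurableType d) (P : probability T R) (I : finType)
    (X : I -> T -> R) (c : R) :
  factorizes P X -> factorizes P (fun i w => c * X i w).
Proof.
move=> facX f bf; apply: (facX (fun i t => f i (c * t))) => i.
by apply: bm_comp => //; exact: measurable_funM.
Qed.

Lemma max_sqrt_dim_ge (R : realType) (r : nat) (n : 'I_r -> nat) :
  (0 < r)%N -> Num.sqrt (max_dim n)%:R <= max_sqrt_dim R n.
Proof.
move=> r0; rewrite /max_dim.
have [|k ->] := @bigop.eq_bigmax _ n; first by rewrite card_ord.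
exact: (le_bigmax _ (fun k => Num.sqrt (n k)%:R : R)).
Qed.

Section upper_bound.
Context {R : realType} {r : nat}.
Variables (eps K : R).
Hypotheses (r0 : (0 < r)%N) (eps0 : 0 < eps) (K0 : 0 <= K).
Context {d : measure_display} {T : measurableType d}.
Variables (P : probability T R) (n : 'I_r -> nat).
Hypothesis n0 : forall k, (0 < n k)%N.
Variable Y : tensor_index n -> T -> R.
Hypothesis mY : forall j, measurable_fun [set: T] (Y j).
Hypothesis facY : factorizes P Y.

Lemma max_abs_entry_ge (F : tensor R n) j : `|F j| <= max_abs_entry F.
Proof. exact: (le_bigmax _ (fun j => `|F j|)). Qed.

Lemma max_abs_entry_ge0 (F : tensor R n) : 0 <= max_abs_entry F.
Proof. exact: bigmax_ge_id. Qed.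

Lemma measurable_max_abs_entry :
  measurable_fun [set: T] (fun w => max_abs_entry (fun j => Y j w)).
Proof.
rewrite /max_abs_entry; elim: (index_enum _) => [|j s IHs].
  by under eq_fun do rewrite big_nil; exact: measurable_cst.
under eq_fun do rewrite big_cons.
apply: measurable_maxr => //.
by apply: measurableT_comp.
Qed.

Lemma inj_norm_ge0 (F : tensor R n) : 0 <= inj_norm F.
Proof. by have [x [_ ->] _] := inj_norm_max n0 F. Qed.

(** Here [sg] is any scale bounding the moments, not the standard deviation itself, so that a
    degenerate law can be treated by letting [sg] tend to 0. *)
Lemma upper_scaled (sg : R) : 0 < sg ->
  (forall j, mean P (Y j) = 0) ->
  (forall j, (\int[P]_w (Y j w ^+ 2)%:E <= (sg ^+ 2)%:E)%E) ->
  (forall j, (\int[P]_w (`|Y j w| `^ (2 + eps))%:E <=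
    (K * sg `^ (2 + eps))%:E)%E) ->
  (\int[P]_w (inj_norm (fun j => Y j w))%:E <=
   (@upper_const R r eps K)%:E * ((sg * Num.sqrt (max_dim n)%:R)%:E +
    \int[P]_w (max_abs_entry (fun j => Y j w))%:E))%E.
Proof.
move=> sg0 Y0 Ysq Yp.
have N0 : (0 < max_dim n)%N by exact: leq_trans (n0 (Ordinal r0)) (le_max_dim _ _).
have sgi0 : 0 <= sg^-1 by rewrite invr_ge0 ltW.
pose Y' j w := sg^-1 * Y j w.
have mY' j : measurable_fun [set: T] (Y' j) by apply: measurable_funM.
have Ysq' j : (\int[P]_w (Y' j w ^+ 2)%:E <= 1)%E.
  have m2 : measurable_fun [set: T] (fun w => Y j w ^+ 2) by exact: measurable_funX.
  under eq_integral do rewrite exprMn.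
  rewrite ge0_integral_scaler ?sqr_ge0//; last by move=> w; exact: sqr_ge0.
  apply: (@le_trans _ _ ((sg^-1 ^+ 2)%:E * (sg ^+ 2)%:E)%E).
    by rewrite lee_wpmul2l// lee_fin sqr_ge0.
  by rewrite -EFinM lee_fin -exprMn mulVf ?gt_eqF// expr1n.
have e2 : 0 < 2 + eps by rewrite addr_gt0.
have Yp' j : (\int[P]_w (`|Y' j w| `^ (2 + eps))%:E <= K%:E)%E.
  have mp : measurable_fun [set: T] (fun w => `|Y j w| `^ (2 + eps)).
    apply: (measurableT_comp (@measurable_powR R (2 + eps))).
    exact: (measurableT_comp (@normr_measurable R setT)).
  rewrite (eq_integral (fun w => (sg^-1 `^ (2 + eps) * `|Y j w| `^ (2 + eps))%:E)).
    rewrite ge0_integral_scaler ?powR_ge0//.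
    apply: (@le_trans _ _ ((sg^-1 `^ (2 + eps))%:E * (K * sg `^ (2 + eps))%:E)%E).
      by rewrite lee_wpmul2l// lee_fin powR_ge0.
    rewrite -EFinM lee_fin mulrCA -powRM ?(ltW sg0)// mulVf ?gt_eqF//.
    by rewrite powR1 mulr1.
  by move=> w _; rewrite normrM (ger0_norm sgi0) powRM.
have Y0' j : mean P (Y' j) = 0.
  have iY : P.-integrable [set: T] (EFin \o Y j).
    have := integrableZl measurableT sg (sqr_integrable (mY' j)
      (le_lt_trans (Ysq' j) (ltry 1))).
    congr integrable; apply/funext => w /=.
    by rewrite -EFinM /Y' mulrA mulfV ?gt_eqF// mul1r.
  by rewrite /mean /Y' RintegralZl// -/(mean P (Y j)) Y0 mulr0.
pose X := padded_rv Y'.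
have PX (Q : (T -> R) -> Prop) : (forall j, Q (Y' j)) -> Q (fun=> 0) ->
  forall i, Q (X i) by move=> QY Q0 i; exact: padded_rvP.
have mX : forall i, measurable_fun [set: T] (X i).
  by apply: (PX (fun f => measurable_fun [set: T] f)).
have Xsq : forall i, (\int[P]_w (X i w ^+ 2)%:E <= 1)%E.
  apply: (PX (fun f => (\int[P]_w (f w ^+ 2)%:E <= 1)%E)) => //.
  under eq_integral do rewrite expr0n.
  by rewrite (integral_mean P (bm_cst 0)) mean_cst lee_fin ler01.
have Xp : forall i, (\int[P]_w (`|X i w| `^ (2 + eps))%:E <= K%:E)%E.
  apply: (PX (fun f => (\int[P]_w (`|f w| `^ (2 + eps))%:E <= K%:E)%E)) => //.
  under eq_integral do rewrite normr0 powR0 ?gt_eqF//.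
  by rewrite (integral_mean P (bm_cst 0)) mean_cst lee_fin.
have X0 : forall i, mean P (X i) = 0.
  by apply: (PX (fun f => mean P f = 0)) => //; exact: mean_cst.
have facX : factorizes P X.
  by apply: factorizes_padded => //; exact: factorizes_scale.
pose M w := sg^-1 * max_abs_entry (fun j => Y j w).
have mM : measurable_fun [set: T] M.
  by apply: measurable_funM => //; exact: measurable_max_abs_entry.
have M_ge i w : `|X i w| <= M w.
  move: i; apply: (PX (fun f => `|f w| <= M w)) => [j|].
    by rewrite /Y' normrM (ger0_norm sgi0) ler_wpM2l// (max_abs_entry_ge (fun j => Y j w)).
  by rewrite normr0 mulr_ge0// max_abs_entry_ge0.
have [H [mH H0 HX HI]] := @core_upper R r eps K r0 eps0 K0 _ T P (max_dim n) X
  N0 mX facX (fun i c c0 => mean_trunc_le (mX i) (Xsq i) (X0 i) c0)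
  (fun i c _ => mean_trunc_sqr (mX i) (Xsq i) c)
  (fun i t t0 => mean_tail_sqr (mX i) (Xsq i) t0)
  (fun i t t1 => mean_tail_powR (mX i) e2 (lt_le_trans ltr01 t1) (Xp i))
  Xsq M mM M_ge.
apply: (@le_trans _ _ (\int[P]_w (sg * H w)%:E)%E).
  apply: ge0_le_integral_pointwise => w; first exact: inj_norm_ge0.
  have [u u1 ->] := inj_norm_le_form (fun j => Y j w) r0 n0.
  have -> : form (padded (fun j => Y j w)) u = sg * form (fun i => X i w) u.
    rewrite /form !sum_padded mulr_sumr; apply: eq_bigr => j _.
    by rewrite /Y' !mulrA mulfV ?gt_eqF// mul1r.
  by rewrite ler_wpM2l ?(ltW sg0)// HX.
rewrite ge0_integral_scaler// ?(ltW sg0)//.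
apply: (@le_trans _ _ (sg%:E * ((@upper_const R r eps K)%:E *
    ((Num.sqrt (max_dim n)%:R)%:E + \int[P]_w (M w)%:E)))%E).
  by rewrite lee_wpmul2l// lee_fin ltW.
rewrite muleCA; apply: lee_wpmul2l; first by rewrite lee_fin ltW ?upper_const_gt0.
rewrite ge0_integral_scaler//; last 2 first.
- exact: measurable_max_abs_entry.
- by move=> w; exact: max_abs_entry_ge0.
rewrite [leLHS]ge0_muleDr ?lee_fin ?sqrtr_ge0//; last first.
  rewrite mule_ge0 ?lee_fin//; apply: integral_ge0 => w _.
  by rewrite lee_fin max_abs_entry_ge0.
by rewrite -EFinM leeD2l// muleA -EFinM mulfV ?gt_eqF// mul1e.
Qed.

End upper_bound.

(** * Lower bound *)

Section inj_norm_lower.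
Context {R : realType} {r : nat} {n : 'I_r -> nat}.
Hypothesis n0 : forall k, (0 < n k)%N.
Variable F : tensor R n.

Let inj_norm_ge (y : forall k : 'I_r, 'rV[R]_(n k)) :
  (forall k, l2norm (y k) = 1) -> `|tensor_dot F (rank_one y)| <= inj_norm F.
Proof. by have [x [_ ->] xmax] := inj_norm_max n0 F; exact: xmax. Qed.

Lemma inj_norm_ge_entry (j : tensor_index n) : `|F j| <= inj_norm F.
Proof.
apply: le_trans (inj_norm_ge (y := fun k => delta_mx ord0 (j k)) _); last first.
  by move=> k; exact: l2norm_delta.
rewrite /tensor_dot (bigD1 j)//= big1 ?addr0.
  rewrite /rank_one big1 ?mulr1// => k _; by rewrite mxE !eqxx.
move=> i ij; have [k ik] : exists k, i k != j k.
  apply/existsP; rewrite -negb_forall; apply: contra ij => /forallP h.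
  by apply/eqP/ffunP => k; apply/eqP; exact: h.
by rewrite /rank_one (bigD1 k)//= mxE (negbTE ik) andbF mul0r mulr0.
Qed.

Lemma inj_norm_ge_max : max_abs_entry F <= inj_norm F.
Proof.
apply/bigmax_leP; split=> [|j _]; last exact: inj_norm_ge_entry.
exact: inj_norm_ge0.
Qed.

Definition line (j : tensor_index n) (k : 'I_r) (v : 'I_(n k)) : tensor_index n :=
  finfun (eqtype.dfwith (fun l => j l) v).

Lemma line_in j k v : line j v k = v :> 'I_(n k).
Proof. by rewrite /line ffunE dfwith_in. Qed.

Lemma line_out j k (v : 'I_(n k)) l : l != k -> line j v l = j l.
Proof. by move=> lk; rewrite /line ffunE dfwith_out// eq_sym. Qed.

(** Test vectors: in direction [k] the sign vector of the line, normalized by the square root of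
    [n k]; in the other directions the basis vectors given by [j]. *)
Lemma inj_norm_ge_line (j : tensor_index n) (k : 'I_r) :
  (Num.sqrt (n k)%:R)^-1 * \sum_(v < n k) `|F (line j v)| <= inj_norm F.
Proof.
set c := (Num.sqrt (n k)%:R)^-1.
have nk0 : 0 < (n k)%:R :> R by rewrite ltr0n.
have c0 : 0 < c by rewrite invr_gt0 sqrtr_gt0.
pose sgn (v : 'I_(n k)) : R := if 0 <= F (line j v) then 1 else -1.
pose yk : 'rV[R]_(n k) := \row_v (c * sgn v).
pose y : forall l, 'rV[R]_(n l) := eqtype.dfwith (fun l => delta_mx ord0 (j l)) yk.
have yin : y k = yk by rewrite /y dfwith_in.
have yout l : l != k -> y l = delta_mx ord0 (j l).
  by move=> lk; rewrite /y dfwith_out// eq_sym.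
have y1 l : l2norm (y l) = 1.
  have [->|lk] := eqVneq l k; last by rewrite yout// l2norm_delta.
  rewrite yin /l2norm (eq_bigr (fun=> c ^+ 2)).
    rewrite sumr_const card_ord -mulr_natr exprVn sqr_sqrtr ?ltW// mulVf ?sqrtr1//.
    by rewrite gt_eqF.
  move=> v _; rewrite mxE exprMn /sgn; case: ifP => _.
    by rewrite expr1n mulr1.
  by rewrite sqrrN expr1n mulr1.
apply: le_trans (inj_norm_ge y1); apply: le_trans (ler_norm _).
rewrite /tensor_dot (bigID (fun i : tensor_index n =>
  [forall l, (l != k) ==> (i l == j l)]))/= [X in _ <= _ + X]big1 ?addr0; last first.
  move=> i /forallPn[l]; rewrite negb_imply => /andP[lk il].
  by rewrite /rank_one (bigD1 l)//= yout// mxE (negbTE il) andbF mul0r mulr0.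
rewrite (reindex_onto (fun v => line j v) (fun i : tensor_index n => i k)); last first.
  move=> i /forallP ij; apply/ffunP => l.
  have [E|lk] := eqVneq l k; first by move: E => {l} ->; rewrite line_in.
  by rewrite line_out//; apply/esym/eqP; have := ij l; rewrite lk.
rewrite mulr_sumr (eq_bigl xpredT) => [|v]; last first.
  rewrite line_in eqxx andbT; apply/forallP => l; apply/implyP => lk.
  by rewrite line_out.
apply: ler_sum => v _; rewrite /rank_one (bigD1 k)//= yin line_in mxE.
rewrite big1 => [|l lk]; last by rewrite yout// mxE line_out// !eqxx.
rewrite mulr1 mulrCA ler_wpM2l ?(ltW c0)// /sgn.
have [F0|F0] := leP 0 (F (line j v)); first by rewrite mulr1 ger0_norm.
by rewrite mulrN1 ltr0_norm.
Qed.

End inj_norm_lower.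

Lemma sqrt_le_max_sqrt_dim (R : realType) (r : nat) (n : 'I_r -> nat) :
  max_sqrt_dim R n <= Num.sqrt (max_dim n)%:R.
Proof.
apply/bigmax_leP; split=> [|k _]; first exact: sqrtr_ge0.
by rewrite ler_wsqrtr// ler_nat le_max_dim.
Qed.

Section first_absolute_moment.
Context {R : realType} {d : measure_display} {T : measurableType d}.
Variables (P : probability T R) (Z : T -> R) (eps K sg : R).
Hypothesis mZ : measurable_fun [set: T] Z.
Hypotheses (eps0 : 0 < eps) (K0 : 0 < K) (sg0 : 0 <= sg).

(** The factor [B] with [B^eps = 2K]: above the level [sg * B] the moment of order [2 + eps] leaves
    at most half of the second moment. *)
Definition abs_const : R := (2 * K) `^ eps^-1.

Lemma abs_const_gt0 : 0 < abs_const.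
Proof. by rewrite powR_gt0// mulr_gt0. Qed.

Lemma abs_moment_ge :
  (\int[P]_w (Z w ^+ 2)%:E = (sg ^+ 2)%:E)%E ->
  (\int[P]_w (`|Z w| `^ (2 + eps))%:E <= (K * sg `^ (2 + eps))%:E)%E ->
  ((sg / (2 * abs_const))%:E <= \int[P]_w (`|Z w|)%:E)%E.
Proof.
move=> Z2 Zp.
have [s0|s0] := eqVneq sg 0.
  by rewrite s0 mul0r integral_ge0// => w _; rewrite lee_fin.
have sgt : 0 < sg by rewrite lt_def s0.
have e2 : 0 < 2 + eps by rewrite addr_gt0.
have B0 := abs_const_gt0; set B := abs_const in B0 *.
have Beps : B `^ eps = 2 * K.
  by rewrite /B /abs_const -powRrM mulVf ?gt_eqF// powRr1// mulr_ge0// ltW.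
pose A := sg * B; have A0 : 0 < A by rewrite mulr_gt0.
have Aeps : 0 < A `^ eps by rewrite powR_gt0.
have mabs : measurable_fun [set: T] (fun w => `|Z w|).
  exact: (measurableT_comp (@normr_measurable R setT)).
have mp : measurable_fun [set: T] (fun w => `|Z w| `^ (2 + eps)).
  exact: (measurableT_comp (@measurable_powR R (2 + eps))).
have le1 : ((sg ^+ 2)%:E <= A%:E * \int[P]_w (`|Z w|)%:E +
    (2^-1 * sg ^+ 2)%:E)%E.
  (* Up to [A] one has [Z^2 <= A |Z|], and above it [Z^2 <= |Z|^(2+eps) / A^eps]. *)
  rewrite -Z2; apply: (@le_trans _ _ (\int[P]_w (A * `|Z w| +
      (A `^ eps)^-1 * `|Z w| `^ (2 + eps))%:E)%E).
    apply: ge0_le_integral_pointwise => w; first exact: sqr_ge0.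
    rewrite -[leLHS]real_normK ?num_real//.
    have [ZA|ZA] := leP `|Z w| A.
      rewrite -[leLHS]addr0 lerD//; first by rewrite expr2 ler_wpM2r.
      by rewrite mulr_ge0 ?invr_ge0 ?powR_ge0.
    rewrite -[leLHS]add0r lerD//; first by rewrite mulr_ge0// ltW.
    rewrite mulrC ler_pdivlMr// powRD; last by rewrite (gt_eqF e2).
    rewrite powR_mulrn// ler_wpM2l ?sqr_ge0// ge0_ler_powR ?nnegrE ?(ltW A0) ?(ltW eps0)//.
    exact: ltW.
  rewrite ge0_integral_addr//; last 4 first.
  - exact: measurable_funM.
  - exact: measurable_funM.
  - by move=> w; rewrite mulr_ge0// ltW.
  - by move=> w; rewrite mulr_ge0 ?invr_ge0 ?powR_ge0.
  rewrite ge0_integral_scaler ?(ltW A0)// leeD2l//.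
  rewrite ge0_integral_scaler ?invr_ge0 ?powR_ge0//.
  apply: (@le_trans _ _ ((A `^ eps)^-1%:E * (K * sg `^ (2 + eps))%:E)%E).
    by rewrite lee_wpmul2l// lee_fin invr_ge0 powR_ge0.
  rewrite -EFinM lee_fin /A powRM ?(ltW sgt) ?(ltW B0)// Beps powRD ?(gt_eqF e2)//.
  rewrite powR_mulrn ?(ltW sgt)// le_eqVlt; apply/orP; left; apply/eqP.
  by field; rewrite !gt_eqF// powR_gt0.
have : (0 <= \int[P]_w (`|Z w|)%:E)%E.
  by apply: integral_ge0 => w _; rewrite lee_fin.
move: le1; case: (\int[P]_w (`|Z w|)%:E)%E => [m| |]; [|by move=> *; rewrite leey|by []].
rewrite -EFinM -EFinD !lee_fin => m1 m0.
have B2 : 0 < 2 * B by rewrite mulr_gt0.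
rewrite (ler_pdivrMr _ _ B2) -(ler_pM2l sgt).
by move: m1; rewrite /A expr2; lra.
Qed.

End first_absolute_moment.

(** The line is taken along a longest side: its [n k] entries, each of absolute mean at least [m],
    are divided by the square root of [n k]. *)
Lemma inj_norm_mean_ge (R : realType) (r : nat) (n : 'I_r -> nat)
    (d : measure_display) (T : measurableType d) (P : probability T R)
    (Y : tensor_index n -> T -> R) (m : R) : (0 < r)%N ->
  (forall k, (0 < n k)%N) -> (forall j, measurable_fun [set: T] (Y j)) -> 0 <= m ->
  (forall j, (m%:E <= \int[P]_w (`|Y j w|)%:E)%E) ->
  ((m * max_sqrt_dim R n)%:E <= \int[P]_w (inj_norm (fun j => Y j w))%:E)%E.
Proof.
move=> r0 n0 mY m0 Ym.
apply: (@le_trans _ _ (m * Num.sqrt (max_dim n)%:R)%:E).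
  by rewrite lee_fin ler_wpM2l// sqrt_le_max_sqrt_dim.
rewrite /max_dim; have [|k ->] := @bigop.eq_bigmax _ n; first by rewrite card_ord.
pose j0 : tensor_index n := finfun (fun l => Ordinal (n0 l)).
have nk0 : 0 < (n k)%:R :> R by rewrite ltr0n.
pose c : R := (Num.sqrt (n k)%:R)^-1.
have c0 : 0 <= c by rewrite invr_ge0 sqrtr_ge0.
have mabs j : measurable_fun [set: T] (fun w => `|Y j w|).
  exact: (measurableT_comp (@normr_measurable R setT)).
apply: (@le_trans _ _ (\int[P]_w (c * \sum_(v < n k) `|Y (line j0 v) w|)%:E)%E); last first.
  apply: ge0_le_integral_pointwise => w; first by rewrite mulr_ge0// sumr_ge0.
  exact: (inj_norm_ge_line n0 (fun j => Y j w)).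
rewrite ge0_integral_scaler//; last 2 first.
- by apply: measurable_sum.
- by move=> w; apply: sumr_ge0.
under eq_integral do rewrite -sumEFin.
rewrite ge0_integral_sum//; last by move=> v; exact/measurable_EFinP.
apply: (@le_trans _ _ (c%:E * \sum_(v < n k) m%:E)%E); last first.
  by rewrite lee_wpmul2l// ?lee_fin//; apply: lee_sum => v _; exact: Ym.
rewrite sumEFin -EFinM lee_fin sumr_const card_ord -[m *+ _]mulr_natr mulrCA.
rewrite ler_wpM2l// /c mulrC ler_pdivlMr ?sqrtr_gt0// -expr2 sqr_sqrtr//.
Qed.

Theorem theorem1p7 (R : realType) (r : nat) (hr : (1 <= r)%N)
    (eps : R) (heps : 0 < eps < 1) (K : R) (hK : 1 <= K) :
  exists c C : R, 0 < c /\ 0 < C /\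
    forall (n : 'I_r -> nat) (hn : forall k : 'I_r, (1 <= n k)%N)
      (dZ : measure_display) (OmegaZ : measurableType dZ)
      (PZ : probability OmegaZ R) (Z : {RV PZ >-> R}),
    'E_PZ[Z]%E = 0%E ->
    ('E_PZ[fun w => (Z w ^+ 2)%R] < +oo)%E ->
    let sigma : R := Num.sqrt (fine 'E_PZ[fun w => (Z w ^+ 2)%R]%E) in
    ('E_PZ[fun w => (`|Z w| `^ (2 + eps))%R] <= (K * sigma `^ (2 + eps))%:E)%E ->
    forall (d : measure_display) (Omega : measurableType d)
      (P : probability Omega R) (T : tensor_index n -> {RV P >-> R}),
    iid_copies T Z ->
    let Q : \bar R :=
      ((sigma * max_sqrt_dim R n)%:E
       + 'E_P[fun w => max_abs_entry (fun i => T i w)])%E in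
    (c%:E * Q <= 'E_P[fun w => inj_norm (fun i => T i w)])%E /\
    ('E_P[fun w => inj_norm (fun i => T i w)] <= C%:E * Q)%E.
Proof.
have /andP[eps0 _] := heps.
have K0 : 0 < K by exact: lt_le_trans hK.
pose B := @abs_const R eps K.
have B0 : 0 < B by exact: abs_const_gt0.
pose C := @upper_const R r eps K.
have C0 : 0 < C by exact: upper_const_gt0.
(* Half of the constants [1] and [1 / (2 B)] of the two lower bounds, which are averaged below. *)
pose c : R := Num.min 2^-1 (2 * (2 * B))^-1.
have c0 : 0 < c by rewrite lt_min !invr_gt0 !mulr_gt0 ?ltr0n.
exists c, C; split => //; split => // n hn dZ OmegaZ PZ Z.
rewrite expectation.unlock => Z0 Z2 sigma Zp d Omega P T [indT lawT] Q.
have mT j : measurable_fun [set: Omega] (T j) by exact: measurable_funPT.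
have mZ : measurable_fun [set: OmegaZ] Z by exact: measurable_funPT.
have sigma0 : 0 <= sigma by exact: sqrtr_ge0.
have Z2_ge0 : (0 <= \int[PZ]_w (Z w ^+ 2)%:E)%E.
  by apply: integral_ge0 => w _; rewrite lee_fin sqr_ge0.
have Z2E : (\int[PZ]_w (Z w ^+ 2)%:E = (sigma ^+ 2)%:E)%E.
  by rewrite sqr_sqrtr ?fine_ge0// fineK// ge0_fin_numE.
have facT : factorizes P (fun j => T j : Omega -> R).
  exact: independent_factorizes.
have T2 j : (\int[P]_w (T j w ^+ 2)%:E = (sigma ^+ 2)%:E)%E.
  rewrite -Z2E; apply: (same_law_ge0_integral (lawT j) (g := fun t => t ^+ 2)) => //.
  by move=> x; exact: sqr_ge0.
have T1 j : mean P (T j) = 0.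
  rewrite /mean /Rintegral (same_law_integral (lawT j)) ?Z0//.
    by apply: sqr_integrable; rewrite ?T2 ?ltry.
  exact: sqr_integrable.
have Tp j : (\int[P]_w (`|T j w| `^ (2 + eps))%:E <= (K * sigma `^ (2 + eps))%:E)%E.
  apply: le_trans Zp; rewrite (same_law_ge0_integral (lawT j) (g := fun t => `|t| `^ (2 + eps)))//.
  exact: (measurableT_comp (@measurable_powR R (2 + eps)) (@normr_measurable R setT)).
have Tabs j : ((sigma / (2 * B))%:E <= \int[P]_w (`|T j w|)%:E)%E.
  rewrite (same_law_ge0_integral (lawT j) (g := fun t => `|t|))//.
  exact: abs_moment_ge.
pose IM := (\int[P]_w (max_abs_entry (fun j => T j w))%:E)%E.
pose IN := (\int[P]_w (inj_norm (fun j => T j w))%:E)%E.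
have IM0 : (0 <= IM)%E.
  by apply: integral_ge0 => w _; rewrite lee_fin max_abs_entry_ge0.
have QE : Q = ((sigma * max_sqrt_dim R n)%:E + IM)%E by [].
have msd0 : 0 <= max_sqrt_dim R n by exact: bigmax_ge_id.
rewrite QE -/IN; split.
  have IN0 : (0 <= IN)%E.
    by apply: integral_ge0 => w _; rewrite lee_fin inj_norm_ge0.
  have low1 : ((sigma / (2 * B) * max_sqrt_dim R n)%:E <= IN)%E.
    by apply: inj_norm_mean_ge => //; rewrite divr_ge0// mulr_ge0// ltW.
  have low2 : (IM <= IN)%E.
    apply: ge0_le_integral_pointwise => w; first exact: max_abs_entry_ge0.
    exact: inj_norm_ge_max.
  have -> : IN = ((2^-1)%:E * IN + (2^-1)%:E * IN)%E.
    rewrite -ge0_muleDl ?lee_fin ?invr_ge0// -EFinD.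
    by rewrite (_ : 2^-1 + 2^-1 = 1 :> R) ?mul1e//; lra.
  rewrite [leLHS]ge0_muleDr ?lee_fin ?mulr_ge0//; apply: leeD.
    apply: (@le_trans _ _ ((2^-1)%:E * (sigma / (2 * B) * max_sqrt_dim R n)%:E)%E).
      rewrite -!EFinM lee_fin mulrA [leRHS]mulrA ler_wpM2r//.
      by rewrite [leRHS]mulrCA [leLHS]mulrC ler_wpM2l// -invfM ge_min lexx orbT.
    by rewrite lee_wpmul2l// lee_fin invr_ge0.
  apply: (@le_trans _ _ ((2^-1)%:E * IM)%E).
    by rewrite lee_wpmul2r// lee_fin ge_min lexx.
  by rewrite lee_wpmul2l// lee_fin invr_ge0.
have sN := max_sqrt_dim_ge R n hr.
have [s0|s0] := eqVneq sigma 0; last first.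
  have sgt : 0 < sigma by rewrite lt_def s0.
  apply: le_trans (upper_scaled hr eps0 (ltW K0) hn mT facT sgt T1 _ Tp) _.
    by move=> j; rewrite T2.
  by rewrite lee_wpmul2l ?lee_fin ?(ltW C0)// leeD2r// lee_fin ler_wpM2l.
(* sigma = 0: apply the bound at an arbitrary scale sg > 0 and let sg -> 0 *)
apply/lee_addgt0Pr => e e0.
have N0 : 0 < Num.sqrt (max_dim n)%:R :> R.
  rewrite sqrtr_gt0 ltr0n.
  by apply: leq_trans (hn (Ordinal hr)) (le_max_dim _ _).
pose sg := e / (C * Num.sqrt (max_dim n)%:R).
have sg0 : 0 < sg by rewrite divr_gt0// mulr_gt0.
apply: le_trans (upper_scaled hr eps0 (ltW K0) hn mT facT sg0 T1 _ _) _.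
- by move=> j; rewrite T2 s0 expr0n lee_fin sqr_ge0.
- move=> j; apply: le_trans (Tp j) _; rewrite s0 lee_fin powR0 ?mulr0.
    by rewrite mulr_ge0 ?powR_ge0// ltW.
  by rewrite gt_eqF// addr_gt0.
have sgN0 : 0 <= sg * Num.sqrt (max_dim n)%:R by rewrite mulr_ge0// ltW.
rewrite s0 mul0r add0e -/IM -/C [leLHS]ge0_muleDr ?lee_fin//.
rewrite addeC leeD2l// -EFinM lee_fin /sg le_eqVlt; apply/orP; left; apply/eqP.
by field; rewrite !gt_eqF.
Qed.
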